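(* Let $d\in\{2,3\}$, $\alpha\in\mathbb{R}$, and let $1<p<q<\infty$, with $p\in(3/2,3)$ if $d=3$. If $s>0$ satisfies $$s<\frac dp-d+2\qquad\text{and}\qquad \frac sd=\frac1p-\frac1q,$$ then there exists a constant $C=C(d,p,q)>0$ such that for any $\phi\in H^{s,p}_\alpha(\mathbb{R}^d)$ we have $\phi\in L^q(\mathbb{R}^d)$ and $$\|\phi\|_{L^q(\mathbb{R}^d)}\le C\|\phi\|_{H^{s,p}_\alpha(\mathbb{R}^d)}.$$
   Context: Function spaces consist of complex-valued functions, and $\alpha$ is fixed. $H^{s,p}(\mathbb{R}^d)=\{u\in L^p(\mathbb{R}^d): (1-\Delta)^{s/2}u\in L^p(\mathbb{R}^d)\}$ is the usual Bessel potential space. Green function. For $\omega\in\mathbb{C}\setminus(-\infty,0]$ (principal branches of $\sqrt{\cdot}$ and $\ln$), $\mathbb{G}_\omega(x)=\frac{1}{2\pi}K_0(\sqrt{\omega}|x|)$ if $d=2$ ($K_0$ the modified Bessel function of the second kind) and $\mathbb{G}_\omega(x)=\frac{e^{-\sqrt\omega|x|}}{4\pi|x|}$ if $d=3$; so $(\omega-\Delta)\mathbb{G}_\omega=\delta_0$. Set $c(\omega)=\frac{\gamma-\ln2}{2\pi}+\frac1{4\pi}\ln\omega$ if $d=2$ ($\gamma$ the Euler–Mascheroni constant) and $c(\omega)=\frac{\sqrt\omega}{4\pi}$ if $d=3$. For $\alpha\in\mathbb{R}$ let $E_\alpha$ denote the unique root of $\alpha+c(\omega)=0$, if it exists: $E_\alpha=4e^{-4\pi\alpha-2\gamma}$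 if $d=2$; $E_\alpha=(4\pi\alpha)^2$ if $d=3$, $\alpha<0$; it does not exist if $d=3$, $\alpha\ge0$. Then $\sigma(\Delta_\alpha)=(-\infty,0]\cup\{E_\alpha\}$ (only $(-\infty,0]$ if $E_\alpha$ does not exist). Put $\omega_\alpha=E_\alpha$ if $E_\alpha$ exists and $\omega_\alpha=0$ otherwise. Operator. Let $p\in(1,\infty)$ if $d=2$, $p\in(3/2,3)$ if $d=3$. The singular-perturbed Laplacian $\Delta_\alpha$ on $L^p(\mathbb{R}^d)$ has domain $$H^{2,p}_\alpha(\mathbb{R}^d)=\mathcal{D}_p(\Delta_\alpha)=\Big\{\phi\in L^p(\mathbb{R}^d): \phi=g+\tfrac{g(0)}{\alpha+c(\omega)}\mathbb{G}_\omega,\ g\in H^{2,p}(\mathbb{R}^d)\Big\}$$ and action $(\omega-\Delta_\alpha)\phi=(\omega-\Delta)g$, for any $\omega\in\mathbb{C}\setminus\sigma(\Delta_\alpha)$ (the definition does not depend on $\omega$). For real $\omega>\omega_\alpha$ its resolvent is the bounded operator on $L^p$ given by $(\omega-\Delta_\alpha)^{-1}f=(\omega-\Delta)^{-1}f+\frac{1}{\alpha+c(\omega)}\langle f,\mathbb{G}_\omega\rangle\mathbb{G}_\omega$, where $\langle f,h\rangle=\int f\overline h\,dx$. Fractional spaces. For $s\in(0,2)$ and a fixed real $\omega>\omega_\alpha$, the operator $(\omega-\Delta_\alpha)^{-s/2}=\frac{\sin(s\pi/2)}{\pi}\int_0^\infty t^{-s/2}(\omega+t-\Delta_\alpha)^{-1}\,dt$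 is bounded and injective on $L^p(\mathbb{R}^d)$; $H^{s,p}_\alpha(\mathbb{R}^d)$ is defined as its range, $(\omega-\Delta_\alpha)^{s/2}:H^{s,p}_\alpha(\mathbb{R}^d)\to L^p(\mathbb{R}^d)$ is its inverse, and $\|\phi\|_{H^{s,p}_\alpha}=\|(\omega-\Delta_\alpha)^{s/2}\phi\|_{L^p}$. *)

(* Defs.v *)
From HB Require Import structures.
From mathcomp Require Import all_boot all_order all_algebra.
From mathcomp Require Import all_classical all_reals all_analysis.
From mathcomp Require Import complex.

Set Implicit Arguments.
Unset Strict Implicit.
Unset Printing Implicit Defensive.

Import Order.TTheory GRing.Theory Num.Theory.
Import numFieldNormedType.Exports.

Local Open Scope classical_set_scope.
Local Open Scope complex_scope.
Local Open Scope ring_scope.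

(* R^n is 'rV[R]_n, with the product (= Borel) sigma-algebra; mathcomp-analysis
   only equips tuples with it. *)
Definition measure_rV_display : measure_display -> measure_display.
Proof. exact. Qed.

Section measurable_rV.
Context {disp : measure_display} {T : measurableType disp} (n : nat).

Definition rV_coord (i : 'I_n) (x : 'rV[T]_n) : T := x ord0 i.

Let rV_set0 : g_sigma_preimage rV_coord set0.
Proof. exact: sigma_algebra0. Qed.

Let rV_setC A : g_sigma_preimage rV_coord A -> g_sigma_preimage rV_coord (~` A).
Proof. exact: sigma_algebraC. Qed.

Let rV_bigcup (F : _^nat) : (forall i, g_sigma_preimage rV_coord (F i)) ->
  g_sigma_preimage rV_coord (\bigcup_i (F i)).
Proof. exact: sigma_algebra_bigcup. Qed.

HB.instance Definition _ := @isMeasurable.Build (measure_rV_display disp)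
  'rV[T]_n (g_sigma_preimage rV_coord) rV_set0 rV_setC rV_bigcup.

Lemma measurable_fun_rVP (d1 : measure_display) (T1 : measurableType d1)
    (f : T1 -> 'rV[T]_n) :
  (forall i, measurable_fun [set: T1] (fun x => f x ord0 i)) ->
  measurable_fun [set: T1] f.
Proof.
move=> mf.
suff prefS : g_sigma_preimage (fun i => rV_coord i \o f) `<=` measurable.
  move=> _ A mA; apply: prefS.
  by rewrite g_sigma_preimage_comp; exists A.
apply: smallest_sub; first exact: sigma_algebra_measurable.
move=> A; elim/big_ind : _ => //= [X Y hX hY [/hX|/hY]|i _ [B mB <-]] //.
exact: mf.
Qed.

Lemma measurable_rV_coord (i : 'I_n) :
  measurable_fun [set: 'rV[T]_n] (rV_coord i).
Proof.
move=> _ Y mY; rewrite setTI; apply: sub_sigma_algebra => /=.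
rewrite -bigcup_seq/=; exists i => /=; first by rewrite mem_index_enum.
by exists Y => //; rewrite setTI.
Qed.

End measurable_rV.

Section lebesgue_rV.
Context {R : realType}.

Definition rVcons (n : nat) (x : R * 'rV[R]_n) : 'rV[R]_n.+1 :=
  \row_i oapp (fun j => x.2 ord0 j) x.1 (unlift ord0 i).

Lemma measurable_rVcons (n : nat) :
  measurable_fun [set: R * 'rV[R]_n] (@rVcons n).
Proof.
apply: measurable_fun_rVP => i.
rewrite /rVcons.
under eq_fun do rewrite mxE.
case: (unlift ord0 i) => [j|] /=; last exact: measurable_fst.
exact: (measurableT_comp (measurable_rV_coord j) measurable_snd).
Qed.

Definition lebesgue_rVS (n : nat) (mu : {measure set 'rV[R]_n -> \bar R})
    : set 'rV[R]_n.+1 -> \bar R :=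
  pushforward (@lebesgue_measure R \x^ mu)%E (@rVcons n).

Let lebesgue_rVS0 (n : nat) (mu : {measure set 'rV[R]_n -> \bar R}) :
  lebesgue_rVS mu set0 = 0%E.
Proof. by rewrite /lebesgue_rVS /pushforward preimage_set0 measure0. Qed.

Let lebesgue_rVS_ge0 (n : nat) (mu : {measure set 'rV[R]_n -> \bar R}) A :
  (0 <= lebesgue_rVS mu A)%E.
Proof. by rewrite /lebesgue_rVS /pushforward. Qed.

Let lebesgue_rVS_sigma_additive (n : nat)
    (mu : {measure set 'rV[R]_n -> \bar R}) :
  semi_sigma_additive (lebesgue_rVS mu).
Proof. by apply: measure_semi_sigma_additive; exact: measurable_rVcons. Qed.

HB.instance Definition _ (n : nat) (mu : {measure set 'rV[R]_n -> \bar R}) :=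
  isMeasure.Build _ _ _ (lebesgue_rVS mu) (lebesgue_rVS0 mu)
    (lebesgue_rVS_ge0 mu) (@lebesgue_rVS_sigma_additive n mu).

Fixpoint lebesgue_rV (n : nat) : {measure set 'rV[R]_n -> \bar R} :=
  if n is n'.+1 then lebesgue_rVS (lebesgue_rV n') else \d_ (0 : 'rV[R]_0).

Lemma lebesgue_rV_box (n : nat) (A : 'I_n -> set R) :
  (forall i, measurable (A i)) ->
  lebesgue_rV n [set x | forall i, A i (x ord0 i)] =
  (\prod_(i < n) @lebesgue_measure R (A i))%E.
Proof.
elim: n A => [|n IH] A mA /=.
  rewrite big_ord0 /= diracE mem_set //. by case.
rewrite /= /lebesgue_rVS /pushforward.
set B := (X in product_measure2 _ _ X).
rewrite (_ : B =
    A ord0 `*` [set x : 'rV[R]_n | forall i, A (lift ord0 i) (x ord0 i)]).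
  rewrite product_measure2E ?big_ord_recl.
  - by congr (_ * _)%E; exact: (IH (fun i => A (lift ord0 i)) (fun i => mA _)).
  - exact: mA.
  - rewrite (_ : [set x : 'rV[R]_n | _] =
      \bigcap_(i in [set: 'I_n]) (rV_coord i @^-1` A (lift ord0 i))).
    apply: fin_bigcap_measurable; first exact: finite_finset.
    move=> i _; rewrite -[X in measurable X]setTI; exact: measurable_rV_coord.
  by apply/seteqP; split => x /= h i; [move=> _|]; exact: h.
apply/seteqP; split => -[a v] /= h.
  split. by have := h ord0; rewrite mxE unlift_none.
  by move=> i; have := h (lift ord0 i); rewrite mxE liftK.
case: h => ha hv i; rewrite mxE; case: unliftP => [j ->|->] //=.
Qed.

End lebesgue_rV.

Arguments lebesgue_rV : clear implicits.

Section complex_Lp.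
Context {R : realType} {disp : measure_display} {T : measurableType disp}.
Variable mu : {measure set T -> \bar R}.
Implicit Types (f g : T -> R[i]) (p : R).

Definition cmeasurable f : Prop :=
  measurable_fun [set: T] (fun x => complex.Re (f x)) /\
  measurable_fun [set: T] (fun x => complex.Im (f x)).

Definition cLnorm p f : \bar R :=
  Lnorm mu p%:E (fun x => (Normc.normc (f x))%:E).

Definition cLdist p f g : \bar R := cLnorm p (fun x => f x - g x).

Definition cLfun p f : Prop := cmeasurable f /\ (cLnorm p f < +oo)%E.

Definition cintegral f : R[i] :=
  Complex (Rintegral mu [set: T] (fun x => complex.Re (f x)))
          (Rintegral mu [set: T] (fun x => complex.Im (f x))).

(* Bochner integral over D `<=` R of functions with values in L^p(mu), whose
   elements are represented by functions on T. The simple function S takes the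
   value simple_val S i on simple_set S i. *)
Record simple_Lp := SimpleLp {
  simple_size : nat;
  simple_set : 'I_simple_size -> set R;
  simple_val : 'I_simple_size -> T -> R[i] }.

Arguments simple_set : clear implicits.
Arguments simple_val : clear implicits.

Definition simple_Lp_on p (D : set R) (S : simple_Lp) : Prop :=
  forall i, [/\ measurable (simple_set S i), simple_set S i `<=` D,
    (lebesgue_measure (simple_set S i) < +oo)%E & cLfun p (simple_val S i)].

Definition simple_eval (S : simple_Lp) (t : R) : T -> R[i] := fun x =>
  \sum_(i < simple_size S) (\1_(simple_set S i) t)%:C * simple_val S i x.

Definition simple_integral (S : simple_Lp) : T -> R[i] := fun x =>
  \sum_(i < simple_size S)
     (fine (lebesgue_measure (simple_set S i)))%:C * simple_val S i x.

Definition is_Bochner_integral p (D : set R) (F : R -> T -> R[i])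
    (Phi : T -> R[i]) : Prop :=
  (forall t, D t -> cLfun p (F t)) /\ cLfun p Phi /\
  exists S : nat -> simple_Lp,
    [/\ forall n, simple_Lp_on p D (S n),
        {ae lebesgue_measure, forall t, D t ->
           (fun n => cLdist p (simple_eval (S n) t) (F t))
             @ \oo --> 0%E},
        (fun n => \int[lebesgue_measure]_(t in D)
           cLdist p (simple_eval (S n) t) (F t))%E
             @ \oo --> 0%E &
        (fun n => cLdist p (simple_integral (S n)) Phi)
             @ \oo --> 0%E].

End complex_Lp.

Section space.
Context {R : realType} {d : nat}.
Local Notation E := 'rV[R]_d.
Local Notation mu := (lebesgue_rV R d).

(* The norm `|x| of the library on 'rV[R]_d is the sup norm. *)
Definition enorm (x : E) : R := Num.sqrt (\sum_(i < d) x ord0 i ^+ 2).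

Definition partial (i : 'I_d) (f : E -> R) : E -> R :=
  'D_(delta_mx ord0 i : E) f.

Definition partials (l : seq 'I_d) (f : E -> R) : E -> R := foldr partial f l.

Definition Laplacian (f : E -> R) : E -> R := fun x =>
  \sum_(i < d) partial i (partial i f) x.

Definition smooth (f : E -> R) : Prop := forall l : seq 'I_d,
  continuous (partials l f) /\
  forall (i : 'I_d) x, derivable (partials l f) x (delta_mx ord0 i : E).

Definition Schwartz (f : E -> R) : Prop := smooth f /\
  forall (l : seq 'I_d) (k : nat), exists M : R,
    forall x, (1 + enorm x) ^+ k * `|partials l f x| <= M.

Definition cSchwartz (psi : E -> R[i]) : Prop :=
  Schwartz (fun x => complex.Re (psi x)) /\
  Schwartz (fun x => complex.Im (psi x)).

Definition cLaplacian (psi : E -> R[i]) : E -> R[i] := fun x =>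
  Complex (Laplacian (fun y => complex.Re (psi y)) x)
          (Laplacian (fun y => complex.Im (psi y)) x).

(* (omega - Delta) u = f as tempered distributions, for u and f in Lebesgue
   spaces; the pairing is bilinear. *)
Definition Helmholtz (omega : R) (u f : E -> R[i]) : Prop :=
  forall psi : E -> R[i], cSchwartz psi ->
    cintegral mu (fun x => u x * (omega%:C * psi x - cLaplacian psi x)) =
    cintegral mu (fun x => f x * psi x).

(* Bessel potential space of order 2, where (1 - Delta)^(2 / 2) = 1 - Delta. *)
Definition H2p (p : R) (u : E -> R[i]) : Prop :=
  cLfun mu p u /\ exists f, cLfun mu p f /\ Helmholtz 1 u f.

Definition ccontinuous (u : E -> R[i]) : Prop :=
  continuous (fun x => complex.Re (u x)) /\
  continuous (fun x => complex.Im (u x)).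

End space.

Section point_interaction.
Context {R : realType}.

Definition cosh (t : R) : R := (expR t + expR (- t)) / 2.

(* K_0(z) = \int_0^oo exp(- z cosh t) dt for z > 0. *)
Definition BesselK0 (z : R) : R :=
  Rintegral lebesgue_measure `[0, +oo[ (fun t => expR (- (z * cosh t))).

Definition Euler_gamma : R :=
  limn (fun n : nat => (\sum_(0 <= k < n) (k.+1%:R)^-1) - ln (n%:R : R)).

(* In the three definitions that depend on the dimension, the last case is
   d = 3; the dimension is only ever 2 or 3. *)
Definition Green (d : nat) (omega : R) (x : 'rV[R]_d) : R :=
  if d == 2%N then (2 * pi)^-1 * BesselK0 (Num.sqrt omega * enorm x)
  else expR (- (Num.sqrt omega * enorm x)) / (4 * pi * enorm x).

Definition green_const (d : nat) (omega : R) : R :=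
  if d == 2%N then (Euler_gamma - ln 2) / (2 * pi) + (4 * pi)^-1 * ln omega
  else Num.sqrt omega / (4 * pi).

Definition omega_min (d : nat) (alpha : R) : R :=
  if d == 2%N then 4 * expR (- (4 * pi * alpha) - 2 * Euler_gamma)
  else if alpha < 0 then (4 * pi * alpha) ^+ 2 else 0.

Section fixed_parameters.
Variables (d : nat) (alpha p : R).
Local Notation E := 'rV[R]_d.
Local Notation mu := (lebesgue_rV R d).

(* phi is in the domain of Delta_alpha iff phi has a decomposition for one, or
   equally for every, omega > omega_min. The continuous representative of the
   class g is used, so that g 0 makes sense. *)
Definition decomposition (omega : R) (phi g : E -> R[i]) : Prop :=
  [/\ cLfun mu p phi, H2p p g, ccontinuous g &
      {ae mu, forall x, phi x =
         g x + g 0 / (alpha + green_const d omega)%:C * (Green omega x)%:C}].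

(* phi = (omega - Delta_alpha)^-1 f: phi is in the domain of Delta_alpha, and
   (omega - Delta_alpha) phi, which is (omega - Delta) g, equals f. *)
Definition is_resolvent (omega : R) (f phi : E -> R[i]) : Prop :=
  cLfun mu p f /\ exists g, decomposition omega phi g /\ Helmholtz omega g f.

(* phi = (omega - Delta_alpha)^(- s / 2) f, for 0 < s < 2; the resolvents
   F t = (omega + t - Delta_alpha)^-1 f are determined almost everywhere. *)
Definition is_frac_resolvent (s omega : R) (f phi : E -> R[i]) : Prop :=
  [/\ cLfun mu p f, cLfun mu p phi &
      exists (F : R -> E -> R[i]) (Phi : E -> R[i]),
        [/\ forall t, 0 < t -> is_resolvent (omega + t) f (F t),
            is_Bochner_integral mu p `]0, +oo[
              (fun t x => (t `^ (- (s / 2)))%:C * F t x) Phi &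
            {ae mu, forall x, phi x = (sin (s * pi / 2) / pi)%:C * Phi x}]].

Definition Hsp_alpha (s omega : R) : set (E -> R[i]) :=
  [set phi | exists f, is_frac_resolvent s omega f phi].

(* (omega - Delta_alpha)^(s / 2): the preimage of phi, which is unique almost
   everywhere. *)
Definition frac_op (s omega : R) (phi : E -> R[i]) : E -> R[i] :=
  xget (fun=> 0) [set f | is_frac_resolvent s omega f phi].

Definition Hsp_norm (s omega : R) (phi : E -> R[i]) : \bar R :=
  cLnorm mu p (frac_op s omega phi).

End fixed_parameters.
End point_interaction.

(* Main.v *)
(* Subordinating the resolvents to the heat semigroup e^{z Delta} reduces the
   bound to the Gauss-Weierstrass kernel: (w - Delta)^-1 is the Laplace
   transform of the heat semigroup, and the Green function is at most a
   constant times \int_0^oo m(w z) heat_z dz with m(u) = min(u^-b1, u^-b2).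
   Pairing (w + t - Delta_alpha)^-1 f with h in the dual space of L^q, the
   regular part yields a weighted integral of <heat_z * f, h>, and the rank-one
   part the product of weighted integrals of <heat_z, f> and <heat_z, h>. The
   t-integral of both is finite by scaling as soon as b1 < e < b2 for the
   exponents e = 1 - s/2, 1 - d/(2p), 1 - d/(2q'); positivity of the last one
   is the hypothesis s < d/p - d + 2. What remains are Hardy-Littlewood-Sobolev
   type bounds at the scale-invariant exponents, obtained by splitting Young's
   inequality at the size of the functions relative to z. Lower integrals make
   the Bochner integral accessible without measurability of its integrand. *)

From HB Require Import structures.
Require Import Defs.
From mathcomp Require Import all_boot all_order all_algebra.
From mathcomp Require Import all_classical all_reals all_analysis.
From mathcomp Require Import complex.
From mathcomp Require Import measurable_realfun ring lra.

Set Implicit Arguments.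
Unset Strict Implicit.
Unset Printing Implicit Defensive.

Import Order.TTheory GRing.Theory Num.Theory.
Import numFieldNormedType.Exports.

Local Open Scope classical_set_scope.
Local Open Scope ring_scope.

(** * Integration on row vectors *)

(** Nothing is known about the joint dependence of the resolvents [F t] on (t, x), so Tonelli's
    theorem is available only for simple approximations and for explicit majorants. This is why the
    pairing with [h] is bounded for each [t] before any integration in [t]. A resolvent is given
    only by an equation tested on Schwartz functions, whereas the rank-one part needs the value
    [g 0]. Testing against Gaussians of all times and using the continuity of [g] gives a pointwise
    bound. In the majorants [omega + t] is replaced by the smaller [t]: all integrals become
    homogeneous, and [omega] survives only in the lower bound for [alpha + green_const]. The power
    weights [mm] have elementary Mellin integrals, and with them the inequality for the Green
    function follows from crude estimates in dimensions 2 and 3 alike, without an exact formula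
    relating [BesselK0] to the heat kernel. The final choice is [b2 = 1], with [b1] half the least
    of the three exponents. *)

Section lower_integral.
Context {d} {T : measurableType d} {R : realType}.
Variable mu : {measure set T -> \bar R}.
Local Open Scope ereal_scope.

(** The integral of a nonnegative function is a supremum over the simple functions below it, so
    monotonicity is an inclusion of sets of simple functions, whether or not [f] and [g] are
    measurable. *)
Lemma ge0_le_lower_integral (D : set T) (f g : T -> \bar R) :
  (forall x, D x -> 0 <= f x) -> (forall x, D x -> f x <= g x) ->
  \int[mu]_(x in D) f x <= \int[mu]_(x in D) g x.
Proof.
move=> f0 fg; rewrite ge0_integralE//= ge0_integralE//=; last first.
  by move=> x Dx; apply: le_trans (fg x Dx); exact: f0.
apply: ereal_sup_le => _ [h /= hf <-]; exists h => //= x.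
apply: le_trans (hf x) _; rewrite /patch; case: ifPn => // /[!inE] Dx.
exact: fg.
Qed.

End lower_integral.

Section lebesgue_rV_sigma_finite.
Context {R : realType}.
Local Open Scope ereal_scope.

Lemma lebesgue_rV_sigma_finite (n : nat) :
  sigma_finite [set: 'rV[R]_n] (lebesgue_rV R n).
Proof.
exists (fun k : nat => [set x : 'rV[R]_n |
   forall i, (`[(- (k%:R))%R, k%:R%R]%classic : set R) (x ord0 i)]).
  apply/seteqP; split => // x _.
  (* The sum of the ceilings bounds all coordinates at once. *)
  exists (\sum_(i < n) `|Num.ceil `|x ord0 i| |%N)%N => //= i.
  rewrite in_itv/= -ler_norml (bigD1 i)//= natrD.
  rewrite (@le_trans _ _ (`|Num.ceil `|x ord0 i| |%N)%:R)%R ?lerDl//.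
  rewrite natr_absz (@ger0_norm _ (Num.ceil _)) ?ceil_ge//.
  by rewrite ceil_ge0// (lt_le_trans _ (normr_ge0 _))// ltrN10.
move=> k; split.
  rewrite (_ : [set x : 'rV[R]_n | _] =
      \bigcap_(i in [set: 'I_n]) (rV_coord i @^-1` (`[(- (k%:R))%R, k%:R%R]%classic : set R))).
    apply: fin_bigcap_measurable; first exact: finite_finset.
    move=> i _; rewrite -[X in measurable X]setTI; exact: measurable_rV_coord.
  by apply/seteqP; split => x /= h i; [move=> _|]; exact: h.
rewrite (@lebesgue_rV_box R n (fun=> `[(- (k%:R))%R, k%:R%R]%classic)); last first.
  by move=> i; exact: measurable_itv.
rewrite ltey_eq; apply/orP; left.
elim/big_ind : _ => //; first by move=> x y; exact: fin_numM.
by move=> i _; rewrite lebesgue_measure_itv/=; case: ifPn.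
Qed.

(* A convertible copy, since [lebesgue_rV] is typed as a mere measure and cannot
   receive a sigma-finite structure. *)
Definition lebrV (n : nat) : set 'rV[R]_n -> \bar R := lebesgue_rV R n.

HB.instance Definition _ (n : nat) := isMeasure.Build _ _ _ (@lebrV n)
  (measure0 (lebesgue_rV R n)) (measure_ge0 (lebesgue_rV R n))
  (@measure_semi_sigma_additive _ _ _ (lebesgue_rV R n)).

HB.instance Definition _ (n : nat) := Measure_isSigmaFinite.Build _ _ _
  (@lebrV n) (lebesgue_rV_sigma_finite n).

End lebesgue_rV_sigma_finite.
Arguments lebrV R n : clear implicits.

Section tonelli.
Context {d1 d2} {T1 : measurableType d1} {T2 : measurableType d2} {R : realType}.
Variable m1 : {sigma_finite_measure set T1 -> \bar R}.
Variable m2 : {sigma_finite_measure set T2 -> \bar R}.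
Local Open Scope ereal_scope.

Lemma tonelli (f : T1 -> T2 -> \bar R) :
  measurable_fun [set: T1 * T2] (fun z => f z.1 z.2) ->
  (forall x y, 0 <= f x y) ->
  \int[m1]_x \int[m2]_y f x y = \int[m2]_y \int[m1]_x f x y.
Proof. by move=> mf f0; apply: (@fubini_tonelli _ _ _ _ _ m1 m2 _ mf) => z; exact: f0. Qed.

Lemma measurable_integral1 (f : T1 -> T2 -> \bar R) :
  measurable_fun [set: T1 * T2] (fun z => f z.1 z.2) ->
  (forall x y, 0 <= f x y) ->
  measurable_fun [set: T1] (fun x => \int[m2]_y f x y).
Proof. by move=> mf f0; apply: (@measurable_fun_fubini_tonelli_F _ _ _ _ _ m2 _ mf) => z; exact: f0. Qed.

Lemma measurable_integral2 (f : T1 -> T2 -> \bar R) :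
  measurable_fun [set: T1 * T2] (fun z => f z.1 z.2) ->
  (forall x y, 0 <= f x y) ->
  measurable_fun [set: T2] (fun y => \int[m1]_x f x y).
Proof. by move=> mf f0; apply: (@measurable_fun_fubini_tonelli_G _ _ _ _ _ m1 _ mf) => z; exact: f0. Qed.

End tonelli.

Section product_integral.
Context {R : realType}.
Local Open Scope ereal_scope.
Local Notation leb := (@lebesgue_measure R).

Lemma integral_rVS (n : nat) (f : 'rV[R]_n.+1 -> \bar R) :
  measurable_fun [set: 'rV[R]_n.+1] f -> (forall x, 0 <= f x) ->
  \int[lebrV R n.+1]_x f x = \int[lebrV R n]_y \int[leb]_t f (rVcons (t, y)).
Proof.
move=> mf f0.
transitivity (\int[pushforward (leb \x^ lebesgue_rV R n) (@rVcons R n)]_x f x).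
  by [].
rewrite ge0_integral_pushforward//=; last exact: measurable_rVcons.
rewrite preimage_setT.
(* The two constructions of the product measure agree on rectangles, hence everywhere by uniqueness;
   on this one Tonelli's theorem applies. *)
transitivity (\int[leb \x lebrV R n]_z (f \o @rVcons R n) z).
  apply: eq_measure_integral => A mA _.
  apply/esym/product_measure_unique => // B C mB mC.
  exact: product_measure2E.
have mfr := measurableT_comp mf (@measurable_rVcons R n).
by rewrite fubini_tonelli2// => z; exact: f0.
Qed.

Lemma integral_rV_prod (n : nat) (g : 'I_n -> R -> R) :
  (forall i, measurable_fun [set: R] (g i)) -> (forall i t, (0 <= g i t)%R) ->
  \int[lebrV R n]_x (\prod_(i < n) g i (x ord0 i))%:E =
  \prod_(i < n) \int[leb]_t (g i t)%:E.
Proof.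
elim: n g => [|n IH] g mg g0.
  under eq_integral do rewrite big_ord0.
  rewrite big_ord0 [LHS](_ : _ = \int[\d_ (0%R : 'rV[R]_0)]_x 1); last by [].
  by rewrite integral_dirac// diracT mul1e.
have mprod m (h : 'I_m -> R -> R) : (forall i, measurable_fun [set: R] (h i)) ->
    measurable_fun [set: 'rV[R]_m] (fun x => (\prod_(i < m) h i (x ord0 i))%R).
  move=> mh; apply: measurable_prod => i _.
  exact: (measurableT_comp (mh i) (measurable_rV_coord i)).
rewrite integral_rVS; last 2 first.
- by apply/measurable_EFinP; exact: mprod.
- by move=> x; rewrite lee_fin prodr_ge0.
transitivity (\int[lebrV R n]_y ((\int[leb]_t (g ord0 t)%:E) *
   (\prod_(i < n) g (lift ord0 i) (y ord0 i))%:E)).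
  apply: eq_integral => y _.
  transitivity (\int[leb]_t ((g ord0 t)%:E * (\prod_(i < n) g (lift ord0 i) (y ord0 i))%:E)).
    apply: eq_integral => t _; rewrite -EFinM big_ord_recl; congr (_ * _)%:E.
      by rewrite mxE unlift_none.
    by apply: eq_bigr => i _; rewrite mxE liftK.
  rewrite ge0_integralZr//.
  - by apply/measurable_EFinP; exact: mg.
  - by move=> t _; rewrite lee_fin.
  - by rewrite lee_fin prodr_ge0.
rewrite ge0_integralZl//; last 3 first.
- by apply/measurable_EFinP; exact: (mprod _ (fun i => g (lift ord0 i))) => i; exact: mg.
- by move=> y _; rewrite lee_fin prodr_ge0.
- by apply: integral_ge0 => t _; rewrite lee_fin.
rewrite big_ord_recl; congr (_ * _).
by apply: (IH (fun i => g (lift ord0 i))) => i; [exact: mg|exact: g0].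
Qed.

End product_integral.

Section real_ge0_integral.
Context {d} {T : measurableType d} {R : realType}.
Variable mu : {measure set T -> \bar R}.

Lemma ge0_intZ (f : T -> R) (k : R) : measurable_fun setT f ->
  (forall x, 0 <= f x) -> 0 <= k ->
  (\int[mu]_x (k * f x)%:E = k%:E * \int[mu]_x (f x)%:E)%E.
Proof.
move=> mf f0 k0; under eq_integral do rewrite EFinM.
by apply: ge0_integralZl; rewrite ?lee_fin// ; [exact/measurable_EFinP|move=> x _; rewrite lee_fin].
Qed.

Lemma ge0_intD (f g : T -> R) : measurable_fun setT f -> measurable_fun setT g ->
  (forall x, 0 <= f x) -> (forall x, 0 <= g x) ->
  (\int[mu]_x (f x + g x)%:E = \int[mu]_x (f x)%:E + \int[mu]_x (g x)%:E)%E.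
Proof.
move=> mf mg f0 g0; under eq_integral do rewrite EFinD.
by apply: ge0_integralD => //; [move=> x _; rewrite lee_fin|exact/measurable_EFinP|
  move=> x _; rewrite lee_fin|exact/measurable_EFinP].
Qed.

Lemma ge0_int_le (f g : T -> R) : (forall x, 0 <= f x) -> (forall x, f x <= g x) ->
  (\int[mu]_x (f x)%:E <= \int[mu]_x (g x)%:E)%E.
Proof.
by move=> f0 fg; apply: ge0_le_lower_integral => x _; rewrite lee_fin.
Qed.

End real_ge0_integral.

(** * The heat kernel *)

Section heat.
Context {R : realType} {n : nat}.
Implicit Types (x y : 'rV[R]_n) (tau : R).
Local Notation leb := (@lebesgue_measure R).

Definition sqnorm x : R := \sum_(i < n) x ord0 i ^+ 2.

(** The Gauss-Weierstrass kernel as a single exponential: it is positive for every [tau], and its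
    time derivative is a chain rule. *)
Definition heat tau x : R :=
  expR (- (n%:R / 2) * ln (4 * pi * tau) - sqnorm x / (4 * tau)).

Lemma sqnorm_ge0 x : 0 <= sqnorm x.
Proof. by apply: sumr_ge0 => i _; exact: sqr_ge0. Qed.

Lemma heat_ge0 tau x : 0 <= heat tau x.
Proof. exact: expR_ge0. Qed.

Lemma heat_sym tau x y : heat tau (x - y) = heat tau (y - x).
Proof.
suff E : sqnorm (x - y) = sqnorm (y - x) by rewrite /heat E.
by apply: eq_bigr => i _; rewrite !mxE -sqrrN opprB.
Qed.

Lemma heatE tau x : 0 < tau -> heat tau x = (4 * pi * tau) `^ (- (n%:R / 2)) * expR (- (sqnorm x / (4 * tau))).
Proof.
move=> t0; rewrite /heat expRD /powR gt_eqF// !mulr_gt0// ?pi_gt0//.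
Qed.

Lemma heat_ub tau x : 0 < tau -> heat tau x <= (4 * pi * tau) `^ (- (n%:R / 2)).
Proof.
move=> t0; rewrite heatE// ler_piMr ?powR_ge0// -[leRHS]expR0 ler_expR.
by rewrite oppr_le0 divr_ge0 ?sqnorm_ge0// mulr_ge0// ltW.
Qed.

(** Heat at time [tau] has variance [2 * tau] in each coordinate, so the total mass of the kernel
    can be read off the normal density. *)
Lemma normal_pdf_heat tau m t : 0 < tau ->
  normal_pdf m (Num.sqrt (2 * tau)) t =
  expR (- (1 / 2) * ln (4 * pi * tau) - (t - m) ^+ 2 / (4 * tau)).
Proof.
move=> t0; have s0 : Num.sqrt (2 * tau) != 0 by rewrite sqrtr_eq0 -ltNge mulr_gt0.
have s2 : Num.sqrt (2 * tau) ^+ 2 = 2 * tau by rewrite sqr_sqrtr// mulr_ge0// ltW.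
have A : 0 < 4 * pi * tau by rewrite !mulr_gt0// pi_gt0.
rewrite normal_pdfE// /normal_peak /normal_fun s2.
rewrite (_ : 2 * tau * pi *+ 2 = 4 * pi * tau); last by ring.
rewrite (_ : (Num.sqrt (4 * pi * tau))^-1 = expR (- (1/2) * ln (4 * pi * tau))).
  have -> : 2 * tau *+ 2 = 4 * tau by ring.
  by rewrite -expRD (mulNr ((t - m) ^+ 2)).
rewrite -powR12_sqrt; last exact: ltW.
by rewrite /powR gt_eqF// -expRN mulNr mul1r.
Qed.

Lemma heat_prod tau x y : 0 < tau ->
  heat tau (x - y) = \prod_(i < n) normal_pdf (y ord0 i) (Num.sqrt (2 * tau)) (x ord0 i).
Proof.
move=> t0; under eq_bigr do rewrite normal_pdf_heat//.
rewrite -(big_morph _ (@expRD R) (@expR0 R)).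
rewrite big_split/= sumr_const card_ord /heat.
suff -> : - (n%:R / 2) * ln (4 * pi * tau) - sqnorm (x - y) / (4 * tau) =
    (- (1 / 2) * ln (4 * pi * tau)) *+ n +
      \sum_(i < n) - ((x ord0 i - y ord0 i) ^+ 2 / (4 * tau)) by [].
rewrite sumrN -mulr_suml; congr (_ - _ / _).
  by rewrite -mulr_natl; field.
by apply: eq_bigr => i _; rewrite !mxE.
Qed.

Lemma integral_heat tau y : 0 < tau ->
  (\int[lebrV R n]_x (heat tau (x - y))%:E = 1)%E.
Proof.
move=> t0; under eq_integral do rewrite heat_prod//.
rewrite (@integral_rV_prod _ _ (fun i => normal_pdf (y ord0 i) (Num.sqrt (2 * tau)))).
- by apply: big1 => i _; exact: integral_normal_pdf.
- by move=> i; exact: measurable_normal_pdf.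
- by move=> i t; exact: normal_pdf_ge0.
Qed.

End heat.

(** * Power weights *)

Section powers.
Context {R : realType}.
Local Notation leb := (@lebesgue_measure R).
Implicit Types (a b c t : R).

Lemma continuous_powR_gt0 a t : 0 < t -> {for t, continuous (fun x : R => x `^ a)}.
Proof.
move=> t0; apply/differentiable_continuous/derivable1_diffP.
by apply: derivable_powR; rewrite in_itv/= t0.
Qed.

Lemma powR_increment a e N : a != 0 -> 0 < e -> e < N ->
  (\int[leb]_(t in `[e, N]) (t `^ (a - 1))%:E = (N `^ a / a)%:E - (e `^ a / a)%:E)%E.
Proof.
move=> a0 e0 eN.
have pos x : x \in `]e, N[ -> 0 < x by rewrite in_itv/= => /andP[/(lt_trans e0)].
apply: (@continuous_FTC2 R (fun t => t `^ (a - 1)) (fun t => t `^ a / a)) => //.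
- apply: continuous_in_subspaceT => x; rewrite inE/= in_itv/= => /andP[ex _].
  by apply: continuous_powR_gt0; exact: lt_le_trans ex.
- have cont x : 0 < x -> {for x, continuous (fun t : R => t `^ a / a)}.
    by move=> x0; apply: continuousM; [exact: continuous_powR_gt0|exact: cst_continuous].
  split.
  + move=> x xeN; apply: derivableM; last exact: derivable_cst.
    by apply: derivable_powR; rewrite in_itv/= pos.
  + by apply: cvg_at_right_filter; exact: cont.
  + by apply: cvg_at_left_filter; apply: cont; exact: lt_trans eN.
- move=> x xeN; have x0 := pos _ xeN.
  have xD : x \in `]0, +oo[%R by rewrite in_itv/= x0.
  rewrite derive1E deriveM//; last exact: derivable_powR.
  rewrite derive_cst scaler0 add0r -derive1E powR_derive1//.
  by rewrite /GRing.scale/= mulrA mulVf// mul1r.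
Qed.

Lemma powRDp (x a b : R) : 0 < x -> x `^ (a + b) = x `^ a * x `^ b.
Proof. by move=> x0; rewrite powRD//; apply/implyP => _; rewrite gt_eqF. Qed.

Lemma measurable_fun_powR {d} {T : measurableType d} (D : set T) (f : T -> R) c :
  measurable_fun D f -> measurable_fun D (fun x => f x `^ c).
Proof. by move=> mf; exact: (measurableT_comp (measurable_powR c) mf). Qed.

(** Cut off to 0 for [t <= 0], where [powR] need not vanish, so that integrals over the half-line
    become integrals over the whole line. In particular [pw 0] is the indicator of the positive
    numbers. *)
Definition pw c t : R := if 0 < t then t `^ c else 0.

Lemma pw_ge0 c t : 0 <= pw c t.
Proof. by rewrite /pw; case: ifP => // _; exact: powR_ge0. Qed.

Lemma measurable_pw c : measurable_fun [set: R] (pw c).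
Proof.
apply: measurable_fun_ifT => //=.
by apply: (@measurable_fun_ltr _ _ R setT (fun=> 0) (fun x => x)) => //=.
Qed.

(** For [b1 <= b2] this is [t ^ (- b1)] up to 1 and [t ^ (- b2)] beyond, so its product with
    [t ^ (c - 1)] is integrable at both ends if [b1 < c < b2]. *)
Definition mm b1 b2 t : R := Num.min (t `^ (- b1)) (t `^ (- b2)).

Lemma mm_ge0 b1 b2 t : 0 <= mm b1 b2 t.
Proof. by rewrite le_min !powR_ge0. Qed.

Lemma measurable_mm b1 b2 : measurable_fun [set: R] (mm b1 b2).
Proof. by apply: measurable_minr; exact: measurable_powR. Qed.

Lemma integral_itv_setU (f : R -> \bar R) e r N : e < r -> r < N ->
  measurable_fun [set: R] f -> (forall x, 0 <= f x)%E ->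
  (\int[leb]_(x in `[e, N]) f x =
   \int[leb]_(x in `[e, r]) f x + \int[leb]_(x in `[r, N]) f x)%E.
Proof.
move=> er rN mf f0.
have mfD (D : set R) : measurable_fun D f by exact: measurable_funTS.
have -> : `[e, N]%classic = `[e, r]%classic `|` `]r, N]%classic :> set R.
  apply/seteqP; split => x /=; rewrite !in_itv/=.
    by move=> /andP[ex xN]; case: (leP x r) => xr; [left|right]; rewrite ?ex ?xN.
  move=> [|] /andP[ex xN]; rewrite ?ex ?xN ?andbT//=.
    by apply: le_trans xN _; exact: ltW.
  by apply: ltW; exact: lt_trans ex.
rewrite -(integral_itv_obnd_cbnd (r := r))// ge0_integral_setU//.
  exact: mfD.
apply/disj_set2P/seteqP; split => x //= []; rewrite !in_itv/= => /andP[_ xr] /andP[rx _].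
by move: xr; rewrite leNgt rx.
Qed.

(** With respect to dt/t only the ratio t/r matters: the integrals up to [r] and from [r] on are at
    most 1/a and 1/b, whatever [r] is. The constants [Kmm] and [Cphi] below come from this bound. *)
Lemma master a b r : 0 < a -> 0 < b -> 0 < r ->
  (\int[leb]_t (pw (-1) t * Num.min ((t / r) `^ a) ((t / r) `^ (- b)))%:E <=
    (a^-1 + b^-1)%:E)%E.
Proof.
move=> a0 b0 r0.
set G := fun t => _%:E.
have G0 t : (0 <= G t)%E.
  by rewrite lee_fin mulr_ge0 ?pw_ge0// le_min !powR_ge0.
have mG : measurable_fun [set: R] G.
  apply/measurable_EFinP; apply: measurable_funM; first exact: measurable_pw.
  by apply: measurable_minr; apply: measurable_fun_powR; exact: measurable_funM.
(* Compact intervals exhausting the half-line; [n.+2] keeps [r] strictly inside, so that each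
   interval can be cut at [r] and the minimum bounded by one argument on each side. *)
pose F (n : nat) : set R := `[r / n.+2%:R, r * n.+2%:R]%classic.
have FU : \bigcup_n F n = `]0, +oo[%classic.
  apply/seteqP; split => t /=.
    move=> [n _]; rewrite /F/= !in_itv/= andbT => /andP[+ _].
    by apply: lt_le_trans; rewrite divr_gt0.
  rewrite in_itv/= andbT => t0.
  have rt0 : 0 < r / t by rewrite divr_gt0.
  have tr0 : 0 < t / r by rewrite divr_gt0.
  exists (Num.truncn (r / t) + Num.truncn (t / r))%N => //.
  rewrite /F/= in_itv/= ler_pdivrMr// -!ler_pdivrMl// ![_^-1 * _]mulrC.
  apply/andP; split; (apply: ltW; apply: (lt_le_trans (truncnS_gt _)));
    by rewrite ler_nat !ltnS (leq_trans _ (leqnSn _))// ?leq_addr ?leq_addl.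
rewrite (_ : \int[leb]_t G t = \int[leb]_(t in \bigcup_n F n) G t)%E; last first.
  rewrite FU [RHS]integral_mkcond; apply: eq_integral => t _.
  rewrite /patch; case: ifPn => //; rewrite notin_setE/= in_itv/= andbT => /negP t0.
  by rewrite /G /pw (negbTE t0) mul0r.
have mF n : measurable (F n) by exact: measurable_itv.
have := @ge0_nondecreasing_set_cvg_integral _ (measurableTypeR R) R F G leb.
have ndF : nondecreasing_seq F.
  move=> m n mn; apply/subsetPset => t; rewrite /F/= !in_itv/= => /andP[t1 t2].
  apply/andP; split.
    apply: le_trans t1; rewrite ler_pM2l// lef_pV2 ?posrE// ler_nat.
    by rewrite !ltnS.
  by apply: le_trans t2 _; rewrite ler_pM2l// ler_nat !ltnS.
have mGF n : measurable_fun (F n) G by exact: measurable_funTS.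
move=> /(_ ndF mF mGF (fun i x _ => G0 x)) GF.
apply: (cvge_to_le GF); apply: nearW => n.
have N1 : 1 < n.+2%:R :> R by rewrite ltr1n.
have e0 : 0 < r / n.+2%:R by rewrite divr_gt0.
have er : r / n.+2%:R < r by rewrite ltr_pdivrMr// ltr_pMr.
have rN : r < r * n.+2%:R by rewrite ltr_pMr.
rewrite (integral_itv_setU er rN)//= EFinD.
apply: leeD.
  apply: (@le_trans _ (\bar R) (\int[leb]_(t in `[(r / n.+2%:R)%R, r]) ((r `^ (- a))%:E * (t `^ (a - 1)%R)%:E))%E).
    apply: ge0_le_lower_integral => t //=; rewrite in_itv/= => /andP[et tr].
    have t0 : 0 < t by exact: lt_le_trans et.
    rewrite /G /pw t0 -EFinM lee_fin.
    rewrite (@le_trans _ _ (t `^ (-1) * (t / r) `^ a))//.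
      by rewrite ler_wpM2l ?powR_ge0// ge_min lexx.
    rewrite powRM ?invr_ge0 ?(ltW t0) ?(ltW r0)// -powR_inv1 ?(ltW r0)// -powRrM mulN1r.
    by rewrite mulrA -powRDp// mulrC [in leRHS]addrC.
  rewrite ge0_integralZl//=; last 3 first.
  - by apply/measurable_EFinP; apply: measurable_funTS; exact: measurable_powR.
  - by move=> t _; rewrite lee_fin powR_ge0.
  - by rewrite lee_fin powR_ge0.
  rewrite powR_increment ?gt_eqF// -EFinB -EFinM lee_fin mulrBr.
  rewrite (@le_trans _ _ (r `^ (- a) * (r `^ a / a)))//.
    by rewrite gerBl mulr_ge0 ?powR_ge0// divr_ge0 ?powR_ge0//; exact: ltW.
  by rewrite mulrA -powRDp// addNr powRr0 mul1r.
apply: (@le_trans _ (\bar R) (\int[leb]_(t in `[r, (r * n.+2%:R)%R]) ((r `^ b)%:E * (t `^ (- b - 1))%:E))%E).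
  apply: ge0_le_lower_integral => t //=; rewrite in_itv/= => /andP[rt tN].
  have t0 : 0 < t by exact: lt_le_trans rt.
  rewrite /G /pw t0 -EFinM lee_fin.
  rewrite (@le_trans _ _ (t `^ (-1) * (t / r) `^ (- b)))//.
    by rewrite ler_wpM2l ?powR_ge0// ge_min lexx orbT.
  rewrite powRM ?invr_ge0 ?(ltW t0) ?(ltW r0)// -[r^-1]powR_inv1 ?(ltW r0)// -powRrM mulN1r opprK.
  by rewrite mulrA -powRDp// mulrC [in leRHS]addrC.
rewrite ge0_integralZl//=; last 3 first.
- by apply/measurable_EFinP; apply: measurable_funTS; exact: measurable_powR.
- by move=> t _; rewrite lee_fin powR_ge0.
- by rewrite lee_fin powR_ge0.
rewrite powR_increment ?oppr_eq0 ?gt_eqF// -EFinB -EFinM lee_fin invrN !mulrN opprK addrC mulrBr.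
rewrite (@le_trans _ _ (r `^ b * (r `^ (- b) / b)))//.
  by rewrite gerBl mulr_ge0 ?powR_ge0// divr_ge0 ?powR_ge0//; exact: ltW.
by rewrite mulrA -powRDp// addrN powRr0 mul1r.
Qed.

(** This is [master] at [r = u^-1]: multiplication by [(u * t) ^ c] shifts the exponents of [mm] to
    [c - b1 > 0] and [c - b2 < 0]. *)
Lemma integral_pw_mm b1 b2 c u : 0 < u -> b1 < c < b2 ->
  (\int[leb]_t (pw (c - 1) t * mm b1 b2 (u * t))%:E <=
    (((c - b1)^-1 + (b2 - c)^-1) * u `^ (- c))%:E)%E.
Proof.
move=> u0 /andP[b1c cb2].
have := @master (c - b1) (b2 - c) u^-1.
rewrite !subr_gt0 invr_gt0 => /(_ b1c cb2 u0) H.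
rewrite mulrC EFinM; apply: le_trans (lee_wpmul2l _ H); last by rewrite lee_fin powR_ge0.
rewrite -ge0_integralZl//=; last 3 first.
- apply/measurable_EFinP; apply: measurable_funM; first exact: measurable_pw.
  by apply: measurable_minr; apply: measurable_fun_powR; exact: measurable_funM.
- by move=> t _; rewrite lee_fin mulr_ge0 ?pw_ge0// le_min !powR_ge0.
- by rewrite lee_fin powR_ge0.
apply: ge0_le_lower_integral => t _; first by rewrite lee_fin mulr_ge0 ?pw_ge0 ?mm_ge0.
rewrite -EFinM lee_fin /pw; case: ifPn => [t0|_]; last by rewrite !mul0r mulr0.
rewrite invrK /mm opprB.
have ut : 0 < u * t by rewrite mulr_gt0.
rewrite [t * u]mulrC !powRDp// -minr_pMr ?powR_ge0//.
rewrite le_eqVlt; apply/orP; left; apply/eqP.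
rewrite (_ : t `^ c = (u * t) `^ c * u `^ (- c)); last first.
  by rewrite powRM ?(ltW u0) ?(ltW t0)// mulrAC -powRDp// subrr powRr0 mul1r.
by rewrite mulrA mulrACA; ring.
Qed.

End powers.

(** * Gaussians are Schwartz functions *)

Section gaussian_schwartz.
Context {R : realType} {n : nat}.
Implicit Types (x y v : 'rV[R]_n) (f g : 'rV[R]_n -> R).

Lemma is_derive_coord x v (i : 'I_n) :
  is_derive x v (fun z : 'rV[R]_n => z ord0 i) (v ord0 i).
Proof.
have H : (fun h : R => h^-1 *: ((fun z : 'rV[R]_n => z ord0 i) (h *: v + x) - x ord0 i))
    @ 0^' --> v ord0 i.
  apply: cvg_near_cst; near=> h.
  have h0 : h != 0 by near: h; exact: nbhs_dnbhs_neq.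
  by rewrite /= !mxE addrK /GRing.scale/= mulrA mulVf// mul1r.
split; first by apply/cvg_ex; exists (v ord0 i).
by apply/cvg_lim.
Unshelve. all: by end_near. Qed.

Lemma is_derive_expR_comp f x v df : differentiable f x ->
  is_derive x v f df -> is_derive x v (fun z => expR (f z)) (df * expR (f x)).
Proof.
move=> dfx fdf.
have dexp (t : R) : differentiable (@expR R) t by exact/derivable1_diffP.
have dc : differentiable (@expR R \o f) x by exact: differentiable_comp.
split; first exact: diff_derivable.
have E1 : 'd f x v = df by rewrite -deriveE//; case: fdf.
have E2 : 'd (@expR R) (f x) 1 = expR (f x) by rewrite -deriveE// derive_val.
rewrite deriveE// diff_comp//= E1.
have -> : df = df *: (1 : R) by rewrite /GRing.scale/= mulr1.
by rewrite linearZ/= E2 /GRing.scale/= mulr1.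
Qed.

Variables (a : R) (y : 'rV[R]_n).

Definition gauss x : R := expR (- a * sqnorm (x - y)).

Lemma sqnormE x : sqnorm (x - y) = \sum_(i < n) (x ord0 i - y ord0 i) ^+ 2.
Proof. by apply: eq_bigr => i _; rewrite !mxE. Qed.

Lemma is_derive_shift_coord x v i :
  is_derive x v (fun z : 'rV[R]_n => z ord0 i - y ord0 i) (v ord0 i).
Proof.
rewrite -[X in is_derive _ _ _ X]subr0; apply: is_deriveB.
exact: is_derive_coord.
Qed.

Lemma differentiable_shift_coord x i :
  differentiable (fun z : 'rV[R]_n => z ord0 i - y ord0 i) x.
Proof. by apply: differentiableB => //; exact: differentiable_coord. Qed.

Lemma differentiable_sqnorm x : differentiable (fun z => - a * sqnorm (z - y)) x.
Proof.
under eq_fun do rewrite sqnormE.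
apply: differentiableM => //.
rewrite (_ : (fun _ => _) = \sum_(i < n) (fun z : 'rV[R]_n => (z ord0 i - y ord0 i) ^+ 2)).
  apply: differentiable_sum => i.
  exact: (differentiableM (differentiable_shift_coord x i)
                          (differentiable_shift_coord x i)).
by apply/funext => z; rewrite fct_sumE.
Qed.

Lemma is_derive_sqnorm x v :
  is_derive x v (fun z => - a * sqnorm (z - y))
    (- a * \sum_(i < n) 2 * (x ord0 i - y ord0 i) * v ord0 i).
Proof.
under eq_fun do rewrite sqnormE.
rewrite (_ : (fun _ => _) = - a \*: \sum_(i < n) (fun z : 'rV[R]_n => (z ord0 i - y ord0 i)) ^+ 2).
  apply: is_deriveZ; apply: is_derive_sum => i.
  have H := is_deriveX 2 (is_derive_shift_coord x v i).
  by apply: (is_derive_eq H); rewrite /= expr1.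
by apply/funext => z; rewrite /= fct_sumE.
Qed.

(** Polynomials in [x - y] times one fixed Gaussian. The class is stable under partial derivatives,
    so smoothness and decay of all derivatives reduce to an induction over these four rules. *)
Inductive gaussian_poly : ('rV[R]_n -> R) -> Prop :=
| gp_gauss : gaussian_poly gauss
| gp_coord i f : gaussian_poly f ->
    gaussian_poly (fun x => (x ord0 i - y ord0 i) * f x)
| gp_scale c f : gaussian_poly f -> gaussian_poly (fun x => c * f x)
| gp_add f g : gaussian_poly f -> gaussian_poly g ->
    gaussian_poly (fun x => f x + g x).

Lemma gaussian_poly_differentiable f x : gaussian_poly f -> differentiable f x.
Proof.
elim=> {f} [|i f _ df|c f _ df|f g _ df _ dg].
- apply: (@differentiable_comp _ _ _ _ _ (@expR R)).
    exact: differentiable_sqnorm.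
  exact/derivable1_diffP.
- by apply: differentiableM => //; exact: differentiable_shift_coord.
- by apply: differentiableM.
- by apply: differentiableD.
Qed.

Lemma partial_gauss i x :
  partial i gauss x = - 2 * a * ((x ord0 i - y ord0 i) * gauss x).
Proof.
have [_] := is_derive_expR_comp (differentiable_sqnorm x) (is_derive_sqnorm x (delta_mx ord0 i)).
rewrite /partial => ->; rewrite (bigD1 i)//= big1 => [|j ji].
  by rewrite addr0 mxE !eqxx /= mulr1 /gauss; ring.
by rewrite mxE (negbTE ji) andbF mulr0.
Qed.

Lemma partial_mulcoord i j f x : differentiable f x ->
  partial i (fun z => (z ord0 j - y ord0 j) * f z) x =
  (i == j)%:R * f x + (x ord0 j - y ord0 j) * partial i f x.
Proof.
move=> df; rewrite /partial.
have dfi : is_derive x (delta_mx ord0 i) f ('D_(delta_mx ord0 i) f x).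
  by split => //; exact: diff_derivable.
have [_ ->] := is_deriveM (is_derive_shift_coord x (delta_mx ord0 i) j) dfi.
by rewrite /GRing.scale/= mxE/= addrC mulrC eq_sym.
Qed.

Lemma partial_scale i c f x : differentiable f x ->
  partial i (fun z => c * f z) x = c * partial i f x.
Proof.
move=> df; rewrite /partial.
have dfi : is_derive x (delta_mx ord0 i) f ('D_(delta_mx ord0 i) f x).
  by split => //; exact: diff_derivable.
by have [_ ->] := is_deriveZ c dfi.
Qed.

Lemma partial_add i f g x : differentiable f x -> differentiable g x ->
  partial i (fun z => f z + g z) x = partial i f x + partial i g x.
Proof.
move=> df dg; rewrite /partial.
have dfi : is_derive x (delta_mx ord0 i) f ('D_(delta_mx ord0 i) f x).
  by split => //; exact: diff_derivable.
have dgi : is_derive x (delta_mx ord0 i) g ('D_(delta_mx ord0 i) g x).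
  by split => //; exact: diff_derivable.
by have [_ ->] := is_deriveD dfi dgi.
Qed.

Lemma gaussian_poly_partial i f : gaussian_poly f -> gaussian_poly (partial i f).
Proof.
elim=> {f} [|j f gf IH|c f gf IH|f g gf IHf gg IHg].
- rewrite (_ : partial i gauss = fun x => - 2 * a * ((x ord0 i - y ord0 i) * gauss x)).
    by apply: gp_scale; apply: gp_coord; exact: gp_gauss.
  by apply/funext => x; rewrite partial_gauss.
- rewrite (_ : partial i _ = fun x => (i == j)%:R * f x + (x ord0 j - y ord0 j) * partial i f x).
    by apply: gp_add; [exact: gp_scale|exact: gp_coord].
  by apply/funext => x; rewrite partial_mulcoord//; exact: gaussian_poly_differentiable.
- rewrite (_ : partial i _ = fun x => c * partial i f x).
    exact: gp_scale.
  by apply/funext => x; rewrite partial_scale//; exact: gaussian_poly_differentiable.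
- rewrite (_ : partial i _ = fun x => partial i f x + partial i g x).
    exact: gp_add.
  by apply/funext => x; rewrite partial_add//; exact: gaussian_poly_differentiable.
Qed.

Lemma gaussian_poly_partials l f : gaussian_poly f -> gaussian_poly (partials l f).
Proof. by move=> gf; elim: l => //= i l IH; exact: gaussian_poly_partial. Qed.

Lemma Laplacian_scale_gauss c x : Laplacian (fun z => c * gauss z) x =
  c * ((- 2 * a * n%:R + 4 * a ^+ 2 * sqnorm (x - y)) * gauss x).
Proof.
rewrite /Laplacian.
have dg z : differentiable gauss z by apply: gaussian_poly_differentiable; exact: gp_gauss.
have E i : partial i (fun z => c * gauss z) =
    fun z => c * (- 2 * a) * ((z ord0 i - y ord0 i) * gauss z).
  by apply/funext => z; rewrite partial_scale// partial_gauss; ring.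
under eq_bigr => i _.
  rewrite E partial_scale; last first.
    by apply: gaussian_poly_differentiable; apply: gp_coord; exact: gp_gauss.
  rewrite partial_mulcoord// partial_gauss eqxx mul1r.
  rewrite (_ : c * (- 2 * a) * _ =
    c * (- 2 * a) * gauss x + c * (4 * a ^+ 2) * gauss x * (x ord0 i - y ord0 i) ^+ 2).
    over.
  by rewrite !(expr2, exprS, expr0); ring.
rewrite big_split/= sumr_const card_ord -mulr_sumr -sqnormE -mulr_natl; ring.
Qed.

Hypothesis a0 : 0 < a.

Lemma enorm_ge0 x : 0 <= enorm x. Proof. exact: sqrtr_ge0. Qed.

Lemma enorm_sqr x : enorm x ^+ 2 = sqnorm x.
Proof. by rewrite /enorm sqr_sqrtr// sqnorm_ge0. Qed.

Lemma coord_le_enorm x i : `|x ord0 i| <= enorm x.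
Proof.
rewrite -(ler_pXn2r (n := 2))// ?nnegrE ?enorm_ge0// enorm_sqr.
rewrite real_normK ?num_real// /sqnorm (bigD1 i)//= lerDl.
by apply: sumr_ge0 => j _; exact: sqr_ge0.
Qed.

(** The factor 2 comes from |x|^2 <= 2|y|^2 + 2|x-y|^2, which holds coordinate by coordinate because
    (x_i - 2 y_i)^2 >= 0; this replaces the triangle inequality for the Euclidean norm. *)
Lemma enorm_sub_ub x : 1 + enorm x <= 2 * (1 + enorm y) * (1 + enorm (x - y)).
Proof.
have H : sqnorm x <= 2 * sqnorm y + 2 * sqnorm (x - y).
  rewrite sqnormE /sqnorm !mulr_sumr -big_split/=; apply: ler_sum => i _.
  have := sqr_ge0 (x ord0 i - 2 * y ord0 i); nra.
rewrite -!enorm_sqr in H.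
have := enorm_ge0 x; have := enorm_ge0 y; have := enorm_ge0 (x - y).
set u := enorm x in H *; set v := enorm y in H *; set w := enorm (x - y) in H *.
move=> w0 v0 u0.
suff : u <= 2 * v + 2 * w by nra.
rewrite -(ler_pXn2r (n := 2))// ?nnegrE//; [nra|lra].
Qed.

Lemma gauss_decay (k : nat) : exists M : R, forall x, (1 + enorm x) ^+ k * `|gauss x| <= M.
Proof.
(* for a suitable C, [1 + z <= C (1 + a z^2 / (k + 1)) <= C exp(a z^2 / (k + 1))] *)
pose e := a / k.+1%:R.
have e0 : 0 < e by rewrite divr_gt0.
pose C := 1 + e^-1.
have ie0 : 0 < e^-1 by rewrite invr_gt0.
have C0 : 0 < C by rewrite addr_gt0.
have bound z : 0 <= z -> 1 + z <= (1 + C) * expR (e * z ^+ 2).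
  move=> z0; apply: (@le_trans _ _ ((1 + C) * (1 + e * z ^+ 2))).
    have ee : e * e^-1 = 1 by rewrite mulfV// gt_eqF.
    suff : z <= 1 + C * (e * z ^+ 2) by rewrite /C => ?; nra.
    have -> : C * (e * z ^+ 2) = e * z ^+ 2 + (e / e) * z ^+ 2 by rewrite /C; ring.
    rewrite ee mul1r.
    have := sqr_ge0 (z - 1); have : 0 <= e * z ^+ 2 by rewrite mulr_ge0 ?sqr_ge0// ltW.
    rewrite expr2; nra.
  by rewrite ler_wpM2l ?expR_ge1Dx// addr_ge0// ltW.
exists ((2 * (1 + enorm y) * (1 + C)) ^+ k) => x.
have D0 : 0 <= 2 * (1 + enorm y) by rewrite mulr_ge0// addr_ge0// enorm_ge0.
have E0 : 0 <= 1 + enorm x by rewrite addr_ge0// enorm_ge0.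
have G0 : 0 <= 2 * (1 + enorm y) * (1 + C) by rewrite mulr_ge0// addr_ge0// ltW.
have H : 1 + enorm x <= 2 * (1 + enorm y) * (1 + C) * expR (e * sqnorm (x - y)).
  apply: le_trans (enorm_sub_ub x) _; rewrite -[leRHS]mulrA ler_wpM2l// -enorm_sqr.
  by apply: bound; exact: enorm_ge0.
have Hk : (1 + enorm x) ^+ k <=
    (2 * (1 + enorm y) * (1 + C)) ^+ k * expR (e * sqnorm (x - y)) ^+ k.
  by rewrite -exprMn lerXn2r// nnegrE// mulr_ge0// expR_ge0.
rewrite ger0_norm ?expR_ge0//.
apply: le_trans (ler_wpM2r (expR_ge0 _) Hk) _.
rewrite -[leLHS]mulrA ler_piMr ?exprn_ge0// -expRM_natl -expRD -[leRHS]expR0 ler_expR.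
rewrite mulrA -mulrDl mulr_le0_ge0 ?sqnorm_ge0// subr_le0 /e mulrCA.
by rewrite ler_piMr ?(ltW a0)// ler_pdivrMr// mul1r ler_nat.
Qed.

Lemma gaussian_poly_decay f (k : nat) : gaussian_poly f ->
  exists M : R, forall x, (1 + enorm x) ^+ k * `|f x| <= M.
Proof.
move=> gf; elim: gf k => {f} [|i f _ IH|c f _ IH|f g _ IHf _ IHg] k.
- exact: gauss_decay.
(* A coordinate factor is paid for with one more power of [1 + enorm x]. *)
- have [M HM] := IH k.+1; exists ((1 + enorm y) * M) => x.
  apply: le_trans (_ : (1 + enorm y) * ((1 + enorm x) ^+ k.+1 * `|f x|) <= _); last first.
    by rewrite ler_wpM2l// addr_ge0// enorm_ge0.
  rewrite normrM exprS mulrCA !mulrA ler_wpM2r//.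
  rewrite ler_wpM2r ?exprn_ge0 ?addr_ge0 ?enorm_ge0//.
  have := coord_le_enorm x i; have := coord_le_enorm y i.
  have := ler_normB (x ord0 i) (y ord0 i); have := enorm_ge0 x; have := enorm_ge0 y; nra.
- have [M HM] := IH k; exists (`|c| * M) => x.
  by rewrite normrM mulrCA ler_wpM2l.
- have [M HM] := IHf k; have [N HN] := IHg k; exists (M + N) => x.
  apply: le_trans (lerD (HM x) (HN x)); rewrite -mulrDr ler_wpM2l ?ler_normD//.
  by rewrite exprn_ge0// addr_ge0// enorm_ge0.
Qed.

Lemma Schwartz_gaussian_poly f : gaussian_poly f -> Schwartz f.
Proof.
move=> gf; split.
  move=> l; have gl := gaussian_poly_partials l gf; split.
    by move=> x; apply: differentiable_continuous; exact: gaussian_poly_differentiable.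
  by move=> i x; apply: diff_derivable; exact: gaussian_poly_differentiable.
by move=> l k; apply: gaussian_poly_decay; exact: gaussian_poly_partials.
Qed.

End gaussian_schwartz.

(** * Measurability of the kernels *)

Section measurability.
Variable R : realType.

(** On positive values the inverse is a real power, and oddness reduces the other values to these;
    at 0 both sides are 0. *)
Lemma measurable_fun_inv {d} {T : measurableType d} (f : T -> R) :
  measurable_fun setT f -> measurable_fun [set: T] (fun x => (f x)^-1).
Proof.
move=> mf.
rewrite (_ : (fun x => _) = fun x => if 0 < f x then f x `^ (-1) else - ((- f x) `^ (-1))).
  apply: measurable_fun_ifT => /=.
  - by apply: (@measurable_fun_ltr _ T R setT (fun=> 0) f).
  - exact: measurable_fun_powR.
  - by apply: measurable_funN; apply: measurable_fun_powR; exact: measurable_funN.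
apply/funext => t; case: ifPn => [t0|]; first by rewrite powR_inv1// ltW.
by rewrite -leNgt => t0; rewrite powR_inv1 ?oppr_ge0// invrN opprK.
Qed.

Lemma measurable_sqnorm {d} {T : measurableType d} n (f : T -> 'rV[R]_n) :
  (forall i, measurable_fun setT (fun z => f z ord0 i)) ->
  measurable_fun [set: T] (fun z => sqnorm (f z)).
Proof. by move=> mf; apply: measurable_sum => i; exact: measurable_funX. Qed.

Lemma measurable_heat {d} {T : measurableType d} n (t : T -> R) (f : T -> 'rV[R]_n) :
  measurable_fun setT t ->
  (forall i, measurable_fun setT (fun z => f z ord0 i)) ->
  measurable_fun [set: T] (fun z => heat (t z) (f z)).
Proof.
move=> mt mf; apply: (measurableT_comp (@measurable_expR R)).
apply: measurable_funB.
  apply: measurable_funM => //; apply: (measurableT_comp (@measurable_ln R)).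
  exact: measurable_funM.
apply: measurable_funM; first exact: measurable_sqnorm.
by apply: measurable_fun_inv; exact: measurable_funM.
Qed.

Lemma measurable_rV_sub {d} {T : measurableType d} n (f g : T -> 'rV[R]_n) i :
  measurable_fun setT f -> measurable_fun setT g ->
  measurable_fun [set: T] (fun z => (f z - g z) ord0 i).
Proof.
move=> mf mg; under eq_fun do rewrite !mxE.
by apply: measurable_funB; exact: (measurableT_comp (measurable_rV_coord i)).
Qed.

Lemma measurable_heat_sub {d} {T : measurableType d} n (t : T -> R) (f g : T -> 'rV[R]_n) :
  measurable_fun setT t -> measurable_fun setT f -> measurable_fun setT g ->
  measurable_fun [set: T] (fun z => heat (t z) (f z - g z)).
Proof.
by move=> mt mf mg; apply: measurable_heat => // i; exact: measurable_rV_sub.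
Qed.

Lemma measurable_sqnorm_sub {d} {T : measurableType d} n (f g : T -> 'rV[R]_n) :
  measurable_fun setT f -> measurable_fun setT g ->
  measurable_fun [set: T] (fun z => sqnorm (f z - g z)).
Proof.
by move=> mf mg; apply: measurable_sqnorm => // i; exact: measurable_rV_sub.
Qed.

End measurability.

(** Syntax-directed proofs of measurability, with hypotheses used for unknown functions. [heat] and
    [sqnorm] are recognised only at differences, as they occur in convolutions; elsewhere a
    hypothesis has to be supplied. *)
Ltac mfun := repeat match goal with
  | |- measurable_fun _ (fun z => EFin _) => apply/measurable_EFinP
  | |- measurable_fun _ (fun z => (_ * _)%R) => apply: measurable_funM
  | |- measurable_fun _ (fun z => (_ + - _)%R) => apply: measurable_funB
  | |- measurable_fun _ (fun z => (_ + _)%R) => apply: measurable_funD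
  | |- measurable_fun _ (fun z => (_ ^+ _)%R) => apply: measurable_funX
  | |- measurable_fun _ (fun z => (- _)%R) => apply: measurable_funN
  | |- measurable_fun _ (fun z => `| _ |%R) =>
      apply: (measurableT_comp (@normr_measurable _ setT))
  | |- measurable_fun _ (fun z => (_^-1)%R) => apply: measurable_fun_inv
  | |- measurable_fun _ (fun z => expR _) => apply: (measurableT_comp (@measurable_expR _))
  | |- measurable_fun _ (fun z => pw _ _) => apply: (measurableT_comp (measurable_pw _))
  | |- measurable_fun _ (fun z => mm _ _ _) => apply: (measurableT_comp (measurable_mm _ _))
  | |- measurable_fun _ (fun z => powR _ _) => apply: measurable_fun_powR
  | |- measurable_fun _ (fun z => Num.min _ _) => apply: measurable_minr
  | |- measurable_fun _ (fun z => heat _ (_ - _)%R) => apply: measurable_heat_sub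
  | |- measurable_fun _ (fun z => sqnorm (_ - _)%R) => apply: measurable_sqnorm_sub
  | |- measurable_fun _ (fun z => fst _) => apply: (measurableT_comp measurable_fst)
  | |- measurable_fun _ (fun z => snd _) => apply: (measurableT_comp measurable_snd)
  | |- measurable_fun _ (fun z => z) => exact: measurable_id
  | |- measurable_fun _ (fun z => _) => exact: measurable_cst
  | |- measurable_fun _ (@GRing.inv _) => apply: (@measurable_fun_inv _ _ _ (fun z => z)); exact: measurable_id
  | |- measurable_fun _ (pw _) => exact: measurable_pw
  | |- measurable_fun _ (mm _ _) => exact: measurable_mm
  | |- measurable_fun _ expR => exact: measurable_expR
  | |- measurable_fun _ (@Num.norm _ _) => exact: normr_measurable
  | |- measurable_fun _ fst => exact: measurable_fst
  | |- measurable_fun _ snd => exact: measurable_snd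
  | H : measurable_fun setT ?h |- measurable_fun _ ?h => exact: H
  | H : measurable_fun setT ?h |- measurable_fun _ (fun z => ?h _) =>
      apply: (measurableT_comp H)
  | _ => by []
  end.

(** * Pointwise bound for solutions of the Helmholtz equation *)

Section heat_time.
Context {R : realType} {n : nat}.
Variables (w : R) (y : 'rV[R]_n).
Hypothesis w0 : 0 < w.
Implicit Types (x : 'rV[R]_n) (t : R).
Local Notation leb := (@lebesgue_measure R).
Local Notation mu := (lebrV R n).

Definition hker t x : R := expR (- (w * t)) * heat t (x - y).

(** The factor by which [w - Delta] in space and minus the derivative in time both multiply [hker];
    that the two agree is the heat equation. *)
Definition hsym t x : R := w + n%:R / 2 * t^-1 - sqnorm (x - y) / 4 * (t^-1) ^+ 2.

Lemma hker_ge0 t x : 0 <= hker t x.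
Proof. by rewrite mulr_ge0 ?expR_ge0 ?heat_ge0. Qed.

Lemma is_derive_hker t x : 0 < t ->
  is_derive t 1 (hker ^~ x) (- (hker t x * hsym t x)).
Proof.
move=> t0.
set g := fun t : R => - (w * t) + (- (n%:R / 2) * ln (4 * pi * t) - (sqnorm (x - y) / 4) * t^-1).
have E : hker ^~ x = expR \o g.
  apply/funext => r; rewrite /hker /heat -expRD /g /=; congr (expR (_ + (_ + _))).
  by rewrite invfM mulrA.
have cm (c : R) : is_derive t 1 (fun r : R => c * r) c.
  have H := @is_deriveZ _ _ _ (@id R) c t 1 1 (is_derive_id _ _).
  by apply: (is_derive_eq H); rewrite /GRing.scale/= mulr1.
have A0 : 0 < 4 * pi * t by rewrite !mulr_gt0// pi_gt0.
have dln : is_derive t 1 (fun r : R => ln (4 * pi * r)) (t^-1).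
  have H := @is_derive1_comp _ (@ln R) (fun r : R => 4 * pi * r) t _ _ (is_derive1_ln A0) (cm _).
  by apply: (is_derive_eq H); rewrite invfM mulrAC mulVf ?mul1r// mulf_neq0// gt_eqF// pi_gt0.
have dinv : is_derive t 1 (fun r : R => r^-1) (- (t^-1) ^+ 2).
  have H := @is_deriveV _ (@id R) t 1 1 (lt0r_neq0 t0) (is_derive_id _ _).
  by apply: (is_derive_eq H); rewrite /GRing.scale/= mulr1 -exprVn.
have dg : is_derive t 1 g (- hsym t x).
  have H := is_deriveD (is_deriveN (cm w)) (is_deriveB
    (is_deriveZ (- (n%:R / 2)) dln) (is_deriveZ (sqnorm (x - y) / 4) dinv)).
  apply: (is_derive_eq H); rewrite /hsym /GRing.scale/=; ring.
have H := @is_derive1_comp _ (@expR R) g t _ _ (is_derive_expR (g t)) dg.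
by rewrite E; apply: (is_derive_eq H); rewrite mulrN -[hker t x]/((hker ^~ x) t) E.
Qed.

Lemma integral_hker_sym e T x : 0 < e -> e < T ->
  (\int[leb]_(t in `[e, T]) (hker t x * hsym t x)%:E = (hker e x)%:E - (hker T x)%:E)%E.
Proof.
move=> e0 eT.
have d t : 0 < t -> derivable (hker ^~ x) t 1.
  by move=> /(is_derive_hker x) [].
have c t : 0 < t -> {for t, continuous (hker ^~ x)}.
  by move=> t0; apply: differentiable_continuous; apply/derivable1_diffP; exact: d.
rewrite (@continuous_FTC2 R _ (fun t => - hker t x))//.
- by rewrite -!EFinB opprK addrC.
- apply: continuous_in_subspaceT => t; rewrite inE/= in_itv/= => /andP[et _].
  have t0 : 0 < t by exact: lt_le_trans et.
  have cv : {for t, continuous (fun r : R => r^-1)} by apply: inv_continuous; rewrite gt_eqF.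
  suff cs : {for t, continuous (hsym ^~ x)} by exact: (continuousM (c t t0) cs).
  apply: continuousB.
    apply: continuousD; first exact: cst_continuous.
    by apply: continuousM; [exact: cst_continuous|].
  apply: continuousM; first exact: cst_continuous.
  exact: (continuousM cv cv).
- split.
  + move=> t /[!in_itv]/= /andP[et _]; apply: derivableN; apply: d; exact: lt_trans et.
  + by apply: cvg_at_right_filter; exact: (cvgN (c _ e0)).
  + by apply: cvg_at_left_filter; exact: (cvgN (c _ (lt_trans e0 eT))).
- move=> t /[!in_itv]/= /andP[et _]; have t0 : 0 < t by exact: lt_trans et.
  rewrite derive1E deriveN; last exact: d.
  by have [_ ->] := is_derive_hker x t0; rewrite opprK.
Qed.

(** The exponential exp(-|x-y|^2/(4T)) is split into two equal factors: one absorbs the quadratic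
    growth of [hsym], the other is the Gaussian of time [2 * T]. The bound is uniform over the time
    interval, which is what Fubini's theorem needs. *)
Lemma hker_sym_ub e T : 0 < e -> e < T -> exists2 C : R, 0 <= C &
  forall t x, e <= t -> t <= T -> `|hker t x * hsym t x| <= C * heat (2 * T) (x - y).
Proof.
move=> e0 eT; have T0 : 0 < T by exact: lt_trans eT.
pose A := (4 * pi * e) `^ (- (n%:R / 2)).
pose B := (4 * pi * (2 * T)) `^ (- (n%:R / 2)).
have pe : 0 < 4 * pi * e by rewrite !mulr_gt0// pi_gt0.
have pT : 0 < 4 * pi * (2 * T) by rewrite !mulr_gt0// pi_gt0.
have A0 : 0 < A by exact: powR_gt0.
have B0 : 0 < B by exact: powR_gt0.
pose D := w + n%:R / 2 * e^-1 + 2 * T * (e^-1) ^+ 2.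
have ei : 0 < e^-1 by rewrite invr_gt0.
have D0 : 0 <= D.
  by rewrite /D !addr_ge0 ?mulr_ge0 ?divr_ge0 ?sqr_ge0// ltW.
exists (A * D / B); first by rewrite divr_ge0 ?mulr_ge0 // ltW.
move=> t x et tT; have t0 : 0 < t by exact: lt_le_trans et.
set s := sqnorm (x - y); have s0 : 0 <= s by exact: sqnorm_ge0.
have te : t^-1 <= e^-1 by rewrite lef_pV2.
have ti : 0 < t^-1 by rewrite invr_gt0.
rewrite (heatE _ (_ : 0 < 2 * T)) ?mulr_gt0// -/B -/s mulrA divfK ?gt_eqF//.
have H1 : hker t x <= A * (expR (- (s / (8 * T))) * expR (- (s / (8 * T)))).
  rewrite /hker heatE// -/s mulrA; apply: ler_pM; rewrite ?mulr_ge0 ?expR_ge0 ?powR_ge0//.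
    rewrite -[leRHS]mul1r; apply: ler_pM; rewrite ?expR_ge0 ?powR_ge0//.
      by rewrite -[leRHS]expR0 ler_expR oppr_le0 mulr_ge0// ltW.
    rewrite /A !powRN lef_pV2 ?posrE ?powR_gt0 ?mulr_gt0 ?pi_gt0//.
    rewrite ge0_ler_powR ?divr_ge0// ?nnegrE ?mulr_ge0 ?pi_ge0 ?(ltW t0) ?(ltW e0)//.
    by rewrite ler_wpM2l// mulr_ge0// pi_ge0.
  rewrite -expRD ler_expR -opprD lerN2 -mulrDr ler_wpM2l//.
  rewrite (_ : _ + _ = (4 * T)^-1); last by field; rewrite gt_eqF.
  by rewrite lef_pV2 ?posrE ?mulr_gt0// ler_pM2l.
have H2 : `|hsym t x| <= D * expR (s / (8 * T)).
  apply: (@le_trans _ _ (w + n%:R / 2 * e^-1 + s / 4 * (e^-1) ^+ 2)).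
    rewrite /hsym -/s; apply: le_trans (ler_normB _ _) _; apply: lerD.
      rewrite ger0_norm; last by rewrite addr_ge0 ?mulr_ge0 ?divr_ge0// ltW.
      by rewrite lerD2l ler_wpM2l// divr_ge0.
    have s4 : 0 <= s / 4 by rewrite divr_ge0.
    rewrite ger0_norm; last by apply: mulr_ge0 => //; exact: sqr_ge0.
    by rewrite ler_wpM2l// lerXn2r// nnegrE ltW.
  have E1 : 1 <= expR (s / (8 * T)).
    by rewrite -[leLHS]expR0 ler_expR divr_ge0// mulr_ge0// ltW.
  have E2 : s / 4 <= 2 * T * expR (s / (8 * T)).
    apply: le_trans (_ : 2 * T * (1 + s / (8 * T)) <= _); last first.
      by rewrite ler_wpM2l ?expR_ge1Dx// mulr_ge0// ltW.
    rewrite (_ : 2 * T * _ = 2 * T + s / 4); last by field; rewrite gt_eqF.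
    by rewrite lerDr mulr_ge0// ltW.
  rewrite [leRHS]mulrDl; apply: lerD.
    by rewrite ler_peMr// addr_ge0 ?mulr_ge0 ?divr_ge0// ltW.
  by rewrite [leRHS]mulrAC; apply: ler_wpM2r => //; exact: sqr_ge0.
rewrite normrM ger0_norm ?hker_ge0//.
apply: le_trans (ler_pM (hker_ge0 _ _) (normr_ge0 _) H1 H2) _.
rewrite mulrACA -!expRD -addrA addNr addr0 (_ : 4 * (2 * T) = 8 * T)//; ring.
Qed.

End heat_time.

Section Lp_heat.
Context {R : realType} {n : nat}.
Local Notation mu := (lebrV R n).
Local Open Scope ereal_scope.
Implicit Types (x y : 'rV[R]_n) (t p : R) (v : 'rV[R]_n -> R).

Definition pint p v : \bar R := \int[mu]_x (`|v x| `^ p)%:E.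

Lemma pint_ge0 p v : 0 <= pint p v.
Proof. by apply: integral_ge0 => x _; rewrite lee_fin powR_ge0. Qed.

Lemma le1powR (a p : R) : (1 <= p)%R -> (0 <= a)%R -> (a <= 1 + a `^ p)%R.
Proof.
move=> p1 a0; have [a1|a1] := leP a 1%R.
  by rewrite (le_trans a1)// lerDl powR_ge0.
by apply: (le_trans (le1r_powR (ltW a1) p1)); rewrite lerDr.
Qed.

(** From a <= 1 + a^p: the constant 1 is integrated against the mass of the kernel, the power
    against its supremum. The bound stays bounded as [t] grows. *)
Lemma Lp_heat_ub p t y v : (1 <= p)%R -> (0 < t)%R -> measurable_fun setT v ->
  \int[mu]_x (`|v x| * heat t (x - y))%:E <=
  1 + ((4 * pi * t) `^ (- (n%:R / 2)))%:E * pint p v.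
Proof.
move=> p1 t0 mv; set A := (_ `^ _)%R; have A0 : (0 <= A)%R by exact: powR_ge0.
have mvp : measurable_fun setT (fun x => `|v x| `^ p)%R by mfun.
have vp0 x : (0 <= `|v x| `^ p)%R by exact: powR_ge0.
rewrite -[X in _ <= X + _](integral_heat y t0) /pint -(ge0_intZ _ mvp vp0 A0).
rewrite -ge0_intD; [|by mfun..|by move=> x; exact: heat_ge0|
  by move=> x; rewrite mulr_ge0].
apply: ge0_int_le => x; first by rewrite mulr_ge0 ?heat_ge0.
apply: (@le_trans _ _ ((1 + `|v x| `^ p) * heat t (x - y))%R).
  by rewrite ler_wpM2r ?heat_ge0// le1powR.
rewrite mulrDl mul1r lerD2l mulrC ler_wpM2r//.
exact: heat_ub.
Qed.

Lemma Lp_heat_integrable p t y v (psi : 'rV[R]_n -> R) (C : R) : (1 <= p)%R -> (0 < t)%R ->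
  measurable_fun setT v -> pint p v < +oo -> measurable_fun setT psi ->
  (forall x, `|psi x| <= C * heat t (x - y))%R ->
  mu.-integrable setT (fun x => (v x * psi x)%:E).
Proof.
move=> p1 t0 mv vp mpsi psiC; apply/integrableP; split; first by mfun.
have C0 : (0 <= C)%R.
  have := psiC 0%R; have := normr_ge0 (psi 0%R) => a b.
  have := le_trans a b; rewrite pmulr_lge0//; exact: expR_gt0.
apply: (@le_lt_trans _ _ (C%:E * \int[mu]_x (`|v x| * heat t (x - y))%:E)); last first.
  rewrite lte_mul_pinfty ?lee_fin//.
  apply: le_lt_trans (Lp_heat_ub y p1 t0 mv) _.
  by rewrite lte_add_pinfty ?ltry// lte_mul_pinfty ?lee_fin ?powR_ge0.
rewrite -ge0_intZ//; [|by mfun|by move=> x; rewrite mulr_ge0 ?heat_ge0].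
apply: ge0_int_le => x //.
by rewrite normrM mulrCA ler_wpM2l.
Qed.

End Lp_heat.

Section real_helmholtz.
Context {R : realType} {n : nat}.
Local Notation mu := (lebrV R n).
Local Notation leb := (@lebesgue_measure R).
Local Open Scope ereal_scope.
Variables (p w : R) (u F : 'rV[R]_n -> R).
Hypothesis p1 : (1 <= p)%R.
Hypothesis w0 : (0 < w)%R.
Hypothesis measu : measurable_fun setT u.
Hypothesis measF : measurable_fun setT F.
Hypothesis up : pint p u < +oo.
Hypothesis Fp : pint p F < +oo.
Hypothesis HH : forall psi, Schwartz psi ->
  Rintegral mu setT (fun x => u x * (w * psi x - Laplacian psi x))%R =
  Rintegral mu setT (fun x => F x * psi x)%R.
Variable y : 'rV[R]_n.

Local Notation K := (hker w y).
Local Notation S := (hsym w y).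

Lemma hkerE t : (0 < t)%R -> hker w y t =
  fun x => (expR (- (w * t)) * (4 * pi * t) `^ (- (n%:R / 2)) * gauss (4 * t)^-1 y x)%R.
Proof.
by move=> t0; apply/funext => x; rewrite /hker heatE// mulrA /gauss mulNr [(_^-1 * _)%R]mulrC.
Qed.

Lemma Schwartz_hker t : (0 < t)%R -> Schwartz (K t).
Proof.
move=> t0; rewrite hkerE//; apply: (@Schwartz_gaussian_poly _ _ (4 * t)^-1 y).
  by rewrite invr_gt0 mulr_gt0.
by apply: gp_scale; exact: gp_gauss.
Qed.

Lemma hker_operator t x : (0 < t)%R ->
  (w * K t x - Laplacian (K t) x = K t x * S t x)%R.
Proof.
move=> t0; have L : Laplacian (K t) x =
    (K t x * (- 2 * (4 * t)^-1 * n%:R + 4 * (4 * t)^-1 ^+ 2 * sqnorm (x - y)))%R.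
  by rewrite hkerE// Laplacian_scale_gauss -[RHS]mulrA; congr (_ * _)%R; rewrite mulrC.
by rewrite L /hsym; field; rewrite gt_eqF.
Qed.

Lemma slice_integrable v t : (0 < t)%R -> measurable_fun setT v -> pint p v < +oo ->
  mu.-integrable setT (fun x => (v x * K t x)%:E).
Proof.
move=> t0 mv vp; apply: (@Lp_heat_integrable _ _ p t y v (K t) 1) => //.
  by rewrite /hker; mfun.
move=> x; rewrite ger0_norm ?hker_ge0// ler_wpM2r ?heat_ge0//.
by rewrite -expR0 ler_expR oppr_le0 mulr_ge0// ltW.
Qed.

Lemma slice_sym_integrable t : (0 < t)%R ->
  mu.-integrable setT (fun x => (u x * (K t x * S t x))%:E).
Proof.
move=> t0; have tt : (t < t + t)%R by rewrite ltrDl.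
have [C C0 HC] := hker_sym_ub y w0 t0 tt.
apply: (@Lp_heat_integrable _ _ p (2 * (t + t)) y u _ C) => //.
- by rewrite mulr_gt0// addr_gt0.
- rewrite /hker /hsym; mfun.
- by move=> x; apply: HC => //; exact: ltW.
Qed.

(** The weak equation at the Schwartz function [K t]. It is an equality of real integrals;
    integrability of both sides lifts it to extended reals. *)
Lemma slice_identity t : (0 < t)%R ->
  \int[mu]_x (u x * (K t x * S t x))%:E = \int[mu]_x (F x * K t x)%:E.
Proof.
move=> t0; have := HH (Schwartz_hker t0).
under eq_Rintegral do rewrite hker_operator//.
rewrite /Rintegral => E.
rewrite -[LHS]fineK ?integrable_fin_num//; last exact: slice_sym_integrable.
rewrite E fineK// integrable_fin_num//; exact: slice_integrable.
Qed.

(** The Laplace transform at [w] of the heat flow of [|F|], evaluated at [y]. *)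
Let M := \int[leb]_t \int[mu]_x (pw 0 t * K t x * `|F x|)%:E.

(** Fubini's theorem is used on the compact time interval only, where a single Gaussian dominates;
    the bound by [M] no longer depends on the interval. *)
Lemma heat_increment e T : (0 < e)%R -> (e < T)%R ->
  `| \int[mu]_x (u x * K e x)%:E - \int[mu]_x (u x * K T x)%:E | <= M.
Proof.
move=> e0 eT; have T0 : (0 < T)%R by exact: lt_trans eT.
have [C C0 HC] := hker_sym_ub y w0 e0 eT.
pose I (t : R) : R := \1_(`[e, T]%classic : set R) t.
have mI : measurable_fun [set: R] I by exact: measurable_indic.
have I0 t : (0 <= I t)%R by rewrite /I indicE.
have I1 t : (I t <= 1)%R by rewrite /I indicE; case: (_ \in _).
pose f (z : 'rV[R]_n * R) := (u z.1 * (K z.2 z.1 * S z.2 z.1) * I z.2)%:E.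
have mf : measurable_fun setT f by rewrite /f /hker /hsym; mfun.
have fi : (mu \x leb).-integrable setT f.
  apply: (@integrable12ltyP _ _ _ _ R mu leb f mf).2.
  apply: (@le_lt_trans _ _ (\int[mu]_x ((C * (T - e)) * (`|u x| * heat (2 * T) (x - y)))%:E)).
    apply: ge0_le_lower_integral => x _; first exact: integral_ge0.
    apply: (@le_trans _ _ (\int[leb]_(t in `[e, T]) (`|u x| * heat (2 * T) (x - y) * C)%:E)).
      rewrite [leRHS]integral_mkcond; apply: ge0_le_lower_integral => t _ //.
      rewrite /f/= /patch; case: ifPn => tI; last first.
        by rewrite /I indicE (negbTE tI) mulr0 normr0.
      move: tI; rewrite inE/= in_itv/= => /andP[et tT].
      rewrite lee_fin normrM (normrM (u x)) -mulrA -[leRHS]mulrA ler_wpM2l//.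
      rewrite (ger0_norm (I0 t)) [leRHS]mulrC.
      by rewrite (le_trans _ (HC _ _ et tT))// ler_piMr.
    rewrite integral_cst//= lebesgue_measure_itv/= lte_fin eT -EFinD -EFinM lee_fin.
    by rewrite -[leLHS]mulrA mulrC.
  have CT : (0 <= C * (T - e))%R by rewrite mulr_ge0 ?subr_ge0// ltW.
  rewrite ge0_intZ//; [|by mfun|by move=> x; rewrite mulr_ge0 ?heat_ge0].
  rewrite lte_mul_pinfty ?lee_fin//.
  have T2 : (0 < 2 * T)%R by rewrite mulr_gt0.
  apply: le_lt_trans (Lp_heat_ub y p1 T2 measu) _.
  by rewrite lte_add_pinfty ?ltry// lte_mul_pinfty ?lee_fin ?powR_ge0.
have := Fubini fi.
have -> : \int[mu]_x \int[leb]_t f (x, t) =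
    \int[mu]_x (u x * K e x)%:E - \int[mu]_x (u x * K T x)%:E.
  rewrite -integralB//; [|exact: slice_integrable..].
  apply: eq_integral => x _.
  transitivity (\int[leb]_(t in `[e, T]) ((u x)%:E * (K t x * S t x)%:E)).
    rewrite [RHS]integral_mkcond; apply: eq_integral => t _.
    by rewrite /f /patch /I indicE/=; case: ifPn => _; rewrite ?mulr1 ?mulr0.
  rewrite integralZl//; last first.
    apply: measurable_bounded_integrable => //.
    - have lfin : leb `[e, T]%classic < +oo.
        by rewrite lebesgue_measure_itv/= lte_fin eT -EFinD ltry.
      exact: lfin.
    - have mKS : measurable_fun [set: R] (fun t => K t x * S t x)%R.
        by rewrite /hker /hsym; mfun.
      exact: measurable_funTS mKS.
    - exists (C * heat (2 * T) (x - y))%R; split; first by rewrite num_real.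
      move=> B HB t /=; rewrite in_itv/= => /andP[et tT].
      by apply: le_trans (ltW HB); exact: HC.
  rewrite integral_hker_sym//= -!EFinB -EFinM; congr EFin; ring.
move=> ->; apply: le_trans (_ : \int[leb]_t `| \int[mu]_x f (x, t) | <= _).
  by apply: le_abse_integral => //; exact: (measurable_fubini_G fi).
apply: ge0_le_lower_integral => t _ //.
have [tI|tI] := boolP (t \in (`[e, T]%classic : set R)); last first.
  rewrite [X in `|X|](_ : _ = 0).
    by rewrite abse0; apply: integral_ge0 => x _; rewrite lee_fin !mulr_ge0 ?pw_ge0 ?expR_ge0.
  by apply: integral0_eq => x _; rewrite /f/= /I indicE (negbTE tI) mulr0.
have t0 : (0 < t)%R by move: tI; rewrite inE/= in_itv/= => /andP[et _]; exact: lt_le_trans et.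
have -> : \int[mu]_x f (x, t) = \int[mu]_x (F x * K t x)%:E.
  rewrite -slice_identity//; apply: eq_integral => x _.
  by rewrite /f/= /I indicE tI mulr1.
apply: le_trans (le_abse_integral _ _ _) _ => //.
  by rewrite /hker; mfun.
apply: ge0_le_lower_integral => x _ //.
by rewrite /= /pw t0 powRr0 mul1r lee_fin normrM (ger0_norm (hker_ge0 _ _ _ _)) mulrC.
Qed.

End real_helmholtz.

(** The constant [b ^ b] results from raising u/b <= exp(u/b) to the power [b]. *)
Lemma powR_expR_ub {R : realType} (b : R) : 0 <= b ->
  exists2 C : R, 0 < C & forall u, 0 <= u -> u `^ b <= C * expR u.
Proof.
rewrite le_eqVlt => /predU1P[<-|b0].
  exists 1 => // u u0; rewrite powRr0 mul1r -[leLHS]expR0 ler_expR//.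
exists (b `^ b); first exact: powR_gt0.
move=> u u0; rewrite -[in leLHS](divfK (lt0r_neq0 b0) u) powRM ?divr_ge0 ?(ltW b0)//.
rewrite mulrC ler_wpM2l ?powR_ge0//.
rewrite (_ : expR u = expR (u / b) `^ b); last first.
  by rewrite /powR gt_eqF ?expR_gt0// expRK mulrC divfK ?gt_eqF.
rewrite ge0_ler_powR ?(ltW b0)// ?nnegrE ?expR_ge0// ?divr_ge0 ?(ltW b0)//.
by apply: le_trans (expR_ge1Dx _); rewrite lerDr.
Qed.

Section helmholtz_bound.
Context {R : realType} {n : nat}.
Local Notation mu := (lebrV R n).
Local Notation leb := (@lebesgue_measure R).
Variables (p w : R) (u F : 'rV[R]_n -> R).
Hypothesis p1 : 1 <= p.
Hypothesis w0 : 0 < w.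
Hypothesis measu : measurable_fun setT u.
Hypothesis measF : measurable_fun setT F.
Hypothesis up : (pint p u < +oo)%E.
Hypothesis Fp : (pint p F < +oo)%E.
Hypothesis cu : continuous u.
Hypothesis HH : forall psi, Schwartz psi ->
  Rintegral mu setT (fun x => u x * (w * psi x - Laplacian psi x)) =
  Rintegral mu setT (fun x => F x * psi x).
Variable y : 'rV[R]_n.

Local Notation K := (hker w y).
Local Notation M := (\int[leb]_t \int[mu]_x (pw 0 t * hker w y t x * `|F x|)%:E)%E.
Local Notation U e := (\int[mu]_x (u x * K e x)%:E)%E.

Lemma slice_abs_ub t : 0 < t ->
  (`| \int[mu]_x (u x * heat t (x - y))%:E | <=
   1 + ((4 * pi * t) `^ (- (n%:R / 2)))%:E * pint p u)%E.
Proof.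
move=> t0; apply: le_trans (le_abse_integral _ _ _) _ => //; first by mfun.
apply: le_trans (Lp_heat_ub y p1 t0 measu); apply: ge0_int_le => x //.
by rewrite normrM (ger0_norm (heat_ge0 _ _)).
Qed.

Lemma slice_heat_integrable t : 0 < t ->
  mu.-integrable setT (fun x => (u x * heat t (x - y))%:E).
Proof.
move=> t0; apply: (@Lp_heat_integrable _ _ p t y u _ 1) => //; first by mfun.
by move=> x; rewrite ger0_norm ?heat_ge0// mul1r.
Qed.

Lemma slice_hkerE t : 0 < t ->
  U t = ((expR (- (w * t)))%:E * \int[mu]_x (u x * heat t (x - y))%:E)%E.
Proof.
move=> t0; rewrite -integralZl//; last exact: slice_heat_integrable.
by apply: eq_integral => x _; rewrite /hker mulrCA EFinM.
Qed.

Lemma slice_ub e : 0 < e -> (`|U e| <= M)%E.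
Proof.
move=> e0; apply/lee_addgt0Pr => r r0.
pose N := fine (pint p u).
have N0 : 0 <= N by rewrite fine_ge0// pint_ge0.
(* [T >= 1] makes (4 pi T)^(-n/2) at most 1, and the last bound gives exp(-wT)(1 + N) <= (1 +
   N)/(wT) <= r, so the contribution of the late time is negligible. *)
pose T := Num.max (e + 1) (Num.max 1 ((1 + N) / (w * r))).
have eT : e < T by rewrite /T lt_max ltrDl ltr01.
have T1 : 1 <= T by rewrite /T !le_max lexx orbT.
have T0 : 0 < T by exact: lt_le_trans T1.
have TN : (1 + N) / (w * r) <= T by rewrite /T !le_max lexx !orbT.
have UT : (`|U T| <= r%:E)%E.
  rewrite slice_hkerE// abseM (gee0_abs (x := (expR _)%:E)) ?lee_fin ?expR_ge0//.
  apply: (@le_trans _ (\bar R) ((expR (- (w * T)))%:E * (1 + N)%:E)%E).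
    apply: lee_wpmul2l; first by rewrite lee_fin expR_ge0.
    apply: le_trans (slice_abs_ub T0) _.
    rewrite -[pint p u]fineK ?ge0_fin_numE ?pint_ge0// -EFinM -EFinD lee_fin lerD2l.
    have pT : 1 <= 4 * pi * T by have := pi_ge2 R; nra.
    by rewrite ler_piMl// -[leRHS](powRr0 (4 * pi * T)) ler_powR// oppr_le0 divr_ge0.
  rewrite -EFinM lee_fin mulrC.
  have wT : 0 < w * T by rewrite mulr_gt0.
  apply: (@le_trans _ _ ((1 + N) / (w * T))).
    rewrite ler_wpM2l ?addr_ge0// expRN lef_pV2 ?posrE ?expR_gt0//.
    by apply: le_trans (expR_ge1Dx _); rewrite lerDr.
  rewrite ler_pdivrMr// mulrCA -ler_pdivrMl// ?mulr_gt0//.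
  move: TN; rewrite ler_pdivrMr ?mulr_gt0// => TN.
  by rewrite ler_pdivrMl// (le_trans TN)// mulrC -!mulrA [r * T]mulrC.
have fU t : 0 < t -> U t \is a fin_num.
  by move=> t0; apply: integrable_fin_num => //; exact: (slice_integrable p1 w0).
have -> : U e = ((U e - U T) + U T)%E by rewrite subeK// fU.
apply: le_trans (lee_abs_add _ _) _; apply: leeD UT.
exact: (heat_increment p1 w0 measu measF up Fp HH y e0 eT).
Qed.

(** As [u] may be unbounded, a small mass of the kernel far from [y] is not enough: there [heat e]
    is shown to be at most [D * e * heat 1], and [u] is integrable against [heat 1]. *)
Lemma heat_concentration (r : R) : 0 < r -> exists2 e0 : R, 0 < e0 & forall e, 0 < e -> e <= e0 ->
  (`| \int[mu]_x (u x * heat e (x - y))%:E - (u y)%:E | <= r%:E)%E.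
Proof.
move=> r0.
have /nbhs_ballP[d /= d0 Hd] : nbhs y [set x | `|u y - u x| < r / 2].
  have /cvgrPdist_lt := (cu (x := y)).
  by apply; rewrite divr_gt0.
(* Balls of row vectors are sup-norm balls, and each coordinate is at most the Euclidean norm. *)
have near x : sqnorm (x - y) < d ^+ 2 -> `|u x - u y| <= r / 2.
  move=> xy; rewrite distrC; apply/ltW/Hd; split=> // i j.
  rewrite (ord1 i) /ball/= /ball_/=.
  rewrite -(ltr_pXn2r (n := 2))// ?nnegrE ?(ltW d0)// real_normK ?num_real//.
  apply: le_lt_trans xy; rewrite sqnormE (bigD1 j)//= -sqrrN opprB lerDl.
  by apply: sumr_ge0 => k _; exact: sqr_ge0.
(* A bound for the integral of [|u| + |u y|] against [heat 1]. *)
pose L := 1 + (4 * pi * 1) `^ (- (n%:R / 2)) * fine (pint p u) + `|u y|.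
have L0 : 0 < L.
  by rewrite /L -addrA ltr_pwDl// addr_ge0// mulr_ge0 ?powR_ge0// fine_ge0// pint_ge0.
have [C C0 HC] := @powR_expR_ub R (n%:R / 2) (divr_ge0 (ler0n _ _) (ler0n _ _)).
pose D := C * (d ^+ 2 / 16) `^ (- (n%:R / 2)) * (16 / d ^+ 2).
have d20 : 0 < d ^+ 2 / 16 by rewrite divr_gt0// exprn_gt0.
have D0 : 0 < D by rewrite /D !mulr_gt0 ?powR_gt0 ?invr_gt0 ?exprn_gt0.
have far e x : 0 < e -> e <= 1 / 2 -> d ^+ 2 <= sqnorm (x - y) ->
    heat e (x - y) <= D * e * heat 1 (x - y).
  move=> e0 e1 dxy; rewrite !heatE//; set s := sqnorm (x - y) in dxy *.
  have pe : 4 * pi * e = e * (4 * pi * 1) by rewrite mulr1 mulrC.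
  have pi0 : 0 <= 4 * pi * 1 :> R by rewrite !mulr_ge0// pi_ge0.
  have ei : 0 < e^-1 by rewrite invr_gt0.
  have de : 0 < d ^+ 2 / 16 / e by rewrite divr_gt0.
  have s0 : 0 <= s by exact: sqnorm_ge0.
  rewrite pe (powRM _ (ltW e0) pi0) mulrAC [leRHS]mulrCA [leRHS]mulrC.
  apply: ler_wpM2r; first exact: powR_ge0.
  (* Since 1/e >= 2 and s >= d^2, s/(4e) >= 2 d^2/(16e) + s/4. One copy of exp(-d^2/(16e)) absorbs
     e^(-n/2), the other yields the factor e. *)
  have E1 : expR (- (s / (4 * e))) <=
      expR (- (d ^+ 2 / 16 / e)) * (expR (- (d ^+ 2 / 16 / e)) * expR (- (s / (4 * 1)))).
    rewrite -!expRD ler_expR.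
    have -> : s / (4 * e) = s / 4 * e^-1 by rewrite invfM mulrA.
    have e2 : 2 <= e^-1.
      by rewrite -[leLHS]invrK lef_pV2 ?posrE ?invr_gt0// -[2^-1]mul1r.
    rewrite mulr1; nra.
  apply: le_trans (ler_wpM2l (powR_ge0 _ _) E1) _.
  rewrite !mulrA ler_wpM2r ?expR_ge0//.
  have E2 : e `^ (- (n%:R / 2)) <= (d ^+ 2 / 16) `^ (- (n%:R / 2)) * (C * expR (d ^+ 2 / 16 / e)).
    have -> : e `^ (- (n%:R / 2)) = (d ^+ 2 / 16) `^ (- (n%:R / 2)) * (d ^+ 2 / 16 / e) `^ (n%:R / 2).
      rewrite (powRM _ (ltW d20) (ltW ei)) mulrA -powRDp// addNr powRr0 mul1r.
      by rewrite -[e^-1]powR_inv1 ?(ltW e0)// -powRrM mulN1r.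
    by rewrite ler_wpM2l ?powR_ge0// HC// ltW.
  have E3 : expR (- (d ^+ 2 / 16 / e)) <= 16 / d ^+ 2 * e.
    rewrite expRN -[leRHS]invrK lef_pV2 ?posrE ?expR_gt0 ?invr_gt0 ?mulr_gt0 ?invr_gt0 ?exprn_gt0//.
    rewrite !invfM invrK [16^-1 * _]mulrC.
    by apply: le_trans (expR_ge1Dx _); rewrite lerDr.
  apply: (@le_trans _ _ ((d ^+ 2 / 16) `^ (- (n%:R / 2)) * (C * expR (d ^+ 2 / 16 / e)) *
     expR (- (d ^+ 2 / 16 / e)) * (16 / d ^+ 2 * e))).
    apply: ler_pM => //; rewrite ?mulr_ge0 ?powR_ge0 ?expR_ge0//.
    by rewrite ler_wpM2r ?expR_ge0.
  rewrite -[X in X * (16 / _ * e)]mulrA -[X in _ * X * (16 / _ * e)]mulrA -expRD subrr expR0 mulr1.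
  by rewrite le_eqVlt; apply/orP; left; apply/eqP; rewrite /D; ring.
exists (Num.min (1 / 2) (r / (2 * D * L))); first by rewrite lt_min; apply/andP; split; apply: divr_gt0 => //; apply: mulr_gt0 => //; exact: mulr_gt0.
move=> e e0; rewrite le_min => /andP[e1 e2].
have De : 0 <= D * e by apply: mulr_ge0; exact: ltW.
have H1 := integral_heat y e0.
have iu := slice_heat_integrable e0.
have ih : mu.-integrable setT (fun x => (u y * heat e (x - y))%:E).
  under eq_fun do rewrite EFinM.
  apply: integrableZl => //; apply/integrableP; split; first by mfun.
  by under eq_integral do rewrite gee0_abs ?lee_fin ?heat_ge0//; rewrite H1 ltry.
rewrite EFinN; have -> : ((u y)%:E = \int[mu]_x (u y * heat e (x - y))%:E)%E.
  under eq_integral do rewrite EFinM.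
  rewrite integralZl//; first by rewrite H1 mule1.
  apply/integrableP; split; first by mfun.
  by under eq_integral do rewrite gee0_abs ?lee_fin ?heat_ge0//; rewrite H1 ltry.
rewrite -integralB//.
apply: le_trans (le_abse_integral _ _ _) _ => //.
  by apply: emeasurable_funB; mfun.
apply: (@le_trans _ (\bar R) (\int[mu]_x (r / 2 * heat e (x - y) +
    D * e * (`|u x| * heat 1 (x - y) + `|u y| * heat 1 (x - y)))%:E)%E).
  apply: ge0_le_lower_integral => x _ //.
  rewrite -EFinB /= lee_fin -mulrBl normrM (ger0_norm (heat_ge0 _ _)).
  have P1 : 0 <= r / 2 * heat e (x - y) by rewrite mulr_ge0 ?heat_ge0 ?divr_ge0 ?(ltW r0).
  have P2 : 0 <= D * e * (`|u x| * heat 1 (x - y) + `|u y| * heat 1 (x - y)).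
    by apply: mulr_ge0 => //; apply: addr_ge0; apply: mulr_ge0 => //; exact: heat_ge0.
  have [xy|xy] := ltP (sqnorm (x - y)) (d ^+ 2).
    by apply: le_trans (ler_wpM2r (heat_ge0 _ _) (near _ xy)) _; rewrite lerDl.
  apply: (@le_trans _ _ ((`|u x| + `|u y|) * (D * e * heat 1 (x - y)))).
    by apply: ler_pM; rewrite ?heat_ge0// ?ler_normB//; exact: far.
  by rewrite mulrCA mulrDl lerDr.
rewrite ge0_intD; [|by mfun|by mfun|by move=> x; rewrite mulr_ge0 ?heat_ge0 ?divr_ge0 ?(ltW r0)|
  by move=> x; rewrite mulr_ge0// addr_ge0// mulr_ge0 ?heat_ge0].
rewrite ge0_intZ; [|by mfun|by move=> x; exact: heat_ge0|by rewrite divr_ge0 ?(ltW r0)].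
rewrite H1 mule1 ge0_intZ//; [|by mfun|by move=> x; rewrite addr_ge0// mulr_ge0 ?heat_ge0].
rewrite ge0_intD; [|by mfun|by mfun|by move=> x; rewrite mulr_ge0 ?heat_ge0..].
rewrite ge0_intZ//; [|by mfun|by move=> x; exact: heat_ge0].
rewrite integral_heat// mule1.
have B := Lp_heat_ub y p1 (ltr01 : 0 < 1 :> R) measu.
apply: (@le_trans _ (\bar R) ((r / 2)%:E + (D * e)%:E * L%:E)%E).
  rewrite leeD2l// lee_wpmul2l ?lee_fin//.
  rewrite /L !EFinD leeD2r//; apply: le_trans B _.
  by rewrite EFinM fineK// ge0_fin_numE// pint_ge0.
rewrite -EFinM -EFinD lee_fin.
have DL : 0 < 2 * D * L by apply: mulr_gt0 => //; exact: mulr_gt0.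
move: e2; rewrite ler_pdivlMr// => e2.
suff : D * e * L <= r / 2 by lra.
by rewrite ler_pdivlMr//; apply: le_trans e2; rewrite le_eqVlt; apply/orP; left; apply/eqP; ring.
Qed.

(* Tested against [hker w y t], the equation says that [\int u * hker w y t] has
   time derivative [- \int F * hker w y t]; it vanishes as t tends to infinity
   and tends to [u y] as t tends to 0, because [u] is continuous. *)
Lemma helmholtz_ub : (`|u y|%:E <= M)%E.
Proof.
have M0 : (0 <= M)%E.
  by apply: integral_ge0 => t _; apply: integral_ge0 => x _;
    rewrite lee_fin !mulr_ge0 ?pw_ge0 ?expR_ge0.
have [Moo|Mfin] := eqVneq M +oo%E; first by rewrite Moo leey.
have Mf : M \is a fin_num by rewrite ge0_fin_numE// ltey.
rewrite -(fineK Mf); set m := fine M.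
have m0 : 0 <= m by exact: fine_ge0.
apply/lee_addgt0Pr => r r0.
(* The error [r'] of the concentration and the error [r' * m] of dropping the factor exp(-we) >=
   1/(1 + r') add up to [r]. *)
pose r' := r / (1 + m).
have r'0 : 0 < r' by rewrite divr_gt0// ltr_pwDl.
have [e0 e00 He0] := heat_concentration r'0.
pose e := Num.min e0 (ln (1 + r') / w).
have l0 : 0 < ln (1 + r') by rewrite ln_gt0// ltrDl.
have ep : 0 < e by rewrite lt_min e00 divr_gt0.
have ee0 : e <= e0 by rewrite ge_min lexx.
have ew : w * e <= ln (1 + r').
  by rewrite mulrC -ler_pdivlMr// ge_min lexx orbT.
set I := (\int[mu]_x (u x * heat e (x - y))%:E)%E.
have If : I \is a fin_num by apply: integrable_fin_num => //; exact: slice_heat_integrable.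
have A1 : (`|I - (u y)%:E| <= r'%:E)%E by exact: He0.
have A2 : (`|I| <= ((1 + r') * m)%:E)%E.
  have := slice_ub ep; rewrite slice_hkerE// -/I.
  rewrite -(fineK Mf) -/m -(fineK If) -EFinM !abse_EFin !lee_fin normrM (ger0_norm (expR_ge0 _)).
  rewrite expRN ler_pdivrMl ?expR_gt0// => H; apply: le_trans H _.
  by rewrite ler_wpM2r// -[leRHS]lnK ?posrE ?addr_gt0// ler_expR.
move: A1 A2; rewrite -(fineK If) -EFinB !abse_EFin -EFinD !lee_fin => A1 A2.
have := ler_normD (u y - fine I) (fine I); rewrite subrK distrC => A3.
have rr : r' + r' * m = r by rewrite -[X in X + _]mulr1 -mulrDr /r' divfK// gt_eqF// ltr_pwDl.
lra.
Qed.

End helmholtz_bound.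

(** * Pairing with a Bochner integral *)

Section normc.
Context {R : realType}.
Implicit Types z : R[i].

Lemma normcE' z : Normc.normc z = Num.sqrt (complex.Re z ^+ 2 + complex.Im z ^+ 2).
Proof. by case: z. Qed.

Lemma normc_ge0' z : 0 <= Normc.normc z.
Proof. by rewrite normcE' sqrtr_ge0. Qed.

Lemma Re_le_normc z : `|complex.Re z| <= Normc.normc z.
Proof. by rewrite normcE' -sqrtr_sqr ler_wsqrtr// lerDl sqr_ge0. Qed.

Lemma Im_le_normc z : `|complex.Im z| <= Normc.normc z.
Proof. by rewrite normcE' -sqrtr_sqr ler_wsqrtr// lerDr sqr_ge0. Qed.

Lemma normc_le_ReIm z : Normc.normc z <= `|complex.Re z| + `|complex.Im z|.
Proof.
rewrite normcE' -[leRHS]ger0_norm ?addr_ge0// -sqrtr_sqr ler_wsqrtr//.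
rewrite sqrrD !real_normK ?num_real//.
by rewrite addrAC lerDl mulrn_wge0// mulr_ge0.
Qed.

Lemma measurable_normc {d} {T : measurableType d} (f : T -> R[i]) :
  cmeasurable f -> measurable_fun setT (fun x => Normc.normc (f x)).
Proof.
move=> [mr mi].
rewrite (_ : (fun x => _) =
    fun x => (complex.Re (f x) ^+ 2 + complex.Im (f x) ^+ 2) `^ 2^-1); first by mfun.
by apply/funext => x; rewrite normcE' powR12_sqrt// addr_ge0 ?sqr_ge0.
Qed.

Lemma ReB z z' : complex.Re (z - z') = complex.Re z - complex.Re z'.
Proof. by case: z z' => [a b] [c e]. Qed.

Lemma ImB z z' : complex.Im (z - z') = complex.Im z - complex.Im z'.
Proof. by case: z z' => [a b] [c e]. Qed.

Lemma cmeasurableB {d} {T : measurableType d} (f g : T -> R[i]) :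
  cmeasurable f -> cmeasurable g -> cmeasurable (fun x => f x - g x).
Proof.
move=> [fr fi] [gr gi]; split.
  by under eq_fun do rewrite ReB; exact: measurable_funB.
by under eq_fun do rewrite ImB; exact: measurable_funB.
Qed.

Lemma Re_realM (a : R) z : complex.Re (a%:C%C * z) = a * complex.Re z.
Proof. by case: z => [x y] /=; rewrite mul0r subr0. Qed.

Lemma Im_realM (a : R) z : complex.Im (a%:C%C * z) = a * complex.Im z.
Proof. by case: z => [x y] /=; rewrite mul0r addr0. Qed.

Lemma Re_sum (I : finType) (f : I -> R[i]) :
  complex.Re (\sum_i f i) = \sum_i complex.Re (f i).
Proof. by elim/big_rec2 : _ => // i a z _ <-; case: (f i) z => [? ?] [? ?]. Qed.

Lemma Im_sum (I : finType) (f : I -> R[i]) :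
  complex.Im (\sum_i f i) = \sum_i complex.Im (f i).
Proof. by elim/big_rec2 : _ => // i a z _ <-; case: (f i) z => [? ?] [? ?]. Qed.

Lemma normcD_le z z' : Normc.normc (z + z') <= Normc.normc z + Normc.normc z'.
Proof.
by have := ler_normD z z'; rewrite !normc_def -!normcE' -rmorphD lecR.
Qed.

Lemma normcB_le z z' : Normc.normc (z - z') <= Normc.normc z + Normc.normc z'.
Proof.
by have := ler_normB z z'; rewrite !normc_def -!normcE' -rmorphD lecR.
Qed.

End normc.

Section lower_integral_add.
Context {d} {T : measurableType d} {R : realType}.
Variable mu : {measure set T -> \bar R}.
Local Open Scope ereal_scope.

(* [D] need not be measurable: its integral is a lower integral. *)
Lemma lower_integral_leD (E M D : T -> \bar R) (c : R) : (0 < c)%R ->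
  measurable_fun setT E -> measurable_fun setT M ->
  (forall x, 0 <= E x) -> (forall x, 0 <= M x) -> (forall x, 0 <= D x) ->
  (forall x, E x <= M x + c%:E * D x) ->
  \int[mu]_x E x <= \int[mu]_x M x + c%:E * \int[mu]_x D x.
Proof.
move=> c0 mE mM E0 M0 D0 H.
(* The positive part of [E - M] is measurable and at most [c * D]. Additivity is applied to [M + g],
   and [D] enters by monotonicity alone. *)
pose g x := maxe (E x - M x) 0.
have g0 x : 0 <= g x by rewrite /g le_max lexx orbT.
have mg : measurable_fun setT g.
  by apply: measurable_maxe; [exact: emeasurable_funB|exact: measurable_cst].
have EMg x : E x <= M x + g x.
  have [Moo|Moo] := eqVneq (M x) +oo.
    by rewrite Moo addye ?leey// gt_eqF// (lt_le_trans _ (g0 x)).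
  have Mf : M x \is a fin_num by rewrite ge0_fin_numE// ltey.
  by rewrite -leeBlDl// /g le_max lexx.
have gD x : (c^-1)%:E * g x <= D x.
  rewrite lee_pdivrMl// /g ge_max mule_ge0 ?lee_fin ?(ltW c0)// andbT.
  have [Moo|Moo] := eqVneq (M x) +oo.
    by rewrite Moo addeNy leNye.
  have Mf : M x \is a fin_num by rewrite ge0_fin_numE// ltey.
  by rewrite leeBlDl.
apply: (@le_trans _ _ (\int[mu]_x (M x + g x))).
  by apply: ge0_le_lower_integral => x _.
rewrite ge0_integralD// leeD2l//.
rewrite -lee_pdivrMl// -ge0_integralZl ?lee_fin ?invr_ge0 ?(ltW c0)//.
apply: ge0_le_lower_integral => x _ //.
by rewrite mule_ge0// lee_fin invr_ge0 ltW.
Qed.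

End lower_integral_add.

Section Lp_pairing.
Context {R : realType} {n : nat}.
Local Notation mu := (lebrV R n).
Local Open Scope ereal_scope.
Implicit Types (f g h : 'rV[R]_n -> R) (p : R).

Lemma LnormE p f : (0 < p)%R ->
  Lnorm (lebesgue_rV R n) p%:E (fun x => (f x)%:E) = pint p f `^ p^-1.
Proof. by move=> p0; rewrite unlock /=; congr (_ `^ _). Qed.

Lemma pint_pairing p p' f h : (0 < p)%R -> (0 < p')%R -> (p^-1 + p'^-1 = 1)%R ->
  measurable_fun setT f -> measurable_fun setT h ->
  \int[mu]_x (`|f x * h x|)%:E <= pint p f `^ p^-1 * pint p' h `^ p'^-1.
Proof.
move=> p0 p'0 pp mf mh.
have := @hoelder _ _ _ (mu : {measure set _ -> \bar R}) f h p p' mf mh p0 p'0 pp.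
rewrite Lnorm1 unlock /=; apply: le_trans.
by apply: ge0_le_lower_integral => x _ //.
Qed.

End Lp_pairing.

Section bochner.
Context {R : realType} {n : nat}.
Local Notation mu := (lebrV R n).
Local Notation leb := (@lebesgue_measure R).
Local Notation Rpos := (`]0, +oo[%classic : set R).
Variables (p p' : R) (G : R -> 'rV[R]_n -> R[i]) (Phi : 'rV[R]_n -> R[i]).
Variables (h : 'rV[R]_n -> R) (M : R -> \bar R).
Hypothesis p0 : 0 < p.
Hypothesis p'0 : 0 < p'.
Hypothesis pp : p^-1 + p'^-1 = 1.
Hypothesis mh : measurable_fun setT h.
Hypothesis h0 : forall x, 0 <= h x.
Hypothesis hp : (pint p' h < +oo)%E.
Hypothesis mM : measurable_fun setT M.
Hypothesis M0 : forall t, (0 <= M t)%E.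
Hypothesis GM : forall t, 0 < t -> (\int[mu]_x (Normc.normc (G t x) * h x)%:E <= M t)%E.

(** The triangle inequality for integrals, used for real and imaginary parts separately; this costs
    the factor 2. *)
Lemma simple_integral_ub (S : @simple_Lp R _ 'rV[R]_n) x :
  simple_Lp_on (lebesgue_rV R n) p Rpos S ->
  ((Normc.normc (simple_integral S x))%:E <=
   2%:E * \int[leb]_t (Normc.normc (simple_eval S t x))%:E)%E.
Proof.
move=> HS.
have mS (i : 'I_(simple_size S)) : measurable (simple_set i) by have [] := HS i.
have key (r : 'I_(simple_size S) -> R) :
    (`| \sum_i fine (leb (simple_set i)) * r i |%:E <=
      \int[leb]_t (`| \sum_i \1_(simple_set i) t * r i |)%:E)%E.
  have mI (i : 'I_(simple_size S)) : measurable_fun [set: R] (\1_(simple_set i) : R -> R).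
    exact: measurable_indic.
  have ii (i : 'I_(simple_size S)) :
      leb.-integrable setT (fun t => (\1_(simple_set i) t : R)%:E).
    apply/integrableP; split.
      by apply/measurable_EFinP; exact: mI.
    under eq_integral do rewrite gee0_abs ?lee_fin//.
    by have [_ _ lS _] := HS i; rewrite integral_indic ?setIT//; exact: mS.
  have int (i : 'I_(simple_size S)) : leb.-integrable setT (fun t => (\1_(simple_set i) t * r i)%:E).
    under eq_fun do rewrite mulrC EFinM.
    exact: integrableZl.
  have E : ((\sum_i fine (leb (simple_set i)) * r i)%:E =
      \int[leb]_t (\sum_i \1_(simple_set i) t * r i)%:E)%E.
    under [RHS]eq_integral do rewrite -sumEFin.
    rewrite integral_sum// -sumEFin; apply: eq_bigr => i _.
    under eq_integral do rewrite mulrC EFinM.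
    rewrite integralZl//.
    have [_ _ lS _] := HS i.
    have E1 : (\int[leb]_t (\1_(simple_set i) t : R)%:E = leb (simple_set i))%E.
      by rewrite integral_indic ?setIT//; exact: mS.
    have lf : (leb (simple_set i)) \is a fin_num by rewrite ge0_fin_numE.
    rewrite [X in (_ = _ * X)%E]E1 -{2}(fineK lf) -EFinM; congr EFin; exact: mulrC.
  rewrite -abse_EFin E; apply: le_trans (le_abse_integral _ _ _) _ => //.
  apply/measurable_EFinP; apply: measurable_sum => i.
  by apply: measurable_funM => //; exact: mI.
have kRe : (`| complex.Re (simple_integral S x) |%:E <=
    \int[leb]_t (Normc.normc (simple_eval S t x))%:E)%E.
  rewrite /simple_integral Re_sum; under eq_bigr do rewrite Re_realM.
  apply: le_trans (key _) _; apply: ge0_int_le => t //.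
  apply: le_trans (Re_le_normc _); rewrite /simple_eval Re_sum.
  by under [in leRHS]eq_bigr do rewrite Re_realM.
have kIm : (`| complex.Im (simple_integral S x) |%:E <=
    \int[leb]_t (Normc.normc (simple_eval S t x))%:E)%E.
  rewrite /simple_integral Im_sum; under eq_bigr do rewrite Im_realM.
  apply: le_trans (key _) _; apply: ge0_int_le => t //.
  apply: le_trans (Im_le_normc _); rewrite /simple_eval Im_sum.
  by under [in leRHS]eq_bigr do rewrite Im_realM.
rewrite (_ : 2%:E = 1 + 1)%E; last by rewrite -EFinD.
rewrite ge0_muleDl ?mul1e ?lee_fin//; apply: le_trans (leeD kRe kIm).
by rewrite -EFinD lee_fin normc_le_ReIm.
Qed.

Lemma cmeasurable_simple_eval (S : @simple_Lp R _ 'rV[R]_n) :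
  simple_Lp_on (lebesgue_rV R n) p Rpos S ->
  @cmeasurable R _ ('rV[R]_n * R)%type (fun z => simple_eval S z.2 z.1).
Proof.
move=> HS; have mS (i : 'I_(simple_size S)) : measurable (simple_set i) by have [] := HS i.
have mI (i : 'I_(simple_size S)) : measurable_fun [set: R] (\1_(simple_set i) : R -> R) by exact: measurable_indic.
split.
  under eq_fun do rewrite /simple_eval Re_sum.
  apply: measurable_sum => i; under eq_fun do rewrite Re_realM.
  have [_ _ _ [[mr _] _]] := HS i.
  apply: measurable_funM; first exact: (measurableT_comp (mI i) measurable_snd).
  exact: (measurableT_comp mr measurable_fst).
under eq_fun do rewrite /simple_eval Im_sum.
apply: measurable_sum => i; under eq_fun do rewrite Im_realM.
have [_ _ _ [[_ mr] _]] := HS i.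
apply: measurable_funM; first exact: (measurableT_comp (mI i) measurable_snd).
exact: (measurableT_comp mr measurable_fst).
Qed.

Lemma cmeasurable_simple_integral (S : @simple_Lp R _ 'rV[R]_n) :
  simple_Lp_on (lebesgue_rV R n) p Rpos S -> cmeasurable (simple_integral S).
Proof.
move=> HS; split.
  under eq_fun do rewrite /simple_integral Re_sum.
  apply: measurable_sum => i; under eq_fun do rewrite Re_realM.
  by have [_ _ _ [[mr _] _]] := HS i; apply: measurable_funM.
under eq_fun do rewrite /simple_integral Im_sum.
apply: measurable_sum => i; under eq_fun do rewrite Im_realM.
by have [_ _ _ [[_ mr] _]] := HS i; apply: measurable_funM.
Qed.

(** The order of integration is exchanged for the simple functions, which are jointly measurable,
    and not for [G]. Passing from [Phi] to a simple integral and from a simple function back to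
    [G t] costs L^p distances, by Hölder's inequality with [h] in the dual space, and these vanish
    in the limit. The distances in [t] need not be measurable, hence the measurable majorant [M]. *)
Lemma bochner_pairing_ub : is_Bochner_integral (lebesgue_rV R n) p Rpos G Phi ->
  (\int[mu]_x (Normc.normc (Phi x) * h x)%:E <= 2%:E * \int[leb]_t M t)%E.
Proof.
move=> [LG [[mPhi _] [S [HS _ HD HI]]]].
(* The added 1 makes the Hölder constant positive, so that it can be divided by. *)
pose H := fine (pint p' h `^ p'^-1)%E + 1.
have Hf : (pint p' h `^ p'^-1)%E \is a fin_num.
  by rewrite ge0_fin_numE ?poweR_ge0// poweR_lty.
have H0 : 0 < H by rewrite ltr_wpDl// fine_ge0// poweR_ge0.
have pairing f : cmeasurable f ->
    (\int[mu]_x (Normc.normc (f x) * h x)%:E <= H%:E * cLnorm (lebesgue_rV R n) p f)%E.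
  move=> mf; rewrite /cLnorm LnormE//.
  have PP := pint_pairing p0 p'0 pp (measurable_normc mf) mh.
  apply: le_trans (le_trans _ PP) _.
    apply: ge0_int_le => x; first by rewrite mulr_ge0 ?normc_ge0'.
    by rewrite ger0_norm// mulr_ge0 ?normc_ge0'.
  rewrite muleC lee_wpmul2r ?poweR_ge0// -(fineK Hf) lee_fin /H lerDl//.
have step k : (\int[mu]_x (Normc.normc (Phi x) * h x)%:E <=
    H%:E * cLdist (lebesgue_rV R n) p (simple_integral (S k)) Phi +
    2%:E * (\int[leb]_t M t + H%:E *
      \int[leb]_(t in Rpos) cLdist (lebesgue_rV R n) p (simple_eval (S k) t) (G t)))%E.
  have mI := cmeasurable_simple_integral (HS k).
  have mE := cmeasurable_simple_eval (HS k).
  have mnE := measurable_normc mE.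
  have mnI := measurable_normc mI.
  have mnP := measurable_normc mPhi.
  have mnIP := measurable_normc (cmeasurableB mI mPhi).
  apply: (@le_trans _ (\bar R) (\int[mu]_x (Normc.normc (simple_integral (S k) x - Phi x) * h x +
     Normc.normc (simple_integral (S k) x) * h x)%:E)%E).
    apply: ge0_int_le => x; first by rewrite mulr_ge0 ?normc_ge0'.
    rewrite -mulrDl ler_wpM2r//.
    have := normcB_le (simple_integral (S k) x) (simple_integral (S k) x - Phi x).
    by rewrite subKr addrC.
  rewrite ge0_intD; [|by apply: measurable_funM|by apply: measurable_funM|by move=> x; rewrite mulr_ge0 ?normc_ge0'..].
  apply: leeD; first by apply: pairing; exact: cmeasurableB.
  apply: (@le_trans _ (\bar R) (2%:E * \int[mu]_x \int[leb]_t
      (Normc.normc (simple_eval (S k) t x) * h x)%:E)%E).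
    rewrite -ge0_integralZl//=; last 2 first.
    - apply: (measurable_integral1 leb).
        apply/measurable_EFinP; apply: measurable_funM => //.
        exact: (measurableT_comp mh measurable_fst).
      by move=> x t; rewrite lee_fin mulr_ge0 ?normc_ge0'.
    - by move=> x _; apply: integral_ge0 => t _; rewrite lee_fin mulr_ge0 ?normc_ge0'.
    apply: ge0_le_lower_integral => x _; first by rewrite lee_fin mulr_ge0 ?normc_ge0'.
    have mx : measurable_fun [set: R] (fun t => Normc.normc (simple_eval (S k) t x)).
      exact: (measurableT_comp mnE (measurable_pair1 x)).
    under eq_integral do rewrite mulrC.
    rewrite ge0_intZ//; last by move=> t; exact: normc_ge0'.
    rewrite EFinM muleCA [leLHS]muleC lee_wpmul2l ?lee_fin//.
    exact: simple_integral_ub.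
  rewrite lee_wpmul2l// tonelli; last 2 first.
  - apply/measurable_EFinP; apply: measurable_funM => //.
    exact: (measurableT_comp mh measurable_fst).
  - by move=> x t; rewrite lee_fin mulr_ge0 ?normc_ge0'.
  rewrite [X in (_ <= _ + _ * X)%E]integral_mkcond.
  apply: lower_integral_leD => //.
  - apply: (measurable_integral2 mu).
      apply/measurable_EFinP; apply: measurable_funM => //.
      exact: (measurableT_comp mh measurable_fst).
    by move=> x t; rewrite lee_fin mulr_ge0 ?normc_ge0'.
  - by move=> t; apply: integral_ge0 => x _; rewrite lee_fin mulr_ge0 ?normc_ge0'.
  - by move=> t; rewrite /patch; case: ifPn => // _; exact: Lnorm_ge0.
  move=> t; rewrite /patch; case: ifPn => tR; last first.
    rewrite mule0 adde0 integral0_eq// => x _.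
    rewrite /simple_eval big1 ?Normc.normc0 ?mul0r// => i _.
    have [_ Si _ _] := HS k i; rewrite indicE memNset ?mul0r//.
    by move=> /Si tR'; move/negP : tR; apply; rewrite inE.
  have t0 : 0 < t by move: tR; rewrite inE/= in_itv/= andbT.
  have [mG _] := LG t (set_mem tR).
  have met : cmeasurable (simple_eval (S k) t).
    by split; [exact: (measurableT_comp mE.1 (measurable_pair2 t))|
               exact: (measurableT_comp mE.2 (measurable_pair2 t))].
  apply: (@le_trans _ (\bar R) (\int[mu]_x (Normc.normc (G t x) * h x +
     Normc.normc (simple_eval (S k) t x - G t x) * h x)%:E)%E).
    apply: ge0_int_le => x; first by rewrite mulr_ge0 ?normc_ge0'.
    by rewrite -mulrDl ler_wpM2r// -{1}[simple_eval _ _ _](subrK (G t x)) addrC normcD_le.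
  have mnG := measurable_normc mG.
  have mnEG := measurable_normc (cmeasurableB met mG).
  rewrite ge0_intD; [|by apply: measurable_funM|by apply: measurable_funM|by move=> x; rewrite mulr_ge0 ?normc_ge0'..].
  by apply: leeD; [exact: GM|apply: pairing; exact: cmeasurableB].
have I0 : (0 <= \int[leb]_t M t)%E by exact: integral_ge0.
have [Moo|Moo] := eqVneq (\int[leb]_t M t)%E +oo%E.
  by rewrite Moo gt0_muley ?leey// lte_fin.
have Mf : (\int[leb]_t M t)%E \is a fin_num by rewrite ge0_fin_numE// ltey.
apply/lee_addgt0Pr => e e0.
(* The errors are [H * e'] once and, because of the factor 2, [H * e'] twice more. *)
pose e' := e / (3 * H).
have e'0 : 0 < e' by rewrite divr_gt0// mulr_gt0.
have small (a : nat -> \bar R) : a @ \oo --> 0%E -> \forall k \near \oo, (a k < e'%:E)%E.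
  move=> a0; have /a0 : nbhs (0%E : \bar R) [set u | (u < e'%:E)%E].
    by apply: open_ereal_lt'; rewrite lte_fin.
  by [].
near \oo => k.
apply: le_trans (step k) _.
have A1 : (cLdist (lebesgue_rV R n) p (simple_integral (S k)) Phi <= e'%:E)%E.
  by apply: ltW; near: k; exact: small.
have A2 : (\int[leb]_(t in Rpos) cLdist (lebesgue_rV R n) p (simple_eval (S k) t) (G t) <= e'%:E)%E.
  by apply: ltW; near: k; exact: small.
apply: (@le_trans _ (\bar R) (H%:E * e'%:E + 2%:E * (\int[leb]_t M t + H%:E * e'%:E))%E).
  apply: leeD; first by rewrite lee_wpmul2l ?lee_fin ?(ltW H0).
  by rewrite lee_wpmul2l ?lee_fin// leeD2l// lee_wpmul2l ?lee_fin ?(ltW H0).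
rewrite -(fineK Mf); set m := fine _.
rewrite (_ : (_ + _ <= _ + _)%E = (H * e' + 2 * (m + H * e') <= 2 * m + e))//.
have -> : e = 3 * H * e' by rewrite /e' mulrC divfK// gt_eqF// mulr_gt0.
by rewrite le_eqVlt; apply/orP; left; apply/eqP; ring.
Unshelve. all: by end_near. Qed.

End bochner.

(** * Bilinear heat kernel bounds *)

Section double_integrals.
Context {d1 d2} {T1 : measurableType d1} {T2 : measurableType d2} {R : realType}.
Variable m1 : {sigma_finite_measure set T1 -> \bar R}.
Variable m2 : {sigma_finite_measure set T2 -> \bar R}.
Local Open Scope ereal_scope.

Lemma int2D (f g : T1 -> T2 -> R) :
  measurable_fun [set: T1 * T2] (fun z => f z.1 z.2) ->
  measurable_fun [set: T1 * T2] (fun z => g z.1 z.2) ->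
  (forall x y, 0 <= f x y)%R -> (forall x y, 0 <= g x y)%R ->
  \int[m1]_x \int[m2]_y (f x y + g x y)%:E =
  \int[m1]_x \int[m2]_y (f x y)%:E + \int[m1]_x \int[m2]_y (g x y)%:E.
Proof.
move=> mf mg f0 g0; rewrite -ge0_integralD//; last 4 first.
- by move=> x _; apply: integral_ge0 => y _; rewrite lee_fin.
- by apply: measurable_integral1 => //; exact/measurable_EFinP.
- by move=> x _; apply: integral_ge0 => y _; rewrite lee_fin.
- by apply: measurable_integral1 => //; exact/measurable_EFinP.
apply: eq_integral => x _; apply: ge0_intD => //.
- exact: (measurableT_comp mf (measurable_pair1 x)).
- exact: (measurableT_comp mg (measurable_pair1 x)).
Qed.

Lemma int2_prod (f : T1 -> R) (g : T2 -> R) :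
  measurable_fun setT f -> measurable_fun setT g ->
  (forall x, 0 <= f x)%R -> (forall y, 0 <= g y)%R ->
  \int[m1]_x \int[m2]_y (f x * g y)%:E = \int[m1]_x (f x)%:E * \int[m2]_y (g y)%:E.
Proof.
move=> mf mg f0 g0.
under eq_integral do rewrite ge0_intZ//.
rewrite ge0_integralZr//; first exact/measurable_EFinP.
  by move=> x _; rewrite lee_fin.
by apply: integral_ge0 => y _; rewrite lee_fin.
Qed.

Lemma int2_le (f g : T1 -> T2 -> R) : (forall x y, 0 <= f x y)%R ->
  (forall x y, f x y <= g x y)%R ->
  \int[m1]_x \int[m2]_y (f x y)%:E <= \int[m1]_x \int[m2]_y (g x y)%:E.
Proof.
move=> f0 fg; apply: ge0_le_lower_integral => x _; last exact: ge0_int_le.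
by apply: integral_ge0 => y _; rewrite lee_fin.
Qed.

Lemma int2Z (k : R) (f : T1 -> T2 -> R) : (0 <= k)%R ->
  measurable_fun [set: T1 * T2] (fun z => f z.1 z.2) -> (forall x y, 0 <= f x y)%R ->
  \int[m1]_x \int[m2]_y (k * f x y)%:E = k%:E * \int[m1]_x \int[m2]_y (f x y)%:E.
Proof.
move=> k0 mf f0; rewrite -ge0_integralZl ?lee_fin//; last 2 first.
- by apply: measurable_integral1 => //; exact/measurable_EFinP.
- by move=> x _; apply: integral_ge0 => y _; rewrite lee_fin.
apply: eq_integral => x _; apply: ge0_intZ => //.
exact: (measurableT_comp mf (measurable_pair1 x)).
Qed.

Lemma int2_three (A : R) (P a : T1 -> R) (Q b : T2 -> R) : (0 <= A)%R ->
  measurable_fun setT P -> measurable_fun setT a ->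
  measurable_fun setT Q -> measurable_fun setT b ->
  (forall x, 0 <= P x)%R -> (forall x, 0 <= a x)%R ->
  (forall x, 0 <= Q x)%R -> (forall x, 0 <= b x)%R ->
  \int[m1]_x \int[m2]_y ((A * (P x * b y) + A * (a x * Q y)) + A * A * (P x * Q y))%:E
  = A%:E * (\int[m1]_x (P x)%:E * \int[m2]_y (b y)%:E) +
    A%:E * (\int[m1]_x (a x)%:E * \int[m2]_y (Q y)%:E) +
    A%:E * A%:E * (\int[m1]_x (P x)%:E * \int[m2]_y (Q y)%:E).
Proof.
move=> A0 mP ma mQ mb P0 a0 Q0 b0.
rewrite int2D; [|by mfun|by mfun|by move=> x y; rewrite addr_ge0 ?mulr_ge0|
  by move=> x y; rewrite !mulr_ge0].
rewrite int2D; [|by mfun|by mfun|by move=> x y; rewrite !mulr_ge0..].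
rewrite int2Z//; [|by mfun|by move=> x y; rewrite mulr_ge0].
rewrite int2Z//; [|by mfun|by move=> x y; rewrite mulr_ge0].
rewrite int2Z ?mulr_ge0//; [|by mfun|by move=> x y; rewrite mulr_ge0].
by rewrite !int2_prod// EFinM.
Qed.

Lemma int2_prode (f : T1 -> \bar R) (g : T2 -> \bar R) :
  measurable_fun setT f -> measurable_fun setT g ->
  (forall x, 0 <= f x) -> (forall y, 0 <= g y) ->
  \int[m1]_x f x * \int[m2]_y g y = \int[m1]_x \int[m2]_y (f x * g y).
Proof.
move=> mf mg f0 g0; rewrite -ge0_integralZr//; last exact: integral_ge0.
by apply: eq_integral => x _; rewrite ge0_integralZl.
Qed.

End double_integrals.

Lemma powR_div {R : realType} (x y a : R) : 0 < x -> 0 < y ->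
  (x / y) `^ a = x `^ a * y `^ (- a).
Proof.
move=> x0 y0; rewrite (powRM _ (ltW x0)); last by rewrite invr_ge0 ltW.
by rewrite -[y^-1]powR_inv1 ?(ltW y0)// -powRrM mulN1r.
Qed.

Section exponents.
Context {R : realType}.
Variables (p r sg : R).
Hypothesis p1 : 1 < p.
Hypothesis r1 : 1 < r.
Hypothesis sg0 : 0 < sg.
Hypothesis prs : p^-1 + r^-1 = 1 + sg.

(** For [e > 1] this is F^(1 + sg) on [0, 1] and F^(1/e) above 1: below F with a power to spare at
    both ends, which gives integrability over all scales. It is applied to F = v(x)^p t^k, the size
    of [v] relative to the time. *)
Definition phi (e F : R) : R := Num.min (F `^ (1 + sg)) (F `^ e^-1).

Lemma phi_ge0 e F : 0 <= phi e F.
Proof. by rewrite le_min !powR_ge0. Qed.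

Lemma measurable_phi {d} {T : measurableType d} e (f : T -> R) :
  measurable_fun setT f -> measurable_fun setT (fun x => phi e (f x)).
Proof. by move=> mf; rewrite /phi; mfun. Qed.

Lemma powR_anti (a x y : R) : 0 <= a -> a <= 1 -> 0 < x -> x <= y -> a `^ y <= a `^ x.
Proof.
rewrite le_eqVlt => /predU1P[<-|a0] a1 x0 xy.
  by rewrite !powR0 ?gt_eqF// (lt_le_trans x0).
by apply: ger_powR => //; rewrite a0.
Qed.

Lemma phi_le1 e F : 1 < e -> 0 <= F -> F <= 1 -> phi e F = F `^ (1 + sg).
Proof.
move=> e1 F0 F1; apply/min_idPl; apply: powR_anti => //.
  by rewrite invr_gt0 (lt_trans _ e1).
rewrite (@le_trans _ _ 1)// ?lerDl ?(ltW sg0)// invf_le1 ?(ltW e1)//.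
by rewrite (lt_trans _ e1).
Qed.

Lemma phi_ge1 e F : 1 < e -> 1 <= F -> phi e F = F `^ e^-1.
Proof.
move=> e1 F1; apply/min_idPr; apply: ler_powR => //.
rewrite (@le_trans _ _ 1)// ?lerDl ?(ltW sg0)// invf_le1 ?(ltW e1)//.
by rewrite (lt_trans _ e1).
Qed.

Lemma phi_le_id e F : 1 < e -> 0 <= F -> phi e F <= F.
Proof.
move=> e1 F0; have [F1|F1] := leP F 1.
  rewrite phi_le1// -[leRHS](powRr1 F0); apply: powR_anti => //.
  by rewrite lerDl ltW.
rewrite phi_ge1 ?(ltW F1)// -[leRHS](powRr1 F0); apply: ler_powR; first exact: ltW.
by rewrite invf_le1 ?(ltW e1)// (lt_trans _ e1).
Qed.

(* If both [F] and [H] are at most 1, the total exponent [1/p + 1/r = 1 + sg]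
   beats 1; otherwise a factor below 1 is dropped. *)
Lemma young_phi F H : 0 <= F -> 0 <= H ->
  F `^ p^-1 * H `^ r^-1 <= phi p F + phi r H + phi p F * phi r H.
Proof.
move=> F0 H0.
have pi0 : 0 < p^-1 by rewrite invr_gt0 (lt_trans _ p1).
have ri0 : 0 < r^-1 by rewrite invr_gt0 (lt_trans _ r1).
have [a0 b0] : 0 <= phi p F /\ 0 <= phi r H by rewrite !phi_ge0.
have ab0 : 0 <= phi p F * phi r H by rewrite mulr_ge0.
have pow_le1 x y : 0 <= x -> x <= 1 -> 0 < y -> x `^ y <= 1.
  move=> x0 x1 y0; apply: le_trans (ge0_ler_powR (ltW y0) _ _ x1) _; rewrite ?nnegrE//.
  by rewrite powR1.
have [F1|F1] := leP F 1; have [H1|H1] := leP H 1.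
- have [FH|FH] := leP F H.
    apply: (@le_trans _ _ (phi r H)); last lra.
    rewrite phi_le1// -prs powRD; last by rewrite prs gt_eqF// ltr_wpDr// ltW.
    by rewrite ler_wpM2r ?powR_ge0// ge0_ler_powR ?nnegrE// ltW.
  apply: (@le_trans _ _ (phi p F)); last lra.
  rewrite phi_le1// -prs powRD; last by rewrite prs gt_eqF// ltr_wpDr// ltW.
  by rewrite ler_wpM2l ?powR_ge0// ge0_ler_powR ?nnegrE ?(ltW ri0)// ltW.
- apply: (@le_trans _ _ (phi r H)); last lra.
  by rewrite phi_ge1 ?(ltW H1)// ler_piMl ?powR_ge0 ?pow_le1.
- apply: (@le_trans _ _ (phi p F)); last lra.
  by rewrite phi_ge1 ?(ltW F1)// ler_piMr ?powR_ge0 ?pow_le1.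
- by rewrite -!phi_ge1 ?(ltW F1) ?(ltW H1)// lerDr addr_ge0.
Qed.

Variable k : R.
Hypothesis k0 : 0 < k.

Definition Cphi (e : R) : R := (k * sg)^-1 + (k * (1 - e^-1))^-1.

Lemma Cphi_ge0 e : 1 < e -> 0 <= Cphi e.
Proof.
move=> e1; have ei : e^-1 < 1 by rewrite invf_lt1// (lt_trans _ e1).
by rewrite addr_ge0// invr_ge0 mulr_ge0 ?(ltW k0) ?(ltW sg0)// subr_ge0 ltW.
Qed.

(** At [r0 = a ^ (- 1/k)], where a t^k = 1, the two regimes of [phi] meet; in the variable t/r0 the
    integrand is the one of [master] times [a]. Linearity in [a] is the point: with a = u(x)^e the
    integral over x is then the normalised one. *)
Lemma integral_phi e a : 1 < e -> 0 <= a ->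
  (\int[@lebesgue_measure R]_t (pw (-1) t * (pw (- k) t * phi e (a * t `^ k)))%:E
    <= (Cphi e * a)%:E)%E.
Proof.
move=> e1; have e0 : 0 < e by rewrite (lt_trans _ e1).
have ei : e^-1 < 1 by rewrite invf_lt1.
have sg1 : 0 < 1 + sg by rewrite addr_gt0.
rewrite le_eqVlt => /predU1P[<-|a0].
  rewrite mulr0 integral0_eq// => t _.
  by rewrite mul0r /phi !powR0 ?invr_eq0 ?gt_eqF// minxx !mulr0.
pose r0 := a `^ (- k^-1).
have r00 : 0 < r0 by exact: powR_gt0.
have ar : a = r0 `^ (- k) by rewrite -powRrM mulNr mulrN opprK mulVf ?gt_eqF// powRr1// ltW.
clearbody r0.
have c1 : 0 < k * sg by rewrite mulr_gt0.
have c2 : 0 < k * (1 - e^-1) by rewrite mulr_gt0// subr_gt0.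
apply: (@le_trans _ (\bar R) (\int[@lebesgue_measure R]_t (a * (pw (-1) t *
   Num.min ((t / r0) `^ (k * sg)) ((t / r0) `^ (- (k * (1 - e^-1))))))%:E)%E).
  apply: ge0_int_le => t; first by rewrite !mulr_ge0 ?pw_ge0 ?phi_ge0.
  rewrite [leRHS]mulrCA ler_wpM2l ?pw_ge0// /pw; case: ifPn => t0; last first.
    by rewrite mul0r mulr_ge0 ?(ltW a0)// le_min !powR_ge0.
  have tr : 0 < t / r0 by rewrite divr_gt0.
  have -> : a * t `^ k = (t / r0) `^ k by rewrite ar powR_div// mulrC.
  have -> : t `^ (- k) = a * (t / r0) `^ (- k).
    by rewrite ar powR_div// opprK mulrCA -powRDp// addNr powRr0 mulr1.
  rewrite /phi -!powRrM -[leLHS]mulrA ler_wpM2l ?(ltW a0)// minr_pMr ?powR_ge0//.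
  rewrite -!powRDp// le_eqVlt; apply/orP; left; apply/eqP.
  by congr (Num.min (_ `^ _) (_ `^ _)); ring.
rewrite ge0_intZ ?(ltW a0)//; last 2 first.
- by mfun.
- by move=> t; rewrite mulr_ge0 ?pw_ge0// le_min !powR_ge0.
rewrite [X in (_ <= X%:E)%E]mulrC EFinM lee_wpmul2l ?lee_fin ?(ltW a0)//.
exact: master.
Qed.

End exponents.

Section weight_swap.
Context {R : realType}.
Local Notation leb := (@lebesgue_measure R).
Variables (b1 b2 : R).

Definition Kmm (c : R) : R := (c - b1)^-1 + (b2 - c)^-1.

Lemma Kmm_ge0 c : b1 < c < b2 -> 0 <= Kmm c.
Proof. by move=> /andP[? ?]; rewrite addr_ge0// invr_ge0 subr_ge0 ltW. Qed.

(** Tonelli's theorem puts the [t]-integral inside, where it is the Mellin integral of [mm] and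
    contributes the power z^(-c). *)
Lemma weight_swap c e (f : R -> \bar R) : b1 < c < b2 ->
  measurable_fun setT f -> (forall t, 0 <= f t)%E ->
  (\int[leb]_t ((pw (c - 1) t)%:E *
      \int[leb]_z ((pw e z * mm b1 b2 (t * z))%:E * f z)) <=
   (Kmm c)%:E * \int[leb]_z ((pw (e - c) z)%:E * f z))%E.
Proof.
move=> cb mf f0.
have m2 : measurable_fun [set: R * R] (fun w : R * R =>
    ((pw (c - 1) w.1 * (pw e w.2 * mm b1 b2 (w.1 * w.2)))%:E * f w.2)%E).
  apply: emeasurable_funM; first by mfun.
  exact: (measurableT_comp mf measurable_snd).
have g0 t z : (0 <= (pw (c - 1) t * (pw e z * mm b1 b2 (t * z)))%:E * f z)%E.
  by rewrite mule_ge0// lee_fin !mulr_ge0 ?pw_ge0 ?mm_ge0.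
rewrite [leLHS](_ : _ = \int[leb]_t \int[leb]_z
    ((pw (c - 1) t * (pw e z * mm b1 b2 (t * z)))%:E * f z))%E; last first.
  apply: eq_integral => t _; rewrite -ge0_integralZl ?lee_fin ?pw_ge0//.
  - by apply: eq_integral => z _; rewrite muleA -EFinM.
  - by apply: emeasurable_funM => //; mfun.
  - by move=> z _; rewrite mule_ge0// lee_fin mulr_ge0 ?pw_ge0 ?mm_ge0.
rewrite (tonelli leb leb m2 g0) -ge0_integralZl//; last 3 first.
- by apply: emeasurable_funM => //; mfun.
- by move=> z _; rewrite mule_ge0// lee_fin pw_ge0.
- by rewrite lee_fin Kmm_ge0.
apply: ge0_le_lower_integral => z _; first by apply: integral_ge0.
have [z0|z0] := ltP 0 z; last first.
  rewrite integral0_eq; last by move=> t _; rewrite /pw (ltNge 0 z) z0 mul0r mulr0 mul0e.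
  by rewrite !mule_ge0 ?lee_fin ?pw_ge0 ?Kmm_ge0.
rewrite (_ : (fun t => _) = fun t => ((pw (c - 1) t * mm b1 b2 (z * t))%:E * ((pw e z)%:E * f z))%E); last first.
  by apply/funext => t; rewrite muleA -EFinM mulrCA mulrC [z * t]mulrC mulrC mulrCA mulrA.
rewrite ge0_integralZr//; last 3 first.
- by mfun.
- by move=> t _; rewrite lee_fin mulr_ge0 ?pw_ge0 ?mm_ge0.
- by rewrite mule_ge0// lee_fin pw_ge0.
rewrite !muleA; apply: lee_wpmul2r => //.
apply: (@le_trans _ (\bar R) ((Kmm c * z `^ (- c))%:E * (pw e z)%:E)%E).
  by apply: lee_wpmul2r; rewrite ?lee_fin ?pw_ge0//; exact: integral_pw_mm.
by rewrite -!EFinM lee_fin /pw z0 -mulrA -powRDp// addrC.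
Qed.

End weight_swap.

(** Here [x] and [z] are heat kernels and [A * c], [A * e] their suprema. In the term with [a] only
    [x] is replaced by its supremum, in the term with [b] only [z], so the kernel that is kept can
    still be integrated to 1. *)
Lemma split_algebra {R : realType} (A x z a b c e : R) :
  0 <= x -> 0 <= z -> 0 <= a -> 0 <= b -> x <= A * c -> z <= A * e ->
  x * z * (a + b + a * b) <=
  A * (c * a * z) + A * (x * (e * b)) + A * A * (c * a * (e * b)).
Proof.
move=> x0 z0 a0 b0 xc ze.
have H1 := ler_wpM2r (mulr_ge0 a0 z0) xc.
have H2 := ler_wpM2l x0 (ler_wpM2r b0 ze).
have H3 := ler_wpM2r (mulr_ge0 a0 b0) (ler_pM x0 z0 xc ze).
lra.
Qed.

Section splitting.
Context {R : realType} {n : nat}.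
Local Notation mu := (lebrV R n).
Implicit Types (P Q a b : 'rV[R]_n -> R).
Local Open Scope ereal_scope.

(** Each heat kernel is integrated in the variable that its companion does not contain, where it has
    mass 1. *)
Lemma convolution_split t (A : R) P Q b : (0 < t)%R -> (0 <= A)%R ->
  measurable_fun setT P -> measurable_fun setT Q -> measurable_fun setT b ->
  (forall x, 0 <= P x)%R -> (forall x, 0 <= Q x)%R -> (forall x, 0 <= b x)%R ->
  \int[mu]_x (b x)%:E <= 1 ->
  \int[mu]_x \int[mu]_y ((heat t (y - x) * P y + Q x * heat t (y - x)) + A * (b x * P y))%:E
  <= \int[mu]_x (P x)%:E + \int[mu]_x (Q x)%:E + A%:E * \int[mu]_x (P x)%:E.
Proof.
move=> t0 A0 mP mQ mb P0 Q0 b0 b1.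
rewrite int2D; [|by mfun|by mfun|by move=> x y; rewrite addr_ge0 ?mulr_ge0 ?heat_ge0|
  by move=> x y; rewrite !mulr_ge0].
rewrite int2D; [|by mfun|by mfun|by move=> x y; rewrite mulr_ge0 ?heat_ge0..].
apply: leeD; first apply: leeD.
- rewrite tonelli; [|by mfun|by move=> x y; rewrite lee_fin mulr_ge0 ?heat_ge0].
  apply: ge0_le_lower_integral => y _.
    by apply: integral_ge0 => x _; rewrite lee_fin mulr_ge0 ?heat_ge0.
  under eq_integral do rewrite mulrC heat_sym.
  rewrite ge0_intZ//; [|by mfun|by move=> x; exact: heat_ge0].
  by rewrite integral_heat// mule1.
- apply: ge0_le_lower_integral => x _.
    by apply: integral_ge0 => y _; rewrite lee_fin mulr_ge0 ?heat_ge0.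
  rewrite ge0_intZ//; [|by mfun|by move=> y; exact: heat_ge0].
  by rewrite integral_heat// mule1.
- rewrite int2Z//; [|by mfun|by move=> x y; rewrite mulr_ge0].
  rewrite int2_prod// lee_wpmul2l ?lee_fin//.
  rewrite -[leRHS]mul1e lee_wpmul2r//.
  by apply: integral_ge0 => x _; rewrite lee_fin.
Qed.

Lemma product_split (A : R) P Q a b : (0 <= A)%R ->
  measurable_fun setT P -> measurable_fun setT Q ->
  measurable_fun setT a -> measurable_fun setT b ->
  (forall x, 0 <= P x)%R -> (forall x, 0 <= Q x)%R ->
  (forall x, 0 <= a x)%R -> (forall x, 0 <= b x)%R ->
  \int[mu]_x (a x)%:E = 1 -> \int[mu]_x (b x)%:E = 1 ->
  \int[mu]_x \int[mu]_y ((A * (P x * b y) + A * (a x * Q y)) + A * A * (P x * Q y))%:E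
  <= A%:E * \int[mu]_x (P x)%:E + A%:E * \int[mu]_x (Q x)%:E +
    A%:E * A%:E * (\int[mu]_x (P x)%:E * \int[mu]_x (Q x)%:E).
Proof.
move=> A0 mP mQ ma mb P0 Q0 a0 b0 a1 b1.
by rewrite int2_three// a1 b1 mule1 mul1e.
Qed.

End splitting.

Section bilinear_bounds.
Context {R : realType} {n : nat}.
Local Notation mu := (lebrV R n).
Local Notation leb := (@lebesgue_measure R).
Variables (p r sg : R) (v w : 'rV[R]_n -> R).
Hypothesis n0 : (0 < n)%N.
Hypothesis p1 : 1 < p.
Hypothesis r1 : 1 < r.
Hypothesis sg0 : 0 < sg.
Hypothesis prs : p^-1 + r^-1 = 1 + sg.
Hypothesis mv : measurable_fun setT v.
Hypothesis mw : measurable_fun setT w.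
Hypothesis v0 : forall x, 0 <= v x.
Hypothesis w0 : forall x, 0 <= w x.
Hypothesis v1 : (\int[mu]_x (v x `^ p)%:E <= 1)%E.
Hypothesis w1 : (\int[mu]_x (w x `^ r)%:E <= 1)%E.

Local Notation k := (n%:R / 2 : R).

Let k0 : 0 < k. Proof. by rewrite divr_gt0// ltr0n. Qed.

(** The factor t^(-k) undoes the t^k inside [phi], so the result is at most u^e, and smaller by a
    power when u^e t^k is far from 1. *)
Definition Vfun e (u : 'rV[R]_n -> R) t (x : 'rV[R]_n) : R :=
  pw (- k) t * phi sg e (u x `^ e * t `^ k).

Definition Vint e u t : R := fine (\int[mu]_x (Vfun e u t x)%:E).

Lemma Vfun_ge0 e u t x : 0 <= Vfun e u t x.
Proof. by rewrite mulr_ge0 ?pw_ge0 ?phi_ge0. Qed.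

Lemma VfunE e u t x : 0 < t -> Vfun e u t x = t `^ (- k) * phi sg e (u x `^ e * t `^ k).
Proof. by move=> t0; rewrite /Vfun /pw t0. Qed.

Section one_function.
Variables (e : R) (u : 'rV[R]_n -> R).
Hypothesis e1 : 1 < e.
Hypothesis mu_ : measurable_fun setT u.
Hypothesis u0 : forall x, 0 <= u x.
Hypothesis u1 : (\int[mu]_x (u x `^ e)%:E <= 1)%E.

Lemma measurable_Vfun2 :
  measurable_fun [set: R * 'rV[R]_n] (fun z => Vfun e u z.1 z.2).
Proof.
rewrite /Vfun; apply: measurable_funM; first by mfun.
apply: measurable_phi; mfun.
Qed.

Lemma measurable_Vfun t : measurable_fun setT (Vfun e u t).
Proof. exact: (measurableT_comp measurable_Vfun2 (measurable_pair1 t)). Qed.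

Lemma Vfun_le t x : Vfun e u t x <= u x `^ e.
Proof.
rewrite /Vfun /pw; case: ifPn => t0; last by rewrite mul0r powR_ge0.
apply: le_trans (_ : t `^ (- k) * (u x `^ e * t `^ k) <= _).
  by rewrite ler_wpM2l ?powR_ge0// phi_le_id// mulr_ge0 ?powR_ge0.
by rewrite mulrCA -powRDp// addNr powRr0 mulr1.
Qed.

Lemma VintE t : ((Vint e u t)%:E = \int[mu]_x (Vfun e u t x)%:E)%E.
Proof.
rewrite fineK// ge0_fin_numE.
  apply: le_lt_trans (_ : 1 < +oo)%E; last by rewrite ltry.
  by apply: le_trans u1; apply: ge0_int_le => x; [exact: Vfun_ge0|exact: Vfun_le].
by apply: integral_ge0 => x _; rewrite lee_fin Vfun_ge0.
Qed.

Lemma Vint_ge0 t : 0 <= Vint e u t.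
Proof. by apply: fine_ge0; apply: integral_ge0 => x _; rewrite lee_fin Vfun_ge0. Qed.

Lemma measurable_Vint : measurable_fun setT (Vint e u).
Proof.
apply: (measurableT_comp (@fine_measurable R setT measurableT)).
apply: measurable_integral1; first by apply/measurable_EFinP; exact: measurable_Vfun2.
by move=> t x; rewrite lee_fin Vfun_ge0.
Qed.

(** Each [Vint e u t] is at most 1; integrability against dt/t over all scales is due to the powers
    that [phi] gains at both ends. *)
Lemma integral_Vint : (\int[leb]_t (pw (-1) t * Vint e u t)%:E <= (Cphi sg k e)%:E)%E.
Proof.
apply: (@le_trans _ (\bar R) (\int[leb]_t \int[mu]_x (pw (-1) t * Vfun e u t x)%:E)%E).
  apply: ge0_le_lower_integral => t _; first by rewrite lee_fin mulr_ge0 ?pw_ge0 ?Vint_ge0.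
  have mVt := measurable_Vfun t.
  rewrite EFinM VintE -ge0_intZ ?pw_ge0 ?lexx// => x; exact: Vfun_ge0.
rewrite tonelli; last 2 first.
- apply/measurable_EFinP; apply: measurable_funM; first by mfun.
  exact: measurable_Vfun2.
- by move=> t x; rewrite lee_fin mulr_ge0 ?pw_ge0 ?Vfun_ge0.
apply: (@le_trans _ (\bar R) (\int[mu]_x (Cphi sg k e * u x `^ e)%:E)%E).
  apply: ge0_le_lower_integral => x _.
    by apply: integral_ge0 => t _; rewrite lee_fin mulr_ge0 ?pw_ge0 ?Vfun_ge0.
  by apply: integral_phi => //; exact: powR_ge0.
rewrite ge0_intZ//; [|by mfun|by move=> x; exact: powR_ge0|exact: Cphi_ge0].
by rewrite -[leRHS]mule1 lee_wpmul2l// lee_fin Cphi_ge0.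
Qed.

End one_function.

Local Notation V := (Vint p v).
Local Notation W := (Vint r w).
Local Notation A := ((4 * pi) `^ (- k) : R).

Lemma heat_ubA t (x : 'rV[R]_n) : 0 < t -> heat t x <= A * pw (- k) t.
Proof.
move=> t0; apply: le_trans (heat_ub _ t0) _; rewrite /pw t0 powRM ?(ltW t0)//.
by rewrite mulr_ge0// pi_ge0.
Qed.

(** [young_phi] at v(x)^p t^k and w(y)^r z^k. Two times are allowed because the rank-one part pairs
    [v] and [w] with the kernel independently. *)
Lemma pointwise_phi t z x y : 0 < t -> 0 < z ->
  t `^ (k / p) * z `^ (k / r) * (v x * w y) <=
   phi sg p (v x `^ p * t `^ k) + phi sg r (w y `^ r * z `^ k) +
   phi sg p (v x `^ p * t `^ k) * phi sg r (w y `^ r * z `^ k).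
Proof.
move=> t0 z0.
have P := @young_phi _ p r sg p1 r1 sg0 prs (v x `^ p * t `^ k) (w y `^ r * z `^ k)
  (mulr_ge0 (powR_ge0 _ _) (powR_ge0 _ _)) (mulr_ge0 (powR_ge0 _ _) (powR_ge0 _ _)).
apply: le_trans P.
rewrite !powRM ?powR_ge0// -!powRrM !mulfV ?gt_eqF ?(lt_trans _ p1) ?(lt_trans _ r1)//.
by rewrite !powRr1// le_eqVlt; apply/orP; left; apply/eqP; ring.
Qed.

Definition Nint t : \bar R := (\int[mu]_x \int[mu]_y (heat t (y - x) * v y * w x)%:E)%E.

(** The heat flow of [u] at the origin, where the point interaction sits. *)
Definition hint (u : 'rV[R]_n -> R) t : \bar R := (\int[mu]_x (heat t x * u x)%:E)%E.

Lemma Nint_ge0 t : (0 <= Nint t)%E.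
Proof.
by apply: integral_ge0 => x _; apply: integral_ge0 => y _; rewrite lee_fin !mulr_ge0 ?heat_ge0.
Qed.

Lemma measurable_Nint : measurable_fun setT Nint.
Proof.
apply: measurable_integral1; last first.
  by move=> t x; apply: integral_ge0 => y _; rewrite lee_fin !mulr_ge0 ?heat_ge0.
apply: (@measurable_integral1 _ _ (R * 'rV[R]_n)%type _ R mu (fun z y => (heat z.1 (y - z.2) * v y * w z.2)%:E)).
  by mfun.
by move=> z y; rewrite lee_fin !mulr_ge0 ?heat_ge0.
Qed.

Lemma hint_ge0 (u : 'rV[R]_n -> R) t : (forall x, 0 <= u x) -> (0 <= hint u t)%E.
Proof. by move=> u0; apply: integral_ge0 => x _; rewrite lee_fin mulr_ge0 ?heat_ge0. Qed.

Lemma measurable_hint (u : 'rV[R]_n -> R) : measurable_fun setT u -> (forall x, 0 <= u x) ->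
  measurable_fun setT (hint u).
Proof.
move=> measu u0; apply: measurable_integral1; last first.
  by move=> t x; rewrite lee_fin mulr_ge0 ?heat_ge0.
apply/measurable_EFinP; apply: measurable_funM; last by mfun.
apply: measurable_heat; first by mfun.
by move=> i; exact: (measurableT_comp (measurable_rV_coord i) measurable_snd).
Qed.

Let mVf2 t : measurable_fun setT (Vfun p v t). Proof. exact: measurable_Vfun. Qed.
Let mWf2 t : measurable_fun setT (Vfun r w t). Proof. exact: measurable_Vfun. Qed.
Let A0 : 0 <= A. Proof. exact: powR_ge0. Qed.

Lemma Nint_ub t : ((pw (k * sg) t)%:E * Nint t <= (V t + W t + A * V t)%:E)%E.
Proof.
have [t0|t0] := ltP 0 t; last first.
  rewrite /pw ltNge t0/= mul0e lee_fin !addr_ge0 ?mulr_ge0 ?Vint_ge0//.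
pose P := Vfun p v t; pose Q := Vfun r w t.
have P0 x : 0 <= P x by exact: Vfun_ge0.
have Q0 x : 0 <= Q x by exact: Vfun_ge0.
have mP : measurable_fun setT P by exact: mVf2.
have mQ : measurable_fun setT Q by exact: mWf2.
rewrite /Nint -int2Z ?pw_ge0//; last 2 first.
- by mfun.
- by move=> x y; rewrite !mulr_ge0 ?heat_ge0.
apply: (@le_trans _ (\bar R) (\int[mu]_x \int[mu]_y
   ((heat t (y - x) * P y + Q x * heat t (y - x)) + A * (w x `^ r * P y))%:E)%E).
  apply: int2_le => x y; first by rewrite !mulr_ge0 ?pw_ge0 ?heat_ge0.
  have H := pointwise_phi y x t0 t0.
  have Pa : P y = t `^ (- k) * phi sg p (v y `^ p * t `^ k).
    exact: VfunE.
  have Qb : Q x = t `^ (- k) * phi sg r (w x `^ r * t `^ k).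
    exact: VfunE.
  have a0 := phi_ge0 sg p (v y `^ p * t `^ k).
  (* In the product term [phi] of [w] is replaced by its argument: t^k cancels the supremum t^(-k)
     of the kernel and w^r has mass at most 1, so this term too is a multiple of [V t]. *)
  have b0 : phi sg r (w x `^ r * t `^ k) <= w x `^ r * t `^ k.
    by apply: phi_le_id => //; rewrite mulr_ge0 ?powR_ge0.
  move: (phi sg p _) (phi sg r _) H Pa Qb a0 b0 => a b H Pa Qb a0 b0.
  have tk : 0 <= t `^ (- k) by exact: powR_ge0.
  have hh := heat_ge0 t (y - x).
  have hA : heat t (y - x) <= A * t `^ (- k) by have := heat_ubA (y - x) t0; rewrite /pw t0.
  apply: (@le_trans _ _ (heat t (y - x) * (t `^ (- k) * (a + b + a * b)))).
    rewrite [leLHS](_ : _ = heat t (y - x) * (pw (k * sg) t * (v y * w x))); last by ring.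
    rewrite /pw t0 ler_wpM2l//.
    apply: le_trans (_ : t `^ (- k) * (t `^ (k / p) * t `^ (k / r) * (v y * w x)) <= _); last first.
      by rewrite ler_wpM2l.
    (* The excess [sg] of the exponents over 1 determines the power of [t]. *)
    have E : - k + (k / p + k / r) = k * sg by rewrite -mulrDr prs; ring.
    by rewrite -E !powRDp// -[leLHS]mulrA.
  rewrite Pa Qb.
  have -> : heat t (y - x) * (t `^ (- k) * (a + b + a * b)) =
     heat t (y - x) * (t `^ (- k) * a) + t `^ (- k) * b * heat t (y - x) + heat t (y - x) * t `^ (- k) * a * b.
    by ring.
  rewrite lerD2l.
  apply: le_trans (_ : heat t (y - x) * t `^ (- k) * a * (w x `^ r * t `^ k) <= _).
    by rewrite ler_wpM2l// !mulr_ge0.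
  apply: le_trans (_ : A * t `^ (- k) * t `^ (- k) * a * (w x `^ r * t `^ k) <= _).
    by rewrite !ler_wpM2r// ?mulr_ge0 ?powR_ge0.
  rewrite (_ : _ * _ = A * (w x `^ r * (t `^ (- k) * a)) * (t `^ (- k) * t `^ k)); last by ring.
  by rewrite -powRDp// addNr powRr0 mulr1.
apply: le_trans (convolution_split t0 A0 mP mQ _ P0 Q0 _ w1) _.
- by mfun.
- by move=> x; exact: powR_ge0.
have EP : (\int[mu]_x (P x)%:E = (V t)%:E)%E by rewrite (VintE p1 v1).
have EQ : (\int[mu]_x (Q x)%:E = (W t)%:E)%E by rewrite (VintE r1 w1).
clearbody P Q; move: (V t) (W t) EP EQ => V' W' -> ->.
by rewrite !EFinD EFinM lexx.
Qed.

Lemma hint_ub t z : ((pw (k / p) t * pw (k / r) z)%:E * (hint v t * hint w z) <=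
  (A * V t + A * W z + A * A * (V t * W z))%:E)%E.
Proof.
have RHS0 : 0 <= A * V t + A * W z + A * A * (V t * W z).
  by rewrite !addr_ge0 ?mulr_ge0 ?Vint_ge0.
have [t0|t0] := ltP 0 t; last by rewrite /pw (ltNge 0 t) t0/= mul0r mul0e lee_fin.
have [z0|z0] := ltP 0 z; last by rewrite /pw (ltNge 0 z) z0/= mulr0 mul0e lee_fin.
pose P := Vfun p v t; pose Q := Vfun r w z.
have P0 x : 0 <= P x by exact: Vfun_ge0.
have Q0 x : 0 <= Q x by exact: Vfun_ge0.
have mP : measurable_fun setT P by exact: mVf2.
have mQ : measurable_fun setT Q by exact: mWf2.
have mht (t' : R) : measurable_fun setT (fun x : 'rV[R]_n => heat t' x).
  by apply: measurable_heat => // i; exact: measurable_rV_coord.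
have mhtt := mht t; have mhtz := mht z.
have H1 (t' : R) : 0 < t' -> (\int[mu]_x (heat t' x)%:E = 1)%E.
  move=> t'0; rewrite -(integral_heat (0 : 'rV[R]_n) t'0).
  by apply: eq_integral => x _; rewrite subr0.
rewrite /hint -int2_prod; [|by mfun|by mfun|by move=> x; rewrite mulr_ge0 ?heat_ge0..].
rewrite -int2Z ?mulr_ge0 ?pw_ge0//; [|by mfun|by move=> x y; rewrite !mulr_ge0 ?heat_ge0].
apply: (@le_trans _ (\bar R) (\int[mu]_x \int[mu]_y
   ((A * (P x * heat z y) + A * (heat t x * Q y)) + A * A * (P x * Q y))%:E)%E).
  apply: int2_le => x y; first by rewrite !mulr_ge0 ?pw_ge0 ?heat_ge0.
  have H := pointwise_phi x y t0 z0.
  have Pa : P x = t `^ (- k) * phi sg p (v x `^ p * t `^ k) by exact: VfunE.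
  have Qb : Q y = z `^ (- k) * phi sg r (w y `^ r * z `^ k) by exact: VfunE.
  have a0 := phi_ge0 sg p (v x `^ p * t `^ k).
  have b0 := phi_ge0 sg r (w y `^ r * z `^ k).
  move: (phi sg p _) (phi sg r _) H Pa Qb a0 b0 => a b H Pa Qb a0 b0.
  have := heat_ubA x t0; have := heat_ubA y z0; rewrite {1 2}/pw t0 z0 => hz ht.
  have ht0 := heat_ge0 t x; have hz0 := heat_ge0 z y.
  apply: (@le_trans _ _ (heat t x * heat z y * (a + b + a * b))).
    rewrite [leLHS](_ : _ = heat t x * heat z y * (pw (k / p) t * pw (k / r) z * (v x * w y))); last by ring.
    by rewrite ler_wpM2l ?mulr_ge0// /pw t0 z0.
  by rewrite Pa Qb; exact: split_algebra.
apply: le_trans (product_split A0 mP mQ mhtt mhtz P0 Q0 _ _ (H1 _ t0) (H1 _ z0)) _.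
- by move=> x; exact: heat_ge0.
- by move=> x; exact: heat_ge0.
have EP : (\int[mu]_x (P x)%:E = (V t)%:E)%E by rewrite (VintE p1 v1).
have EQ : (\int[mu]_x (Q x)%:E = (W z)%:E)%E by rewrite (VintE r1 w1).
clearbody P Q; move: (V t) (W z) EP EQ => V' W' -> ->.
by rewrite !EFinD !EFinM lexx.
Qed.

End bilinear_bounds.

Lemma pwD {R : realType} (a b t : R) : pw (a + b) t = pw a t * pw b t.
Proof. by rewrite /pw; case: ifPn => t0; rewrite ?powRDp// mul0r. Qed.

Section product_totals.
Context {R : realType}.
Local Notation leb := (@lebesgue_measure R).
Variables (A al be b1 b2 Cp Cr : R) (V W : R -> R) (hv hw : R -> \bar R).
Hypothesis A0 : 0 <= A.
Hypothesis V0 : forall t, 0 <= V t.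
Hypothesis W0 : forall t, 0 <= W t.
Hypothesis mV : measurable_fun setT V.
Hypothesis mW : measurable_fun setT W.
Hypothesis CV : (\int[leb]_t (pw (-1) t * V t)%:E <= Cp%:E)%E.
Hypothesis CW : (\int[leb]_t (pw (-1) t * W t)%:E <= Cr%:E)%E.
Hypothesis Cp0 : 0 <= Cp.
Hypothesis Cr0 : 0 <= Cr.
Hypothesis mhv : measurable_fun setT hv.
Hypothesis mhw : measurable_fun setT hw.
Hypothesis hv0 : forall t, (0 <= hv t)%E.
Hypothesis hw0 : forall t, (0 <= hw t)%E.
Hypothesis HV : forall t z, ((pw (1 - al) t * pw (1 - be) z)%:E * (hv t * hw z) <=
  (A * V t + A * W z + A * A * (V t * W z))%:E)%E.

Lemma mm_powR_le1 (u : R) : 0 < u -> b1 <= be <= b2 -> mm b1 b2 u * u `^ be <= 1.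
Proof.
move=> u0 /andP[h1 h2]; have [u1|u1] := leP u 1.
  apply: (@le_trans _ _ (u `^ (- b1) * u `^ be)).
    by rewrite ler_wpM2r ?powR_ge0// /mm ge_min lexx.
  rewrite -powRDp// -[leRHS](powRr0 u); apply: ger_powR; first by rewrite u0.
  by rewrite addrC subr_ge0.
apply: (@le_trans _ _ (u `^ (- b2) * u `^ be)).
  by rewrite ler_wpM2r ?powR_ge0// /mm ge_min lexx orbT.
rewrite -powRDp// -[leRHS](powRr0 u); apply: ler_powR; first exact: ltW.
by rewrite addrC subr_le0.
Qed.

Let P t := (\int[leb]_z (pw (al - 1) z * mm b1 b2 (t * z) * V z)%:E)%E.
Let Q t := (\int[leb]_z (pw (be - 1) z * mm b1 b2 (t * z) * W z)%:E)%E.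

Let P0 t : (0 <= P t)%E.
Proof. by apply: integral_ge0 => z _; rewrite lee_fin !mulr_ge0 ?pw_ge0 ?mm_ge0. Qed.

Let Q0 t : (0 <= Q t)%E.
Proof. by apply: integral_ge0 => z _; rewrite lee_fin !mulr_ge0 ?pw_ge0 ?mm_ge0. Qed.

Let mP : measurable_fun setT P.
Proof.
apply: measurable_integral1; first by mfun.
by move=> t z; rewrite lee_fin !mulr_ge0 ?pw_ge0 ?mm_ge0.
Qed.

Let mQ : measurable_fun setT Q.
Proof.
apply: measurable_integral1; first by mfun.
by move=> t z; rewrite lee_fin !mulr_ge0 ?pw_ge0 ?mm_ge0.
Qed.

(** The two contributions multiplying [P t]: the term with [V] alone, and the cross term after [Q t]
    has been bounded by [Cr * t ^ (- be)]. *)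
Definition Dtotal : R := A * Kmm b1 b2 be + A * A * Cr.

Lemma product_ub t : 0 < t -> b1 < al < b2 -> b1 < be < b2 ->
  ((\int[leb]_z ((pw 0 z * mm b1 b2 (t * z))%:E * hv z)) *
   (\int[leb]_z ((pw 0 z * mm b1 b2 (t * z))%:E * hw z)) <=
   (Dtotal * t `^ (- be))%:E * P t + (A * Kmm b1 b2 al * t `^ (- al))%:E * Q t)%E.
Proof.
move=> t0 hal hbe.
have mwt : measurable_fun [set: R] (fun z => (pw 0 z * mm b1 b2 (t * z))%:E) by mfun.
have wt0 z : (0 <= (pw 0 z * mm b1 b2 (t * z))%:E)%E by rewrite lee_fin mulr_ge0 ?pw_ge0 ?mm_ge0.
rewrite int2_prode; last 4 first.
- exact: emeasurable_funM.
- exact: emeasurable_funM.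
- by move=> z; rewrite mule_ge0.
- by move=> z; rewrite mule_ge0.
pose a z := pw (al - 1) z * mm b1 b2 (t * z).
pose b z := pw (be - 1) z * mm b1 b2 (t * z).
have a0 z : 0 <= a z by rewrite mulr_ge0 ?pw_ge0 ?mm_ge0.
have b0 z : 0 <= b z by rewrite mulr_ge0 ?pw_ge0 ?mm_ge0.
have ma : measurable_fun setT a by rewrite /a; mfun.
have mb : measurable_fun setT b by rewrite /b; mfun.
have aV0 z : 0 <= a z * V z by rewrite mulr_ge0.
have bW0 z : 0 <= b z * W z by rewrite mulr_ge0.
have maV : measurable_fun setT (fun z => a z * V z) by mfun.
have mbW : measurable_fun setT (fun z => b z * W z) by mfun.
apply: (@le_trans _ (\bar R) (\int[leb]_z \int[leb]_y
  ((A * (a z * V z * b y) + A * (a z * (b y * W y))) + A * A * (a z * V z * (b y * W y)))%:E)%E).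
  apply: ge0_le_lower_integral => z _.
    by apply: integral_ge0 => y _; rewrite !mule_ge0.
  apply: ge0_le_lower_integral => y _; first by rewrite !mule_ge0.
  (* The weight 1 is split into z^(al-1) z^(1-al), and likewise with [be]: the second factors feed
     [HV], the first have finite Mellin integrals against [mm]. *)
  have E (e x : R) : pw 0 x = pw (e - 1) x * pw (1 - e) x by rewrite -pwD addrA subrK subrr.
  rewrite muleACA -EFinM (E al z) (E be y).
  rewrite (_ : _ * _ * _ * (_ * _ * _) = a z * b y * (pw (1 - al) z * pw (1 - be) y)); last first.
    by rewrite /a /b; ring.
  rewrite EFinM -muleA.
  apply: (@le_trans _ (\bar R) ((a z * b y)%:E * (A * V z + A * W y + A * A * (V z * W y))%:E)%E).
    have ab0 : (0 <= (a z * b y)%:E)%E by rewrite lee_fin mulr_ge0.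
    exact: (lee_wpmul2l ab0 (HV z y)).
  rewrite -EFinM lee_fin le_eqVlt; apply/orP; left; apply/eqP.
  move: (a z) (b y) (V z) (W y) A => a' b' V' W' A'; ring.
rewrite int2_three//.
have Ia : (\int[leb]_z (a z)%:E <= (Kmm b1 b2 al * t `^ (- al))%:E)%E.
  exact: integral_pw_mm.
have Ib : (\int[leb]_z (b z)%:E <= (Kmm b1 b2 be * t `^ (- be))%:E)%E.
  exact: integral_pw_mm.
(* The cross term contains [P t * Q t]. Only [P t] is kept for the integration in [t]; in [Q t] the
   bound mm(tz) (tz)^be <= 1 leaves t^(-be) and the integral of [W] against dz/z. *)
have Qt : (Q t <= (Cr * t `^ (- be))%:E)%E.
  apply: (@le_trans _ (\bar R) (\int[leb]_z (t `^ (- be) * (pw (-1) z * W z))%:E)%E).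
    apply: ge0_int_le => z; first by rewrite !mulr_ge0 ?pw_ge0 ?mm_ge0.
    rewrite mulrA; apply: ler_wpM2r => //; rewrite /pw; case: ifPn => z0; last by rewrite mul0r mulr0.
    have tz : 0 < t * z by rewrite mulr_gt0.
    have hb : b1 <= be <= b2 by case/andP: hbe => ? ?; rewrite !ltW.
    have H := ler_wpM2r (mulr_ge0 (powR_ge0 t (- be)) (powR_ge0 z (-1))) (mm_powR_le1 tz hb).
    rewrite mul1r in H; apply: le_trans H.
    rewrite (powRM _ (ltW t0) (ltW z0)).
    rewrite powRDp// le_eqVlt; apply/orP; left; apply/eqP.
    rewrite (_ : mm _ _ _ * _ * _ = (t `^ be * t `^ (- be)) * (z `^ be * z `^ (-1) * mm b1 b2 (t * z))); last by ring.
    by rewrite -(powRDp be (- be) t0) subrr powRr0 mul1r.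
  rewrite ge0_intZ ?powR_ge0//; [|by mfun|by move=> z; rewrite mulr_ge0 ?pw_ge0].
  by rewrite mulrC EFinM; apply: lee_wpmul2l; rewrite ?lee_fin ?powR_ge0.
rewrite -/(P t) -/(Q t).
have Ae : (0 <= A%:E)%E by rewrite lee_fin.
apply: (@le_trans _ (\bar R) (A%:E * (P t * (Kmm b1 b2 be * t `^ (- be))%:E) +
  A%:E * ((Kmm b1 b2 al * t `^ (- al))%:E * Q t) +
  A%:E * A%:E * (P t * (Cr * t `^ (- be))%:E))%E).
  apply: leeD; first apply: leeD.
  - by apply: lee_wpmul2l => //; apply: lee_wpmul2l.
  - by apply: lee_wpmul2l => //; apply: lee_wpmul2r.
  - by apply: lee_wpmul2l; [exact: mule_ge0|apply: lee_wpmul2l].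
have K0 : 0 <= Kmm b1 b2 be by exact: Kmm_ge0.
have DE : Dtotal * t `^ (- be) = A * (Kmm b1 b2 be * t `^ (- be)) + A * A * (Cr * t `^ (- be)).
  rewrite /Dtotal; ring.
rewrite DE EFinD; have x0 : 0 <= Kmm b1 b2 be * t `^ (- be) by rewrite mulr_ge0 ?powR_ge0.
have y0 : 0 <= Cr * t `^ (- be) by rewrite mulr_ge0 ?powR_ge0.
rewrite -[A * _ * t `^ _]mulrA; move: (P t) (Q t) (Kmm b1 b2 al * t `^ (- al)) x0 y0 => X Y c.
move: (Kmm b1 b2 be * _) (Cr * _) => x y x0 y0.
rewrite ge0_muleDl ?lee_fin ?mulr_ge0// addeAC [(X * x%:E)%E]muleC [(X * y%:E)%E]muleC.
by rewrite !EFinM !muleA.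
Qed.

(** The weight t^(al+be-1) meets t^(-be) at [P] and t^(-al) at [Q]. What is left, t^(al-1) and
    t^(be-1), is exactly what [weight_swap] converts into integrals of [V] and [W] against dz/z. *)
Lemma product_total : b1 < al < b2 -> b1 < be < b2 ->
  (\int[leb]_t ((pw (al + be - 1) t)%:E *
     ((\int[leb]_z ((pw 0 z * mm b1 b2 (t * z))%:E * hv z)) *
      (\int[leb]_z ((pw 0 z * mm b1 b2 (t * z))%:E * hw z)))) <=
   (Dtotal * (Kmm b1 b2 al * Cp) + A * Kmm b1 b2 al * (Kmm b1 b2 be * Cr))%:E)%E.
Proof.
move=> hal hbe.
have Ka : 0 <= Kmm b1 b2 al by exact: Kmm_ge0.
have Kb : 0 <= Kmm b1 b2 be by exact: Kmm_ge0.
have D0 : 0 <= Dtotal by rewrite addr_ge0 ?mulr_ge0.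
apply: (@le_trans _ (\bar R) (\int[leb]_t (Dtotal%:E * ((pw (al - 1) t)%:E * P t) +
    (A * Kmm b1 b2 al)%:E * ((pw (be - 1) t)%:E * Q t)))%E).
  apply: ge0_le_lower_integral => t _.
    apply: mule_ge0; first by rewrite lee_fin pw_ge0.
    by apply: mule_ge0; apply: integral_ge0 => z _; rewrite mule_ge0 ?hv0 ?hw0// lee_fin mulr_ge0 ?pw_ge0 ?mm_ge0.
  have [t0|t0] := ltP 0 t; last first.
    by rewrite {1}/pw ltNge t0/= mul0e adde_ge0 ?mule_ge0 ?lee_fin ?mulr_ge0 ?pw_ge0.
  apply: le_trans (lee_wpmul2l _ (product_ub t0 hal hbe)) _; first by rewrite lee_fin pw_ge0.
  rewrite ge0_muleDr; last 2 first.
  - by rewrite mule_ge0// lee_fin mulr_ge0 ?powR_ge0.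
  - by rewrite mule_ge0// lee_fin !mulr_ge0 ?powR_ge0.
  have E1 : pw (al + be - 1) t * (Dtotal * t `^ (- be)) = Dtotal * pw (al - 1) t.
    rewrite /pw t0 mulrCA -powRDp//; congr (_ * _ `^ _); ring.
  have E2 : pw (al + be - 1) t * (A * Kmm b1 b2 al * t `^ (- al)) = A * Kmm b1 b2 al * pw (be - 1) t.
    rewrite /pw t0 mulrCA -powRDp//; congr (_ * _ `^ _); ring.
  by rewrite !muleA -!EFinM E1 E2 lexx.
have pP0 t : (0 <= (pw (al - 1) t)%:E * P t)%E by rewrite mule_ge0 ?lee_fin ?pw_ge0.
have pQ0 t : (0 <= (pw (be - 1) t)%:E * Q t)%E by rewrite mule_ge0 ?lee_fin ?pw_ge0.
have mpP : measurable_fun setT (fun t => (pw (al - 1) t)%:E * P t)%E.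
  by apply: emeasurable_funM => //; mfun.
have mpQ : measurable_fun setT (fun t => (pw (be - 1) t)%:E * Q t)%E.
  by apply: emeasurable_funM => //; mfun.
rewrite ge0_integralD//; last 4 first.
- by move=> t _; rewrite mule_ge0 ?lee_fin.
- exact: measurable_funeM.
- by move=> t _; rewrite mule_ge0 ?lee_fin ?mulr_ge0.
- exact: measurable_funeM.
rewrite !ge0_integralZl ?lee_fin ?mulr_ge0//.
apply: (@le_trans _ (\bar R) (Dtotal%:E * (Kmm b1 b2 al * Cp)%:E +
    (A * Kmm b1 b2 al)%:E * (Kmm b1 b2 be * Cr)%:E)%E); last by rewrite -!EFinM -EFinD lexx.
have mVe : measurable_fun setT (fun t => (V t)%:E) by exact/measurable_EFinP.
have mWe : measurable_fun setT (fun t => (W t)%:E) by exact/measurable_EFinP.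
have V0e t : (0 <= (V t)%:E)%E by rewrite lee_fin.
have W0e t : (0 <= (W t)%:E)%E by rewrite lee_fin.
apply: leeD; apply: lee_wpmul2l; rewrite ?lee_fin ?mulr_ge0//.
  have := @weight_swap R b1 b2 al (al - 1) _ hal mVe V0e.
  rewrite (_ : al - 1 - al = -1); last by ring.
  move=> H; apply: le_trans (le_trans _ H) _.
    by rewrite le_eqVlt; apply/orP; left; apply/eqP; apply: eq_integral => t _;
      congr (_ * _)%E; apply: eq_integral => z _; rewrite -EFinM.
  rewrite EFinM; apply: lee_wpmul2l; first by rewrite lee_fin.
  by under eq_integral do rewrite -EFinM.
have := @weight_swap R b1 b2 be (be - 1) _ hbe mWe W0e.
rewrite (_ : be - 1 - be = -1); last by ring.
move=> H; apply: le_trans (le_trans _ H) _.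
  by rewrite le_eqVlt; apply/orP; left; apply/eqP; apply: eq_integral => t _;
    congr (_ * _)%E; apply: eq_integral => z _; rewrite -EFinM.
rewrite EFinM; apply: lee_wpmul2l; first by rewrite lee_fin.
by under eq_integral do rewrite -EFinM.
Qed.

End product_totals.

Lemma integral_three_le {R : realType} (f g : R -> R) (A c1 c2 : R) :
  measurable_fun setT f -> measurable_fun setT g ->
  (forall t, 0 <= f t) -> (forall t, 0 <= g t) -> 0 <= A ->
  (\int[@lebesgue_measure R]_t (f t)%:E <= c1%:E)%E ->
  (\int[@lebesgue_measure R]_t (g t)%:E <= c2%:E)%E ->
  (\int[@lebesgue_measure R]_t (f t + g t + A * f t)%:E <= (c1 + c2 + A * c1)%:E)%E.
Proof.
move=> mf mg f0 g0 A0 F G.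
rewrite ge0_intD; [|by mfun|by mfun|by move=> t; rewrite addr_ge0|by move=> t; rewrite mulr_ge0].
rewrite ge0_intD// ge0_intZ//.
rewrite !EFinD EFinM; apply: leeD; first exact: leeD.
by apply: lee_wpmul2l; rewrite ?lee_fin.
Qed.

Section bilinear_totals.
Context {R : realType} {n : nat}.
Local Notation mu := (lebrV R n).
Local Notation leb := (@lebesgue_measure R).
Variables (p r sg b1 b2 : R) (v w : 'rV[R]_n -> R).
Hypothesis n0 : (0 < n)%N.
Hypothesis p1 : 1 < p.
Hypothesis r1 : 1 < r.
Hypothesis sg0 : 0 < sg.
Hypothesis prs : p^-1 + r^-1 = 1 + sg.
Hypothesis mv : measurable_fun setT v.
Hypothesis mw : measurable_fun setT w.
Hypothesis v0 : forall x, 0 <= v x.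
Hypothesis w0 : forall x, 0 <= w x.
Hypothesis v1 : (\int[mu]_x (v x `^ p)%:E <= 1)%E.
Hypothesis w1 : (\int[mu]_x (w x `^ r)%:E <= 1)%E.

Local Notation k := (n%:R / 2 : R).
Local Notation A := ((4 * pi) `^ (- k) : R).
Local Notation V := (Vint sg p v).
Local Notation W := (Vint sg r w).
Local Notation Cp := (Cphi sg k p).
Local Notation Cr := (Cphi sg k r).

Let k0 : 0 < k. Proof. by rewrite divr_gt0// ltr0n. Qed.
Let A0 : 0 <= A. Proof. exact: powR_ge0. Qed.
Let V0 t : 0 <= V t. Proof. exact: Vint_ge0. Qed.
Let W0 t : 0 <= W t. Proof. exact: Vint_ge0. Qed.
Let mV : measurable_fun setT V. Proof. exact: measurable_Vint. Qed.
Let mW : measurable_fun setT W. Proof. exact: measurable_Vint. Qed.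
Let CV : (\int[leb]_t (pw (-1) t * V t)%:E <= Cp%:E)%E. Proof. exact: integral_Vint. Qed.
Let CW : (\int[leb]_t (pw (-1) t * W t)%:E <= Cr%:E)%E. Proof. exact: integral_Vint. Qed.
Let Cp0 : 0 <= Cp. Proof. exact: Cphi_ge0. Qed.
Let Cr0 : 0 <= Cr. Proof. exact: Cphi_ge0. Qed.
Let NV t : ((pw (k * sg) t)%:E * Nint v w t <= (V t + W t + A * V t)%:E)%E.
Proof. exact: (@Nint_ub _ _ p r sg). Qed.
Let HV t z : ((pw (k / p) t * pw (k / r) z)%:E * (hint v t * hint w z) <=
  (A * V t + A * W z + A * A * (V t * W z))%:E)%E.
Proof. exact: (@hint_ub _ _ p r sg). Qed.

(** At c = 1 - k sg the swapped weight z^(-c) is the power z^(k sg) of [Nint_ub] times 1/z, so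
    everything reduces to integrals of [V] and [W] against dz/z. *)
Lemma Nint_total : b1 < 1 - k * sg < b2 ->
  (\int[leb]_t ((pw (- (k * sg)) t)%:E *
      \int[leb]_z ((pw 0 z * mm b1 b2 (t * z))%:E * Nint v w z)) <=
   (Kmm b1 b2 (1 - k * sg) * (Cp + Cr + A * Cp))%:E)%E.
Proof.
move=> cb.
have mN : measurable_fun setT (Nint v w) by exact: measurable_Nint.
have N0 t : (0 <= Nint v w t)%E by exact: Nint_ge0.
have := @weight_swap R b1 b2 (1 - k * sg) 0 _ cb mN N0.
rewrite (_ : 1 - k * sg - 1 = - (k * sg)); last by ring.
move=> H; apply: (le_trans H).
rewrite EFinM; apply: lee_wpmul2l; first by rewrite lee_fin Kmm_ge0.
apply: (@le_trans _ (\bar R) (\int[leb]_t (pw (-1) t * V t + pw (-1) t * W t + A * (pw (-1) t * V t))%:E)%E).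
  apply: ge0_le_lower_integral => t _; first by rewrite mule_ge0// lee_fin pw_ge0.
  rewrite (_ : 0 - (1 - k * sg) = -1 + k * sg); last by ring.
  rewrite pwD EFinM -muleA.
  apply: (@le_trans _ (\bar R) ((pw (-1) t)%:E * (V t + W t + A * V t)%:E)%E).
    by apply: lee_wpmul2l; rewrite ?lee_fin ?pw_ge0.
  rewrite -EFinM lee_fin le_eqVlt; apply/orP; left; apply/eqP.
  move: (V t) (W t) (pw _ t) A => a b c e; ring.
have pV0 t : 0 <= pw (-1) t * V t by rewrite mulr_ge0 ?pw_ge0.
have pW0 t : 0 <= pw (-1) t * W t by rewrite mulr_ge0 ?pw_ge0.
have mpV : measurable_fun setT (fun t => pw (-1) t * V t) by apply: measurable_funM; [mfun|exact: mV].
have mpW : measurable_fun setT (fun t => pw (-1) t * W t) by apply: measurable_funM; [mfun|exact: mW].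
exact: (integral_three_le mpV mpW pV0 pW0 A0 CV CW).
Qed.

Local Notation al := (1 - k / p).
Local Notation be := (1 - k / r).

Lemma hint_total : b1 < al < b2 -> b1 < be < b2 ->
  (\int[leb]_t ((pw (al + be - 1) t)%:E *
     ((\int[leb]_z ((pw 0 z * mm b1 b2 (t * z))%:E * hint v z)) *
      (\int[leb]_z ((pw 0 z * mm b1 b2 (t * z))%:E * hint w z)))) <=
   (Dtotal A be b1 b2 Cr * (Kmm b1 b2 al * Cp) + A * Kmm b1 b2 al * (Kmm b1 b2 be * Cr))%:E)%E.
Proof.
move=> hal hbe; apply: (product_total A0 V0 W0 mV mW CV CW) => //.
- exact: measurable_hint.
- exact: measurable_hint.
- by move=> t; exact: hint_ge0.
- by move=> t; exact: hint_ge0.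
by move=> t z; rewrite !subKr; exact: HV.
Qed.

End bilinear_totals.

(** * Bounds on the Green function *)

Lemma ler_powRl {R : realType} (b x y : R) : 0 <= b -> 0 <= x -> x <= y -> x `^ b <= y `^ b.
Proof.
by move=> b0 x0 xy; apply: (ge0_ler_powR b0 _ _ xy); rewrite nnegrE// (le_trans x0).
Qed.

Lemma ler_powRNl {R : realType} (b x y : R) : 0 <= b -> 0 < x -> x <= y ->
  y `^ (- b) <= x `^ (- b).
Proof.
move=> b0 x0 xy; rewrite !powRN lef_pV2 ?posrE ?powR_gt0 ?(lt_le_trans x0 xy)//.
by apply: ler_powRl => //; exact: ltW.
Qed.

Section resolvent_weights.
Context {R : realType}.
Local Notation leb := (@lebesgue_measure R).
Variables (b1 b2 : R).
Hypothesis b10 : 0 < b1.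
Hypothesis b20 : 0 < b2.

Lemma mm_antitone (u v : R) : 0 < u -> u <= v -> mm b1 b2 v <= mm b1 b2 u.
Proof.
move=> u0 uv; rewrite /mm le_min !ge_min.
by rewrite (ler_powRNl (ltW b10) u0 uv) (ler_powRNl (ltW b20) u0 uv) orbT.
Qed.

Lemma expR_mm_ub : exists2 C : R, 0 < C & forall u, 0 < u -> expR (- u) <= C * mm b1 b2 u.
Proof.
have [C1 C10 H1] := @powR_expR_ub R b1 (ltW b10).
have [C2 C20 H2] := @powR_expR_ub R b2 (ltW b20).
exists (C1 + C2); first exact: addr_gt0.
move=> u u0; rewrite /mm.
have P (b C : R) : u `^ b <= C * expR u -> 0 <= C -> C <= C1 + C2 ->
    expR (- u) <= (C1 + C2) * u `^ (- b).
  move=> H C0 CC; apply: (@le_trans _ _ (C * u `^ (- b))); last first.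
    by rewrite ler_wpM2r ?powR_ge0.
  by rewrite powRN ler_pdivlMr ?powR_gt0// expRN mulrC ler_pdivrMr ?expR_gt0.
have [_|_] := lerP (u `^ (- b1)) (u `^ (- b2)).
  by apply: (P _ _ (H1 u (ltW u0))); rewrite ?(ltW C10)// lerDl (ltW C20).
by apply: (P _ _ (H2 u (ltW u0))); rewrite ?(ltW C20)// lerDr (ltW C10).
Qed.

Lemma mm_scale_ub (u v : R) : b1 <= b2 -> 0 < u -> 1 <= v ->
  mm b1 b2 (u * v) <= v `^ (- b1) * mm b1 b2 u.
Proof.
move=> b12 u0 v1; have v0 : 0 < v := lt_le_trans ltr01 v1.
rewrite /mm !(powRM _ (ltW u0) (ltW v0)) -[leRHS]mulrC minr_pMl ?powR_ge0//.
rewrite le_min !ge_min lexx/= ; apply/orP; right.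
by rewrite ler_wpM2l ?powR_ge0// ler_powR// lerN2.
Qed.

End resolvent_weights.

Section Green_bounds.
Context {R : realType} {n : nat}.
Local Notation leb := (@lebesgue_measure R).
Variables (b1 b2 : R).
Hypothesis b10 : 0 < b1.
Hypothesis b12 : b1 <= b2.
Implicit Types (x : 'rV[R]_n).

Let b20 : 0 < b2. Proof. exact: lt_le_trans b10 b12. Qed.

(** The argument z will be sqrt(w)|x|, while the heat kernel sees w|x|^2 = z^2; hence the doubled
    exponents in the proof. *)
Lemma expR_sqr_mm_ub :
  exists2 C : R, 0 < C & forall z, 0 < z -> expR (- z) <= C * mm b1 b2 (z ^+ 2).
Proof.
have [C C0 H] := @expR_mm_ub R (2 * b1) (2 * b2) (mulr_gt0 (ltr0Sn R 1) b10) (mulr_gt0 (ltr0Sn R 1) b20).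
exists C => // z z0; apply: le_trans (H z z0) _.
rewrite /mm -powR_mulrn ?(ltW z0)// -!powRrM.
by rewrite !mulrN.
Qed.

(** With exp(-wz) in place of [mm] this would be the Green function itself. The larger power weight
    leaves room for a one-sided bound by elementary estimates. *)
Definition heat_mm (w : R) x : \bar R :=
  (\int[leb]_z ((pw 0 z * mm b1 b2 (w * z)) * heat z x)%:E)%E.

Lemma heat_mm_ge0 w x : (0 <= heat_mm w x)%E.
Proof.
by apply: integral_ge0 => z _; rewrite lee_fin !mulr_ge0 ?pw_ge0 ?mm_ge0 ?heat_ge0.
Qed.

Let k : R := n%:R / 2.

(** Only times between q/2 and q with q = |x|^2 are kept: there [mm] is at least its value at wq,
    and the Gaussian factor is at least exp(-1/2). *)
Lemma heat_mm_lb w x : 0 < w -> 0 < sqnorm x ->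
  ((2^-1 * (4 * pi) `^ (- k) * expR (- 2^-1) * sqnorm x `^ (1 - k) * mm b1 b2 (w * sqnorm x))%:E
     <= heat_mm w x)%E.
Proof.
move=> w0; set q := sqnorm x => q0.
have q20 : 0 < q / 2 by rewrite divr_gt0.
pose c := mm b1 b2 (w * q) * ((4 * pi * q) `^ (- k) * expR (- 2^-1)).
have c0 : 0 <= c by rewrite !mulr_ge0 ?mm_ge0 ?powR_ge0 ?expR_ge0.
have mI : measurable (`[q / 2, q]%classic : set R) by [].
apply: (@le_trans _ (\bar R) (\int[leb]_z (c * \1_`[q / 2, q] z)%:E)%E).
  rewrite ge0_intZ// integral_indic// setIT.
  rewrite [X in (_ <= _ * X)%E](_ : _ = (q / 2)%:E); last first.
    etransitivity; first exact: (lebesgue_measure_itv `[q / 2, q]%R).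
    rewrite /= lte_fin ifT; last by rewrite ltr_pdivrMr// ltr_pMr// ltr1n.
    by rewrite -EFinB; congr EFin; field.
  rewrite -EFinM lee_fin /c.
  rewrite (@powRM _ (4 * pi) q) ?(ltW q0) ?mulr_ge0 ?pi_ge0//.
  rewrite (powRDp 1 (- k) q0) powRr1 ?(ltW q0)//.
  rewrite le_eqVlt; apply/orP; left; apply/eqP.
  by move: (q `^ _) (mm _ _ _) ((4 * pi) `^ _) (expR _) => a b e f; field.
apply: ge0_le_lower_integral => z _.
  by rewrite lee_fin mulr_ge0.
rewrite lee_fin indicE; case: (boolP (z \in _)) => zI; last first.
  by rewrite mulr0 !mulr_ge0 ?pw_ge0 ?mm_ge0 ?heat_ge0.
move: zI; rewrite inE/= in_itv/= => /andP[z1 z2].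
have z0 : 0 < z := lt_le_trans q20 z1.
rewrite mulr1 {1}/pw z0 powRr0 mul1r /c; apply: ler_pM.
- exact: mm_ge0.
- by rewrite mulr_ge0 ?powR_ge0 ?expR_ge0.
- by apply: mm_antitone; rewrite ?mulr_gt0// ler_pM2l.
have p4 : 0 < 4 * pi :> R by rewrite mulr_gt0 ?pi_gt0.
rewrite heatE//; apply: ler_pM.
- exact: powR_ge0.
- exact: expR_ge0.
- by apply: ler_powRNl; [rewrite divr_ge0|rewrite mulr_gt0|rewrite ler_pM2l].
- rewrite ler_expR lerN2 -/q ler_pdivrMr ?mulr_gt0//.
  by move: z1; rewrite ler_pdivrMr// => z1; lra.
Qed.

(** The square of cosh t >= 1 can be taken out of [mm] as a power with exponent -b1, and cosh t >=
    e^t/2 turns it into 4^b1 exp(-2 b1 t). Integrating this exponential gives the constant 1/(2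
    b1). *)
Lemma BesselK0_ub : exists2 C : R, 0 < C &
  forall z, 0 < z -> BesselK0 z <= C * mm b1 b2 (z ^+ 2).
Proof.
have [C C0 H] := expR_sqr_mm_ub.
exists (C * 4 `^ b1 * (2 * b1)^-1); first by rewrite !mulr_gt0 ?powR_gt0 ?invr_gt0 ?mulr_gt0.
move=> z z0; pose K := C * 4 `^ b1 * mm b1 b2 (z ^+ 2).
have K0 : 0 <= K by rewrite !mulr_ge0 ?mm_ge0 ?powR_ge0 ?(ltW C0).
have r0 : 0 < 2 * b1 by rewrite mulr_gt0.
have ub : (\int[leb]_(t in `[0%R, +oo[) (expR (- (z * cosh t)))%:E <=
    (K * (2 * b1)^-1)%:E)%E.
  apply: (@le_trans _ (\bar R) (\int[leb]_t (K * (2 * b1)^-1 * exponential_pdf (2 * b1) t)%:E)%E).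
    rewrite integral_mkcond; apply: ge0_le_lower_integral => t _.
      by rewrite patchE; case: ifPn => _; rewrite ?lee_fin ?expR_ge0.
    rewrite patchE; case: ifPn => [|_]; last first.
      rewrite lee_fin mulr_ge0 ?exponential_pdf_ge0 ?(ltW r0)//.
      by rewrite mulr_ge0// invr_ge0 ltW.
    rewrite inE/= in_itv/= andbT => t0.
    rewrite lee_fin exponential_pdfE//.
    have ch1 : expR t / 2 <= cosh t by rewrite /cosh ler_pM2r ?invr_gt0// lerDl expR_ge0.
    have ch2 : 1 <= cosh t.
      rewrite /cosh ler_pdivlMr// mul1r expRN.
      have e0 := expR_gt0 t; rewrite -subr_ge0.
      rewrite (_ : _ - 2 = (expR t - 1) ^+ 2 / expR t); last by field; rewrite gt_eqF.
      by rewrite divr_ge0 ?sqr_ge0 ?(ltW e0).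
    have ch0 : 0 < cosh t := lt_le_trans ltr01 ch2.
    apply: le_trans (H _ (mulr_gt0 z0 ch0)) _.
    rewrite exprMn; apply: (@le_trans _ _ (C * ((cosh t ^+ 2) `^ (- b1) * mm b1 b2 (z ^+ 2)))).
      by rewrite ler_pM2l//; apply: mm_scale_ub; rewrite ?exprn_gt0 ?exprn_ege1.
    apply: (@le_trans _ _ (C * ((4 `^ b1 * expR (- (2 * b1) * t)) * mm b1 b2 (z ^+ 2)))).
      rewrite ler_pM2l// ler_wpM2r ?mm_ge0//.
      have e2 : 0 < (expR t / 2) ^+ 2 by rewrite exprn_gt0 ?divr_gt0 ?expR_gt0.
      apply: (@le_trans _ _ (((expR t / 2) ^+ 2) `^ (- b1))).
        apply: ler_powRNl => //; first exact: ltW.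
        by rewrite ler_pXn2r ?nnegrE ?divr_ge0 ?expR_ge0 ?(ltW ch0).
      rewrite (_ : (expR t / 2) ^+ 2 = 4^-1 * expR (2 * t)); last first.
        by rewrite exprMn -expRM_natl; field.
      rewrite (@powRM _ 4^-1) ?expR_ge0 ?invr_ge0// -expRM.
      rewrite (_ : 4^-1 `^ (- b1) = 4 `^ b1); last by rewrite -powR_inv1// -powRrM mulN1r opprK.
      rewrite ler_pM2l ?powR_gt0// ler_expR le_eqVlt; apply/orP; left; apply/eqP; ring.
    rewrite le_eqVlt; apply/orP; left; apply/eqP; rewrite /K.
    by move: (4 `^ _) (expR _) (mm _ _ _) => a b e; field; rewrite gt_eqF.
  rewrite ge0_intZ ?integral_exponential_pdf ?mule1//.
  - exact: measurable_exponential_pdf.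
  - by move=> t; rewrite exponential_pdf_ge0// ltW.
  - by rewrite mulr_ge0// invr_ge0 ltW.
have i0 : (0 <= \int[leb]_(t in `[0%R, +oo[) (expR (- (z * cosh t)))%:E)%E.
  by apply: integral_ge0 => t _; rewrite lee_fin expR_ge0.
have fi : (\int[leb]_(t in `[0%R, +oo[) (expR (- (z * cosh t)))%:E)%E \is a fin_num.
  by rewrite ge0_fin_numE// (le_lt_trans ub)// ltry.
rewrite /BesselK0 /Rintegral -lee_fin fineK//.
by apply: (le_trans ub); rewrite lee_fin /K mulrAC.
Qed.

(** A default value: the integral is infinite and [fine] sends it to 0. Together with 0^-1 = 0 it
    makes [Green] vanish at the origin in both dimensions. *)
Lemma BesselK00 : BesselK0 (0 : R) = 0.
Proof.
rewrite /BesselK0; under eq_Rintegral do rewrite mul0r oppr0 expR0.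
rewrite Rintegral_cst// [X in fine X](_ : _ = +oo%E) ?mulr0//.
etransitivity; first exact: (lebesgue_measure_itv `[0 : R, +oo[%R).
by rewrite /= ltry.
Qed.

(** Up to a constant both Green functions are at most |x|^(2-n) mm(w|x|^2), which is the form of the
    lower bound [heat_mm_lb]. *)
Lemma Green_ub : n = 2%N \/ n = 3%N -> exists2 C : R, 0 < C &
  forall w x, 0 < w -> ((Green w x)%:E <= C%:E * heat_mm w x)%E.
Proof.
move=> n23.
pose c0 : R := 2^-1 * (4 * pi) `^ (- k) * expR (- 2^-1).
have p4 : 0 < 4 * pi :> R by rewrite mulr_gt0 ?pi_gt0.
have c00 : 0 < c0 by rewrite !mulr_gt0 ?powR_gt0 ?expR_gt0 ?invr_gt0.
have [D D0 HD] : exists2 D : R, 0 < D & forall w x, 0 < w -> 0 < sqnorm x ->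
    Green w x <= D * (sqnorm x `^ (1 - k) * mm b1 b2 (w * sqnorm x)).
  have zE w x : 0 < w -> (Num.sqrt w * enorm x) ^+ 2 = w * sqnorm x.
    by move=> w0; rewrite exprMn sqr_sqrtr ?(ltW w0)// enorm_sqr.
  have z0 w x : 0 < w -> 0 < sqnorm x -> 0 < Num.sqrt w * enorm x.
    by move=> w0 x0; rewrite mulr_gt0 ?sqrtr_gt0.
  case: n23 => n23.
    have [C C0 H] := BesselK0_ub.
    exists ((2 * pi)^-1 * C); first by rewrite !mulr_gt0 ?invr_gt0 ?mulr_gt0 ?pi_gt0.
    move=> w x w0 x0; rewrite /Green (_ : (n == 2%N) = true); last by rewrite n23.
    rewrite (_ : k = 1); last by rewrite /k n23 divff.
    rewrite subrr powRr0 mul1r -mulrA.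
    rewrite ler_pM2l ?invr_gt0 ?mulr_gt0 ?pi_gt0// -zE//.
    by apply: H; exact: z0.
  have [C C0 H] := expR_sqr_mm_ub.
  exists ((4 * pi)^-1 * C); first by rewrite !mulr_gt0 ?invr_gt0.
  move=> w x w0 x0; rewrite /Green (_ : (n == 2%N) = false); last by rewrite n23.
  rewrite (_ : k = 3 / 2); last by rewrite /k n23.
  have e0 : 0 < enorm x by rewrite sqrtr_gt0.
  rewrite (_ : 1 - 3 / 2 = - 2^-1); last by field.
  rewrite powRN powR12_sqrt ?(ltW x0)// -/(enorm x) invfM -zE//.
  apply: le_trans (ler_wpM2r _ (H _ (z0 _ _ w0 x0))) _.
    by rewrite mulr_ge0 ?invr_ge0 ?(ltW e0) ?(ltW p4).
  rewrite le_eqVlt; apply/orP; left; apply/eqP.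
  by move: (mm _ _ _) => a; ring.
exists (D / c0); first by rewrite divr_gt0.
move=> w x w0; have := sqnorm_ge0 x; rewrite le_eqVlt => /predU1P[x0|x0].
  have e0 : enorm x = 0 by rewrite /enorm -[X in Num.sqrt X]x0 sqrtr0.
  rewrite (_ : Green w x = 0); last first.
    by rewrite /Green; case: ifP => _; rewrite e0 !mulr0 ?BesselK00 ?invr0 mulr0.
  by rewrite mule_ge0 ?heat_mm_ge0// lee_fin divr_ge0 ?(ltW D0) ?(ltW c00).
have Dc : (0 <= (D / c0)%:E)%E by rewrite lee_fin divr_ge0 ?(ltW D0) ?(ltW c00).
apply: le_trans (lee_wpmul2l Dc (heat_mm_lb w0 x0)).
rewrite -EFinM lee_fin; apply: (le_trans (HD w x w0 x0)).
rewrite -/k -/c0 le_eqVlt; apply/orP; left; apply/eqP.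
by move: (sqnorm x `^ _) (mm _ _ _) => a b; field; rewrite gt_eqF.
Qed.

End Green_bounds.

(** * Growth of the denominator in the resolvent formula *)

Section green_constant.
Context {R : realType}.
Implicit Types (alpha omega : R).

Lemma omega_min_ge0 d alpha : 0 <= omega_min d alpha.
Proof.
rewrite /omega_min; case: ifP => _; first by rewrite mulr_ge0// expR_ge0.
by case: ifP => // _; exact: sqr_ge0.
Qed.

(** In dimension 2 the power of [t] is 0 and the value at [t = 0] suffices, the constant being
    increasing. In dimension 3 the square root must dominate a possibly negative [alpha] by a fixed
    fraction. *)
Lemma green_const_ub (d : nat) alpha omega : d = 2%N \/ d = 3%N ->
  omega_min d alpha < omega -> exists2 C : R, 0 < C & forall t, 0 < t ->
    0 < alpha + green_const d (omega + t) /\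
    (alpha + green_const d (omega + t))^-1 <= C * t `^ (1 - d%:R / 2).
Proof.
move=> d23 om; have o0 : 0 < omega := le_lt_trans (omega_min_ge0 d alpha) om.
have p4 : 0 < 4 * pi :> R by rewrite mulr_gt0 ?pi_gt0.
case: d23 om => -> om.
  have a0 : 0 < alpha + green_const 2 omega.
    move: om; rewrite /omega_min /green_const eqxx.
    set g := Euler_gamma => om.
    have om0 : 0 < 4 * expR (- (4 * pi * alpha) - 2 * g) by rewrite mulr_gt0 ?expR_gt0.
    have := om; rewrite -ltr_ln ?posrE// lnM ?posrE ?expR_gt0// expRK.
    rewrite (_ : 4 = 2 * 2 :> R) ?lnM ?posrE//; last by ring.
    move=> L; rewrite -(pmulr_rgt0 _ p4).
    rewrite (_ : 4 * pi * _ = 4 * pi * alpha + 2 * (g - ln 2) + ln omega); last first.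
      by move: (@pi R) (pi_gt0 R) => P P0; field; rewrite gt_eqF.
    have E : 2 * 2 = 4 :> R by ring.
    by move: L; rewrite E; lra.
  exists ((alpha + green_const 2 omega)^-1); first by rewrite invr_gt0.
  move=> t t0; have le : alpha + green_const 2 omega <= alpha + green_const 2 (omega + t).
    rewrite lerD2l /green_const eqxx lerD2l ler_pM2l ?invr_gt0// ler_ln ?posrE ?addr_gt0//.
    by rewrite lerDl ltW.
  split; first exact: lt_le_trans a0 le.
  by rewrite divff// subrr powRr0 mulr1 lef_pV2 ?posrE// (lt_le_trans a0 le).
pose so := Num.sqrt omega.
have so0 : 0 < so by rewrite sqrtr_gt0.
(* The fraction of sqrt(omega)/(4 pi) that [alpha] can cancel; it is below 1 because [omega] exceeds
   [omega_min], and a share 1 - rho of the square root remains for every [t]. *)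
pose rho := Num.max 0 (- alpha * (4 * pi) / so).
have rho0 : 0 <= rho by rewrite le_max lexx.
have rho1 : rho < 1.
  rewrite gt_max ltr01/= ltr_pdivrMr// mul1r.
  move: om; rewrite /omega_min/=; case: ifPn => al om.
    have n0 : 0 <= - alpha * (4 * pi) by rewrite mulr_ge0 ?(ltW p4)// oppr_ge0 ltW.
    rewrite -(ltr_pXn2r (n := 2))// ?nnegrE ?(ltW so0)//.
    by rewrite sqr_sqrtr ?(ltW o0)// mulNr sqrrN mulrC.
  by apply: le_lt_trans so0; rewrite mulNr oppr_le0 mulr_ge0 ?(ltW p4)// leNgt.
have al : - (rho * so / (4 * pi)) <= alpha.
  rewrite -[leRHS]opprK lerN2 ler_pdivlMr// -ler_pdivrMr//.
  by rewrite /rho le_max lexx orbT.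
exists ((1 - rho)^-1 * (4 * pi)); first by rewrite mulr_gt0// invr_gt0 subr_gt0.
move=> t t0; rewrite /green_const/=.
have st0 : 0 < Num.sqrt t by rewrite sqrtr_gt0.
have L : (1 - rho) * Num.sqrt t / (4 * pi) <= alpha + Num.sqrt (omega + t) / (4 * pi).
  apply: (@le_trans _ _ ((1 - rho) * Num.sqrt (omega + t) / (4 * pi))).
    rewrite ler_pM2r ?invr_gt0// ler_pM2l ?subr_gt0// ler_wsqrtr//.
    by rewrite lerDr ltW.
  have : so <= Num.sqrt (omega + t) by rewrite ler_wsqrtr// lerDl ltW.
  move: al; move: (Num.sqrt (omega + t)) => z al zo.
  rewrite !mulrBl mul1r [leRHS]addrC lerD2l; apply: le_trans al; rewrite lerN2.
  by rewrite ler_pM2r ?invr_gt0// ler_wpM2l.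
have L0 : 0 < (1 - rho) * Num.sqrt t / (4 * pi).
  by rewrite !mulr_gt0 ?subr_gt0 ?invr_gt0.
split; first exact: lt_le_trans L0 L.
rewrite (_ : 1 - 3 / 2 = - 2^-1); last by field.
rewrite powRN powR12_sqrt ?(ltW t0)//.
apply: (@le_trans _ _ ((1 - rho) * Num.sqrt t / (4 * pi))^-1).
  by rewrite lef_pV2 ?posrE// (lt_le_trans L0 L).
by rewrite (invfM ((1 - rho) * _)) invfM invrK mulrAC lexx.
Qed.

End green_constant.

(** * Pairing with the resolvent *)

Section Helmholtz_real_part.
Context {R : realType} {n : nat}.
Local Notation mu := (lebrV R n).
Local Notation leb := (@lebesgue_measure R).
Local Notation E := 'rV[R]_n.

Lemma partials_zero (l : seq 'I_n) : partials l (fun _ : E => (0 : R)) = fun=> 0.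
Proof.
elim: l => //= i l ->; apply/funext => x; rewrite /partial.
exact: derive_cst.
Qed.

Lemma Schwartz_zero : Schwartz (fun _ : E => (0 : R)).
Proof.
split.
  move=> l; rewrite partials_zero; split; first by exact: cst_continuous.
  by move=> i x; exact: derivable_cst.
by move=> l k; exists 0 => x; rewrite partials_zero normr0 mulr0.
Qed.

Lemma Laplacian_zero x : Laplacian (fun _ : E => (0 : R)) x = 0.
Proof.
rewrite /Laplacian big1// => i _.
by have := partials_zero [:: i; i]; rewrite /partials/= => ->.
Qed.

(** On real test functions the complex equation splits into its real and imaginary parts, to which
    the real bound applies. *)
Lemma Helmholtz_ReIm (w : R) (u f : E -> R[i]) : Helmholtz w u f ->
  forall psi, Schwartz psi ->
  Rintegral mu setT (fun x => complex.Re (u x) * (w * psi x - Laplacian psi x)) =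
  Rintegral mu setT (fun x => complex.Re (f x) * psi x) /\
  Rintegral mu setT (fun x => complex.Im (u x) * (w * psi x - Laplacian psi x)) =
  Rintegral mu setT (fun x => complex.Im (f x) * psi x).
Proof.
move=> H psi Spsi; have := H (fun x => (psi x)%:C%C) (conj Spsi Schwartz_zero).
have E1 (a : R[i]) (b c e : R) : e = 0 ->
    a * (w%:C%C * b%:C%C - Complex c e) = Complex (complex.Re a * (w * b - c)) (complex.Im a * (w * b - c)).
  by move=> ->; case: a => x y; apply/eqP; rewrite eq_complex/=; apply/andP; split; apply/eqP; ring.
have E2 (a : R[i]) (b : R) : a * b%:C%C = Complex (complex.Re a * b) (complex.Im a * b).
  by case: a => x y; apply/eqP; rewrite eq_complex/=; apply/andP; split; apply/eqP; ring.
rewrite (_ : (fun x => u x * _) = fun x =>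
    Complex (complex.Re (u x) * (w * psi x - Laplacian psi x))
            (complex.Im (u x) * (w * psi x - Laplacian psi x))); last first.
  by apply/funext => x; exact: E1 (Laplacian_zero x).
rewrite (_ : (fun x => f x * _) = fun x =>
    Complex (complex.Re (f x) * psi x) (complex.Im (f x) * psi x)); last first.
  by apply/funext => x; exact: E2.
by move=> [].
Qed.

Lemma cLfun_pint p (f : E -> R[i]) : 0 < p -> cLfun (lebesgue_rV R n) p f ->
  (pint p (fun x => Normc.normc (f x)) < +oo)%E.
Proof.
move=> p0 [mf]; rewrite /cLnorm LnormE// => H; rewrite ltey; apply/eqP => E.
by move: H; rewrite E poweRyr// gt_eqF// invr_gt0.
Qed.

Lemma pint_le p (f g : E -> R) : 0 <= p -> (forall x, `|f x| <= `|g x|) -> (pint p f <= pint p g)%E.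
Proof.
move=> p0 fg; apply: ge0_int_le => x; first exact: powR_ge0.
exact: ler_powRl.
Qed.

Variables (b1 b2 : R).

Definition wt (t z : R) : R := pw 0 z * mm b1 b2 (t * z).

Lemma wt_ge0 t z : 0 <= wt t z. Proof. by rewrite mulr_ge0 ?pw_ge0 ?mm_ge0. Qed.

Definition heat_conv (v : E -> R) z y : \bar R := (\int[mu]_x (heat z (x - y) * v x)%:E)%E.

(** Up to a constant, a majorant of (w - Delta)^-1 v for all w >= t simultaneously. *)
Definition heat_potential (v : E -> R) t y : \bar R :=
  (\int[leb]_z ((wt t z)%:E * heat_conv v z y))%E.

Section nonnegative.
Variable v : E -> R.
Hypothesis mv : measurable_fun setT v.
Hypothesis v0 : forall x, 0 <= v x.

Lemma heat_conv_ge0 z y : (0 <= heat_conv v z y)%E.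
Proof. by apply: integral_ge0 => x _; rewrite lee_fin mulr_ge0 ?heat_ge0. Qed.

Lemma measurable_heat_conv : measurable_fun [set: R * E] (fun z => heat_conv v z.1 z.2).
Proof.
apply: (@measurable_integral1 _ _ (R * E)%type _ R mu (fun z x => (heat z.1 (x - z.2) * v x)%:E)).
  by mfun.
by move=> z x; rewrite lee_fin mulr_ge0 ?heat_ge0.
Qed.

Lemma measurable_wt_heat_conv t :
  measurable_fun [set: R * E] (fun z => ((wt t z.1)%:E * heat_conv v z.1 z.2)%E).
Proof.
apply: emeasurable_funM; last exact: measurable_heat_conv.
by apply/measurable_EFinP; rewrite /wt; mfun.
Qed.

Lemma wt_heat_conv_ge0 t z y : (0 <= (wt t z)%:E * heat_conv v z y)%E.
Proof. by rewrite mule_ge0 ?heat_conv_ge0// lee_fin wt_ge0. Qed.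

Lemma heat_potential_ge0 t y : (0 <= heat_potential v t y)%E.
Proof. by apply: integral_ge0 => z _; exact: wt_heat_conv_ge0. Qed.

Lemma measurable_heat_potential t : measurable_fun setT (heat_potential v t).
Proof.
apply: (@measurable_integral2 _ _ (measurableTypeR R) E R leb (fun z y => ((wt t z)%:E * heat_conv v z y)%E)).
  exact: measurable_wt_heat_conv.
exact: wt_heat_conv_ge0.
Qed.

Lemma heat_potential0 t : heat_potential v t 0 = (\int[leb]_z ((wt t z)%:E * hint v z))%E.
Proof.
apply: eq_integral => z _; congr (_ * _)%E.
by apply: eq_integral => x _; rewrite subr0.
Qed.

Lemma heat_potential_pairing (h : E -> R) t : measurable_fun setT h -> (forall x, 0 <= h x) ->
  (\int[mu]_y (heat_potential v t y * (h y)%:E) = \int[leb]_z ((wt t z)%:E * Nint v h z))%E.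
Proof.
move=> mh h0.
transitivity (\int[mu]_y \int[leb]_z ((wt t z)%:E * heat_conv v z y * (h y)%:E))%E.
  apply: eq_integral => y _; rewrite /heat_potential muleC -ge0_integralZl//.
  - by apply: eq_integral => z _; rewrite muleC.
  - exact: (measurableT_comp (measurable_wt_heat_conv t) (measurable_pair2 y)).
  - by move=> z _; exact: wt_heat_conv_ge0.
  - by rewrite lee_fin.
rewrite -(@tonelli _ _ (measurableTypeR R) E R leb mu
  (fun z y => (wt t z)%:E * heat_conv v z y * (h y)%:E)%E); last 2 first.
- apply: emeasurable_funM; first exact: measurable_wt_heat_conv.
  by mfun.
- by move=> z y; apply: mule_ge0; [exact: wt_heat_conv_ge0|rewrite lee_fin].
apply: eq_integral => z _; rewrite /Nint -ge0_integralZl ?lee_fin ?wt_ge0//.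
- apply: eq_integral => y _; rewrite -muleA; congr (_ * _)%E.
  rewrite /heat_conv muleC -ge0_intZ//.
  + by apply: eq_integral => x _; rewrite mulrC.
  + by mfun.
  + by move=> x; rewrite mulr_ge0 ?heat_ge0.
- apply: (@measurable_integral1 _ _ E E R mu (fun y x => (heat z (x - y) * v x * h y)%:E)).
    by mfun.
  by move=> x y; rewrite lee_fin !mulr_ge0 ?heat_ge0.
- by move=> y _; apply: integral_ge0 => x _; rewrite lee_fin !mulr_ge0 ?heat_ge0.
Qed.

Lemma heat_mm_pairing t :
  (\int[mu]_y (heat_mm b1 b2 t y * (v y)%:E) = \int[leb]_z ((wt t z)%:E * hint v z))%E.
Proof.
have mk : measurable_fun [set: R * E] (fun z => (wt t z.1 * heat z.1 z.2)%:E).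
  rewrite /wt; apply/measurable_EFinP; apply: measurable_funM; first by mfun.
  apply: measurable_heat; first by mfun.
  by move=> i; exact: (measurableT_comp (measurable_rV_coord i) measurable_snd).
transitivity (\int[mu]_y \int[leb]_z ((wt t z * heat z y)%:E * (v y)%:E))%E.
  apply: eq_integral => y _; rewrite /heat_mm muleC -ge0_integralZl//.
  - by apply: eq_integral => z _; rewrite muleC.
  - exact: (measurableT_comp mk (measurable_pair2 y)).
  - by move=> z _; rewrite lee_fin mulr_ge0 ?wt_ge0 ?heat_ge0.
  - by rewrite lee_fin.
rewrite -(@tonelli _ _ (measurableTypeR R) E R leb mu
  (fun z y => (wt t z * heat z y)%:E * (v y)%:E)%E); last 2 first.
- by apply: emeasurable_funM => //; mfun.
- by move=> z y; rewrite mule_ge0 ?lee_fin// mulr_ge0 ?wt_ge0 ?heat_ge0.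
apply: eq_integral => z _; rewrite /hint -ge0_intZ ?wt_ge0//.
- by apply: eq_integral => y _; rewrite -EFinM mulrA.
- apply: measurable_funM => //; apply: measurable_heat => //.
  by move=> i; exact: measurable_rV_coord.
- by move=> y; rewrite mulr_ge0 ?heat_ge0.
Qed.

Lemma measurable_heat_mm t : measurable_fun [set: E] (heat_mm b1 b2 t).
Proof.
apply: (@measurable_integral2 _ _ (measurableTypeR R) E R leb (fun z y => (wt t z * heat z y)%:E)).
  rewrite /wt; apply/measurable_EFinP; apply: measurable_funM; first by mfun.
  apply: measurable_heat; first by mfun.
  by move=> i; exact: (measurableT_comp (measurable_rV_coord i) measurable_snd).
by move=> z y; rewrite lee_fin mulr_ge0 ?wt_ge0 ?heat_ge0.
Qed.

End nonnegative.

Hypothesis b10 : 0 < b1.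
Hypothesis b20 : 0 < b2.

(** exp(-wz) <= C mm(wz) <= C mm(tz), so only [t] is left of [w]. The factor 2 adds the real and
    imaginary parts, and [lam] carries the size of [f] while [v] stays normalised. *)
Lemma Helmholtz_solution_ub p (lam C t w : R) (u f : E -> R[i]) (v : E -> R) y :
  (forall z, 0 < z -> expR (- z) <= C * mm b1 b2 z) -> 0 <= C -> 0 <= lam ->
  1 < p -> 0 < t -> t <= w -> cLfun (lebesgue_rV R n) p u -> cLfun (lebesgue_rV R n) p f ->
  ccontinuous u -> Helmholtz w u f -> measurable_fun setT v -> (forall x, 0 <= v x) ->
  (forall x, Normc.normc (f x) = lam * v x) ->
  ((Normc.normc (u y))%:E <= (2 * (C * lam))%:E * heat_potential v t y)%E.
Proof.
move=> HC C0 lam0 p1 t0 tw Lu Lf [cu1 cu2] Huf mv v0 fv.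
have p0 : 0 < p := lt_trans ltr01 p1.
have w0 : 0 < w := lt_le_trans t0 tw.
have pu := cLfun_pint p0 Lu; have pf := cLfun_pint p0 Lf.
case: (Lu) (Lf) => -[mu1 mu2] _ [[mf1 mf2] _].
have part (a b : E -> R) : measurable_fun setT a -> measurable_fun setT b ->
    (forall x, `|a x| <= Normc.normc (u x)) -> (forall x, `|b x| <= Normc.normc (f x)) ->
    continuous a ->
    (forall psi, Schwartz psi -> Rintegral mu setT (fun x => a x * (w * psi x - Laplacian psi x)) =
      Rintegral mu setT (fun x => b x * psi x)) ->
    (`|a y|%:E <= (C * lam)%:E * heat_potential v t y)%E.
  move=> ma mb au bf ca H.
  have pa : (pint p a < +oo)%E.
    apply: le_lt_trans pu; apply: pint_le => [|x]; first exact: ltW.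
    by rewrite (ger0_norm (normc_ge0' _)).
  have pb : (pint p b < +oo)%E.
    apply: le_lt_trans pf; apply: pint_le => [|x]; first exact: ltW.
    by rewrite (ger0_norm (normc_ge0' _)).
  apply: le_trans (helmholtz_ub (ltW p1) w0 ma mb pa pb ca H y) _.
  have Cl0 : 0 <= C * lam by rewrite mulr_ge0.
  have hk0 (z : R) (x : E) : 0 <= pw 0 z * hker w y z x * `|b x|.
    rewrite /hker; apply: mulr_ge0; last exact: normr_ge0.
    apply: mulr_ge0; first exact: pw_ge0.
    by apply: mulr_ge0; [exact: expR_ge0|exact: heat_ge0].
  have mhv (z : R) : measurable_fun setT (fun x : E => heat z (x - y) * v x) by mfun.
  have hv0 (z : R) (x : E) : 0 <= heat z (x - y) * v x by rewrite mulr_ge0 ?heat_ge0.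
  have mW : measurable_fun [set: R] (fun z => (wt t z)%:E * heat_conv v z y)%E.
    exact: (measurableT_comp (measurable_wt_heat_conv mv v0 t) (measurable_pair2 y)).
  rewrite /heat_potential -ge0_integralZl ?lee_fin//; last first.
    by move=> z _; exact: (wt_heat_conv_ge0 v0).
  apply: ge0_le_lower_integral => z _.
    by apply: integral_ge0 => x _; rewrite lee_fin.
  have W0 : 0 <= C * lam * wt t z by apply: mulr_ge0 => //; exact: wt_ge0.
  rewrite muleA -EFinM -ge0_intZ//.
  apply: ge0_int_le => x; first exact: hk0.
  rewrite /wt /hker /pw; case: ifPn => z0; last by rewrite !mul0r mulr0 mul0r.
  rewrite powRr0 !mul1r.
  have e1 : expR (- (w * z)) <= C * mm b1 b2 (t * z).
    apply: (le_trans (HC _ (mulr_gt0 w0 z0))); rewrite ler_wpM2l//.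
    by apply: mm_antitone; rewrite ?mulr_gt0// ler_pM2r.
  have e2 : `|b x| <= lam * v x by rewrite -fv.
  apply: (@le_trans _ _ (C * mm b1 b2 (t * z) * heat z (x - y) * (lam * v x))).
    move: (heat_ge0 z (x - y)) (expR_ge0 (- (w * z))) e1 e2 (normr_ge0 (b x)).
    move: (heat _ _) (expR _) (mm _ _ _) `|b x| (lam * v x) => H1 H2 H3 H4 H5 h1 h2 h3 h4 h5.
    by apply: ler_pM => //; [exact: mulr_ge0|exact: ler_wpM2r].
  rewrite le_eqVlt; apply/orP; left; apply/eqP.
  by move: (heat _ _) (mm _ _ _) => a' b'; ring.
have P1 := part _ _ mu1 mf1 (fun x => Re_le_normc _) (fun x => Re_le_normc _) cu1
  (fun psi S => (Helmholtz_ReIm Huf S).1).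
have P2 := part _ _ mu2 mf2 (fun x => Im_le_normc _) (fun x => Im_le_normc _) cu2
  (fun psi S => (Helmholtz_ReIm Huf S).2).
apply: (@le_trans _ (\bar R) (`|complex.Re (u y)|%:E + `|complex.Im (u y)|%:E)%E).
  by rewrite lee_fin normc_le_ReIm.
rewrite mulr_natl mulr2n EFinD ge0_muleDl ?lee_fin ?mulr_ge0//; exact: leeD.
Qed.

End Helmholtz_real_part.

Section resolvent_pairing.
Context {R : realType} {n : nat}.
Local Notation mu := (lebrV R n).
Local Notation leb := (@lebesgue_measure R).
Local Notation E := 'rV[R]_n.

Lemma normcM_real (z : R[i]) (a : R) : Normc.normc (z * a%:C%C) = Normc.normc z * `|a|.
Proof.
rewrite !normcE' mulrC Re_realM Im_realM -sqrtr_sqr -sqrtrM ?addr_ge0 ?sqr_ge0//.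
by congr Num.sqrt; ring.
Qed.

Lemma Green_ge0 (w : R) (x : E) : 0 <= Green w x.
Proof.
rewrite /Green; case: ifP => _; rewrite mulr_ge0 ?invr_ge0 ?mulr_ge0 ?expR_ge0 ?pi_ge0 ?enorm_ge0//.
by apply: fine_ge0; apply: integral_ge0 => t _; rewrite lee_fin expR_ge0.
Qed.

Variables (b1 b2 : R).
Hypothesis b10 : 0 < b1.
Hypothesis b20 : 0 < b2.
Local Notation wt := (wt b1 b2).

Lemma heat_mm_antitone t w (x : E) : 0 < t -> t <= w -> (heat_mm b1 b2 w x <= heat_mm b1 b2 t x)%E.
Proof.
move=> t0 tw; apply: ge0_int_le => z; first by rewrite !mulr_ge0 ?pw_ge0 ?mm_ge0 ?heat_ge0.
apply: ler_wpM2r; first exact: heat_ge0.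
rewrite /pw; case: ifPn => z0; last by rewrite !mul0r.
by apply: ler_wpM2l; [exact: powR_ge0|apply: mm_antitone; rewrite ?mulr_gt0// ler_pM2r].
Qed.

(** The coefficient of the Green function is controlled by [heat_potential] at the origin, which
    integrates [hint v]; pairing the Green function with [h] integrates [hint h]. This is where the
    product of two weighted integrals comes from. *)
Lemma resolvent_pairing (alpha omega p t lam C Cg Cc : R) (f phi : E -> R[i]) (v h : E -> R) :
  (forall z, 0 < z -> expR (- z) <= C * mm b1 b2 z) -> 0 <= C -> 0 <= lam -> 0 <= Cg ->
  (forall (w : R) (x : E), 0 < w -> ((Green w x)%:E <= Cg%:E * heat_mm b1 b2 w x)%E) ->
  0 < alpha + green_const n (omega + t) ->
  (alpha + green_const n (omega + t))^-1 <= Cc * t `^ (1 - n%:R / 2) ->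
  1 < p -> 0 < t -> 0 <= omega -> is_resolvent alpha p (omega + t) f phi ->
  measurable_fun setT v -> (forall x, 0 <= v x) ->
  (forall x, Normc.normc (f x) = lam * v x) ->
  measurable_fun setT h -> (forall x, 0 <= h x) ->
  (\int[mu]_y (Normc.normc (phi y) * h y)%:E <=
   (2 * (C * lam))%:E * (\int[leb]_z ((wt t z)%:E * Nint v h z) +
     (Cc * Cg * t `^ (1 - n%:R / 2))%:E *
      ((\int[leb]_z ((wt t z)%:E * hint v z)) * (\int[leb]_z ((wt t z)%:E * hint h z)))))%E.
Proof.
move=> HC C0 lam0 Cg0 HG c0 cC p1 t0 o0 [Lf [g [[Lphi [Lg _] cg phiE] Hg]]] mv v0 fv mh h0.
set c := alpha + _ in c0 cC phiE.
have tw : t <= omega + t by rewrite lerDr.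
have w0 : 0 < omega + t := lt_le_trans t0 tw.
pose K1 := 2 * (C * lam).
have K10 : 0 <= K1 by rewrite !mulr_ge0.
pose HP := heat_potential b1 b2 v t.
have HP0 y : (0 <= HP y)%E by exact: heat_potential_ge0.
have gy y : ((Normc.normc (g y))%:E <= K1%:E * HP y)%E.
  exact: (Helmholtz_solution_ub b10 b20 y HC C0 lam0 p1 t0 tw Lg Lf cg Hg mv v0 fv).
pose K2 : \bar R := ((c^-1 * Cg)%:E * (K1%:E * HP 0%R))%E.
have ci0 : 0 <= c^-1 by rewrite invr_ge0 ltW.
have K20 : (0 <= K2)%E by rewrite !mule_ge0// lee_fin mulr_ge0.
have hm0 (y : E) : (0 <= heat_mm b1 b2 t y)%E by exact: heat_mm_ge0.
pose B (y : E) : \bar R := (K1%:E * HP y + K2 * heat_mm b1 b2 t y)%E.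
have mHP : measurable_fun setT HP by exact: measurable_heat_potential.
have mhm : measurable_fun [set: E] (heat_mm b1 b2 t) by exact: measurable_heat_mm.
have h0e y : (0 <= (h y)%:E)%E by rewrite lee_fin.
have mhe : measurable_fun setT (fun y => (h y)%:E) by exact/measurable_EFinP.
have mHPh : measurable_fun setT (fun y => HP y * (h y)%:E)%E by exact: emeasurable_funM.
have mhmh : measurable_fun setT (fun y => heat_mm b1 b2 t y * (h y)%:E)%E by exact: emeasurable_funM.
have TH1 y : (0 <= HP y * (h y)%:E)%E by exact: mule_ge0.
have TH2 y : (0 <= heat_mm b1 b2 t y * (h y)%:E)%E by exact: mule_ge0.
have U1 y : (0 <= K1%:E * (HP y * (h y)%:E))%E by apply: mule_ge0 => //; rewrite lee_fin.
have U2 y : (0 <= K2 * (heat_mm b1 b2 t y * (h y)%:E))%E by exact: (mule_ge0 K20 (TH2 y)).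
have phiB : {ae mu, forall y, setT y -> ((Normc.normc (phi y) * h y)%:E <=
    K1%:E * (HP y * (h y)%:E) + K2 * (heat_mm b1 b2 t y * (h y)%:E))%E}.
  apply: filterS phiE => y -> _.
  have T1 : (0 <= K1%:E * HP y)%E by apply: mule_ge0 => //; rewrite lee_fin.
  have T2 : (0 <= K2 * heat_mm b1 b2 t y)%E by exact: (mule_ge0 K20 (hm0 y)).
  rewrite EFinM !muleA -(ge0_muleDl _ T1 T2).
  apply: lee_wpmul2r => //.
  apply: (@le_trans _ (\bar R) ((Normc.normc (g y))%:E + (Normc.normc (g 0%R) * c^-1 * Green (omega + t) y)%:E)%E).
    rewrite lee_fin; apply: le_trans (normcD_le _ _) _; rewrite lerD2l.
    rewrite normcM_real (ger0_norm (Green_ge0 _ _)).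
    rewrite (_ : (c%:C)%C^-1 = (c^-1)%:C%C); last by rewrite fmorphV.
    by rewrite normcM_real (ger0_norm ci0).
  apply: leeD => //.
  have g0 := gy 0.
  have G1 := HG (omega + t) y w0.
  have G2 := heat_mm_antitone y t0 tw.
  apply: (@le_trans _ (\bar R) ((Normc.normc (g 0%R))%:E * ((c^-1 * Cg)%:E * heat_mm b1 b2 t y))%E).
    rewrite -mulrA EFinM; apply: lee_wpmul2l; first by rewrite lee_fin normc_ge0'.
    rewrite !EFinM -muleA; apply: lee_wpmul2l; first by rewrite lee_fin.
    by apply: (le_trans G1); apply: lee_wpmul2l; rewrite ?lee_fin.
  have k0 : (0 <= (c^-1 * Cg)%:E)%E by rewrite lee_fin mulr_ge0.
  rewrite muleCA /K2 -[leRHS]muleA.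
  move: (hm0 y) g0 k0; move: (heat_mm _ _ _ _) (HP _) (_ * Cg)%:E (Normc.normc _)%:E => a' b' c' e' h1 h2 h3.
  by apply: lee_wpmul2l => //; exact: lee_wpmul2r.
have mphi : measurable_fun setT (fun y => (Normc.normc (phi y) * h y)%:E).
  apply/measurable_EFinP; apply: measurable_funM => //; apply: measurable_normc; exact: Lphi.1.
have mT1 : measurable_fun setT (fun y => K1%:E * (HP y * (h y)%:E))%E by exact: measurable_funeM.
have mT2 : measurable_fun setT (fun y => K2 * (heat_mm b1 b2 t y * (h y)%:E))%E by exact: measurable_funeM.
apply: le_trans (ae_ge0_le_integral _ _ _ _ _ phiB) _ => //.
- by move=> y _; rewrite lee_fin mulr_ge0 ?normc_ge0'.
- by move=> y _; exact: adde_ge0.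
- exact: emeasurable_funD.
rewrite ge0_integralD// !ge0_integralZl//.
rewrite heat_potential_pairing// heat_mm_pairing// /K2 /HP heat_potential0.
have N0 : (0 <= \int[leb]_z ((wt t z)%:E * Nint v h z))%E.
  by apply: integral_ge0 => z _; rewrite mule_ge0 ?lee_fin ?wt_ge0 ?Nint_ge0.
have Hv0 : (0 <= \int[leb]_z ((wt t z)%:E * hint v z))%E.
  by apply: integral_ge0 => z _; rewrite mule_ge0 ?lee_fin ?wt_ge0 ?hint_ge0.
have Hh0 : (0 <= \int[leb]_z ((wt t z)%:E * hint h z))%E.
  by apply: integral_ge0 => z _; rewrite mule_ge0 ?lee_fin ?wt_ge0 ?hint_ge0.
have D1 : c^-1 * Cg <= Cc * Cg * t `^ (1 - n%:R / 2).
  by rewrite [leRHS]mulrAC; exact: ler_wpM2r.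
move: N0 Hv0 Hh0 D1; move: (integral _ _ _) (integral _ _ _) (integral _ _ _) => X Y Z X0 Y0 Z0 D1.
rewrite -/K1 [leRHS]ge0_muleDr; [|exact: X0|by rewrite !mule_ge0// lee_fin (le_trans _ D1)// mulr_ge0].
apply: leeD => //; rewrite [(_ * (K1%:E * Y))%E]muleCA -muleA; apply: lee_wpmul2l; first by rewrite lee_fin.
by rewrite -muleA; apply: lee_wpmul2r; [exact: mule_ge0|rewrite lee_fin].
Qed.

End resolvent_pairing.

(** * Pairing with the fractional resolvent *)

Section fractional_pairing.
Context {R : realType} {n : nat}.
Local Notation mu := (lebrV R n).
Local Notation leb := (@lebesgue_measure R).
Local Notation E := 'rV[R]_n.
Variables (alpha omega p r s sg b1 b2 : R).
Hypothesis n23 : n = 2%N \/ n = 3%N.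
Hypothesis om : omega_min n alpha < omega.
Hypothesis p1 : 1 < p.
Hypothesis r1 : 1 < r.
Hypothesis sg0 : 0 < sg.
Hypothesis prs : p^-1 + r^-1 = 1 + sg.
Local Notation k := (n%:R / 2 : R).
Local Notation al := (1 - k / p).
Local Notation be := (1 - k / r).
Hypothesis ssg : s / 2 = k * sg.
Hypothesis b10 : 0 < b1.
Hypothesis b12 : b1 <= b2.
Hypothesis bal : b1 < al < b2.
Hypothesis bbe : b1 < be < b2.
Hypothesis bs : b1 < 1 - k * sg < b2.
Local Notation wt := (wt b1 b2).
Local Notation N_ v h t := (\int[leb]_z ((wt t z)%:E * Nint v h z))%E.
Local Notation H_ v t := (\int[leb]_z ((wt t z)%:E * hint v z))%E.

Let n0 : (0 < n)%N. Proof. by case: n23 => ->. Qed.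
Let b20 : 0 < b2. Proof. exact: lt_le_trans b10 b12. Qed.

Lemma measurable_wt_integral (e : R -> \bar R) : measurable_fun setT e ->
  (forall z, (0 <= e z)%E) -> measurable_fun setT (fun t => \int[leb]_z ((wt t z)%:E * e z))%E.
Proof.
move=> me e0; apply: measurable_integral1; last first.
  by move=> t z; rewrite mule_ge0 ?lee_fin ?wt_ge0.
apply: emeasurable_funM; first by rewrite /wt; mfun.
by apply: (measurableT_comp me); exact: measurable_snd.
Qed.

Lemma wt_integral_ge0 (e : R -> \bar R) t : (forall z, (0 <= e z)%E) ->
  (0 <= \int[leb]_z ((wt t z)%:E * e z))%E.
Proof. by move=> e0; apply: integral_ge0 => z _; rewrite mule_ge0 ?lee_fin ?wt_ge0. Qed.

Lemma fractional_pairing : exists2 K : R, 0 < K &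
  forall (lam : R) (f phi : E -> R[i]) (v h : E -> R), 0 <= lam ->
  is_frac_resolvent alpha p s omega f phi ->
  measurable_fun setT v -> (forall x, 0 <= v x) -> (forall x, Normc.normc (f x) = lam * v x) ->
  (\int[mu]_x (v x `^ p)%:E <= 1)%E ->
  measurable_fun setT h -> (forall x, 0 <= h x) -> (\int[mu]_x (h x `^ r)%:E <= 1)%E ->
  (pint (p / (p - 1)) h < +oo)%E ->
  (\int[mu]_y (Normc.normc (phi y) * h y)%:E <= (K * lam)%:E)%E.
Proof.
have [C C0 HC] := expR_mm_ub b10 b20.
have [Cg Cg0 HG] := Green_ub b10 b12 n23.
have [Cc Cc0 HCc] := green_const_ub n23 om.
have p0 : 0 < p := lt_trans ltr01 p1.
have o0 : 0 <= omega := le_trans (omega_min_ge0 n alpha) (ltW om).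
have k0 : 0 < k by rewrite divr_gt0// ltr0n.
pose A : R := (4 * pi) `^ (- k).
have A0 : 0 <= A by exact: powR_ge0.
pose A1 := Kmm b1 b2 (1 - k * sg) * (Cphi sg k p + Cphi sg k r + A * Cphi sg k p).
pose A2 := Dtotal A be b1 b2 (Cphi sg k r) * (Kmm b1 b2 al * Cphi sg k p) +
  A * Kmm b1 b2 al * (Kmm b1 b2 be * Cphi sg k r).
have Cp0 : 0 <= Cphi sg k p by exact: Cphi_ge0.
have Cr0 : 0 <= Cphi sg k r by exact: Cphi_ge0.
have Ka := Kmm_ge0 bal; have Kb := Kmm_ge0 bbe; have Ks := Kmm_ge0 bs.
have A10 : 0 <= A1.
  by apply: mulr_ge0 => //; apply: addr_ge0; [exact: addr_ge0|exact: mulr_ge0].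
have A20 : 0 <= A2.
  have D0 : 0 <= Dtotal A be b1 b2 (Cphi sg k r) by apply: addr_ge0; do ?apply: mulr_ge0.
  by apply: addr_ge0; do ?apply: mulr_ge0.
pose S : R := `|sin (s * pi / 2) / pi|.
pose K := S * (2 * (2 * C * (A1 + Cc * Cg * A2))).
have CcCg : 0 <= Cc * Cg by rewrite mulr_ge0// ltW.
have K0 : 0 <= K.
  apply: mulr_ge0; first exact: normr_ge0.
  apply: mulr_ge0 => //; apply: mulr_ge0; first by rewrite mulr_ge0// ltW.
  by apply: addr_ge0 => //; exact: mulr_ge0.
(* [K] is only known to be nonnegative, as the sine enters through its absolute value; adding 1
   makes the constant positive. *)
exists (K + 1); first by rewrite ltr_wpDl.
move=> lam f phi v h lam0 [Lf Lphi [F [Phi [HF HB phiE]]]] mv v0 fv v1 mh h0 h1 hp.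
have LPhi := HB.2.1.
pose M t : \bar R := ((2 * (C * lam))%:E * ((pw (- (k * sg)) t)%:E * N_ v h t +
  (Cc * Cg)%:E * ((pw (al + be - 1) t)%:E * (H_ v t * H_ h t))))%E.
have mN : measurable_fun setT (Nint v h) by exact: measurable_Nint.
have mHv : measurable_fun setT (hint v) by exact: measurable_hint.
have mHh : measurable_fun setT (hint h) by exact: measurable_hint.
have N0 z : (0 <= Nint v h z)%E by exact: Nint_ge0.
have Hv0 z : (0 <= hint v z)%E by exact: hint_ge0.
have Hh0 z : (0 <= hint h z)%E by exact: hint_ge0.
have T1 t : (0 <= (pw (- (k * sg)) t)%:E * N_ v h t)%E.
  by apply: mule_ge0; [rewrite lee_fin pw_ge0|exact: wt_integral_ge0].
have T2 t : (0 <= (pw (al + be - 1) t)%:E * (H_ v t * H_ h t))%E.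
  by apply: mule_ge0; [rewrite lee_fin pw_ge0|apply: mule_ge0; exact: wt_integral_ge0].
have m1 : measurable_fun setT (fun t => (pw (- (k * sg)) t)%:E * N_ v h t)%E.
  by apply: emeasurable_funM; [mfun|exact: measurable_wt_integral].
have m2 : measurable_fun setT (fun t => (pw (al + be - 1) t)%:E * (H_ v t * H_ h t))%E.
  apply: emeasurable_funM; first by mfun.
  by apply: emeasurable_funM; exact: measurable_wt_integral.
have m3 : measurable_fun setT (fun t => (Cc * Cg)%:E * ((pw (al + be - 1) t)%:E * (H_ v t * H_ h t)))%E.
  exact: measurable_funeM.
have T3 t : (0 <= (Cc * Cg)%:E * ((pw (al + be - 1) t)%:E * (H_ v t * H_ h t)))%E.
  by apply: mule_ge0; [rewrite lee_fin|exact: T2].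
have m4 := emeasurable_funD m1 m3.
have T4 t := adde_ge0 (T1 t) (T3 t).
have Cl0 : 0 <= 2 * (C * lam) by rewrite !mulr_ge0// ltW.
have mM : measurable_fun setT M by exact: measurable_funeM.
have M0 t : (0 <= M t)%E by apply: mule_ge0; [rewrite lee_fin|exact: T4].
have IM : (\int[leb]_t M t <= (2 * (C * lam) * (A1 + Cc * Cg * A2))%:E)%E.
  have c1 : (0 <= (2 * (C * lam))%:E)%E by rewrite lee_fin.
  have c2 : (0 <= (Cc * Cg)%:E)%E by rewrite lee_fin.
  have I1 := Nint_total n0 p1 r1 sg0 prs mv mh v0 h0 v1 h1 bs.
  have I2 := hint_total n0 p1 r1 sg0 prs mv mh v0 h0 v1 h1 bal bbe.
  rewrite /M ge0_integralZl//.
  apply: (@le_trans _ (\bar R) ((2 * (C * lam))%:E * (A1%:E + (Cc * Cg)%:E * A2%:E))%E); last first.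
    by move: (A1) (A2) (2 * (C * lam)) (Cc * Cg) => c5 c6 c3 c4; exact: lexx.
  apply: lee_wpmul2l => //.
  rewrite ge0_integralD//.
  apply: leeD; first exact: I1.
  rewrite ge0_integralZl//.
  by apply: lee_wpmul2l => //; exact: I2.
have GM t : 0 < t ->
    (\int[mu]_x (Normc.normc ((t `^ (- (s / 2)))%:C%C * F t x) * h x)%:E <= M t)%E.
  move=> t0; have [c0 cC] := HCc t t0.
  have RP := resolvent_pairing b10 b20 HC (ltW C0) lam0 (ltW Cg0) HG c0 cC p1 t0 o0 (HF t t0) mv v0 fv mh h0.
  have [g [[LF _ _ _] _]] := (HF t t0).2.
  have mF := measurable_normc LF.1.
  have mFh : measurable_fun setT (fun x => Normc.normc (F t x) * h x) by exact: measurable_funM.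
  have Fh0 x : 0 <= Normc.normc (F t x) * h x by rewrite mulr_ge0 ?normc_ge0'.
  have te0 : 0 <= t `^ (- (s / 2)) by exact: powR_ge0.
  apply: (@le_trans _ (\bar R) (\int[mu]_x (t `^ (- (s / 2)) * (Normc.normc (F t x) * h x))%:E)%E).
    apply: ge0_int_le => x; first by rewrite mulr_ge0 ?normc_ge0'.
    by rewrite [(_)%:C%C * _]mulrC normcM_real (ger0_norm te0) mulrA [_ * t `^ _]mulrC.
  rewrite ge0_intZ//.
  apply: le_trans (lee_wpmul2l _ RP) _; first by rewrite lee_fin.
  have E1 : pw (- (k * sg)) t = t `^ (- (s / 2)) by rewrite /pw t0 ssg.
  (* The weight t^(-s/2) of the fractional power and t^(1-k) from the denominator combine to the
     scale-invariant exponent, because k sg = s/2. *)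
  have E2 : pw (al + be - 1) t = t `^ (- (s / 2)) * t `^ (1 - k).
    rewrite /pw t0 -powRDp// ssg; congr (_ `^ _).
    have -> : k * sg = k * (p^-1 + r^-1 - 1) by rewrite prs addrAC subrr add0r.
    by move: k => kk; ring.
  rewrite /M E1 E2; have := wt_integral_ge0 t N0; have := wt_integral_ge0 t Hv0.
  have := wt_integral_ge0 t Hh0; move: te0 (powR_ge0 t (1 - k)).
  move: (t `^ _) (t `^ _) (N_ v h t) (H_ v t) (H_ h t) => a b X Y Z a0 b0 Z0 Y0 X0.
  rewrite muleCA; apply: lee_wpmul2l; first by rewrite lee_fin.
  rewrite ge0_muleDr//; last by rewrite mule_ge0 ?mule_ge0// lee_fin mulr_ge0.
  apply: leeD => //; rewrite !muleA -!EFinM.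
  by rewrite (_ : b * (Cc * Cg * a) = Cc * Cg * (b * a)) ?lexx//; ring.
have BP := bochner_pairing_ub p0 _ _ mh h0 hp mM M0 GM HB.
have S0 : 0 <= S by exact: normr_ge0.
have mPhi := measurable_normc LPhi.1.
have mphi := measurable_normc Lphi.1.
apply: (@le_trans _ (\bar R) (\int[mu]_x (S * (Normc.normc (Phi x) * h x))%:E)%E).
  apply: ae_ge0_le_integral => //.
  - by move=> x _; rewrite lee_fin mulr_ge0 ?normc_ge0'.
  - by apply/measurable_EFinP; exact: measurable_funM.
  - by move=> x _; rewrite lee_fin !mulr_ge0 ?normc_ge0'.
  - apply/measurable_EFinP; apply: measurable_funM => //; exact: measurable_funM.
  apply: filterS phiE => x -> _.
  by rewrite lee_fin [(_)%:C%C * _]mulrC normcM_real -/S mulrA [_ * S]mulrC lexx.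
rewrite ge0_intZ//; last 2 first.
- exact: measurable_funM.
- by move=> x; rewrite mulr_ge0 ?normc_ge0'.
have p10 : 0 < p - 1 by rewrite subr_gt0.
apply: (@le_trans _ (\bar R) (S%:E * (2%:E * (2 * (C * lam) * (A1 + Cc * Cg * A2))%:E))%E).
  apply: lee_wpmul2l; first by rewrite lee_fin.
  apply: le_trans (BP _ _) _.
  - by rewrite divr_gt0.
  - by rewrite invf_div; field; rewrite gt_eqF.
  - by apply: lee_wpmul2l => //; rewrite lee_fin.
rewrite -!EFinM lee_fin.
apply: (@le_trans _ _ (K * lam)); last by rewrite (_ : (K + 1) * lam = K * lam + lam) ?lerDl//; ring.
by rewrite le_eqVlt; apply/orP; left; apply/eqP; rewrite /K; move: (S) (A1) (A2) => S1 a1 a2; ring.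
Qed.

End fractional_pairing.

(** * Duality *)

Section duality.
Context {R : realType} {n : nat}.
Local Notation mu := (lebrV R n).
Local Notation E := 'rV[R]_n.
Variables (p q B : R) (u : E -> R).
Hypothesis p1 : 1 < p.
Hypothesis pq : p < q.
Hypothesis B0 : 0 <= B.
Hypothesis measu : measurable_fun setT u.
Hypothesis u0 : forall x, 0 <= u x.
Hypothesis up : (\int[mu]_x (u x `^ p)%:E < +oo)%E.
Local Notation r := (q / (q - 1)).
Local Notation p' := (p / (p - 1)).
Hypothesis pairing : forall h : E -> R, measurable_fun setT h -> (forall x, 0 <= h x) ->
  (\int[mu]_x (h x `^ r)%:E <= 1)%E -> (pint p' h < +oo)%E ->
  (\int[mu]_x (u x * h x)%:E <= B%:E)%E.

Let p0 : 0 < p. Proof. exact: lt_trans p1. Qed.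
Let q0 : 0 < q. Proof. exact: lt_trans pq. Qed.
Let q1 : 0 < q - 1. Proof. by rewrite subr_gt0 (lt_trans p1). Qed.
Let p10 : 0 < p - 1. Proof. by rewrite subr_gt0. Qed.

Lemma powR_truncation_ub (e m c v : R) : p <= e -> 0 <= m -> m <= c -> m <= v ->
  m `^ e <= c `^ (e - p) * v `^ p.
Proof.
move=> pe; rewrite le_eqVlt => /predU1P[<- _ _|m0 mc mv].
  by rewrite powR0 ?mulr_ge0 ?powR_ge0// gt_eqF// (lt_le_trans p0).
rewrite -{1}(subrK p e) (powRDp _ _ m0).
by apply: ler_pM; rewrite ?powR_ge0//; apply: ler_powRl; rewrite ?(ltW m0) ?subr_ge0 ?(ltW p0).
Qed.

(** A priori [u] is only in L^p, so the extremal function of duality might not be admissible. The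
    truncation [m] is bounded and in L^p, hence in L^e for every e >= p, and the bound does not
    involve the level [c]. *)
Lemma integral_truncation_ub (c : R) : 0 <= c ->
  (\int[mu]_x (Num.min (u x) c `^ q)%:E <= (B `^ q)%:E)%E.
Proof.
move=> c0; pose m x := Num.min (u x) c.
have m0 x : 0 <= m x by rewrite le_min u0.
have mu_ x : m x <= u x by rewrite ge_min lexx.
have mc x : m x <= c by rewrite ge_min lexx orbT.
have mm_ : measurable_fun setT m by apply: measurable_minr.
have mmq (e : R) : measurable_fun setT (fun x => m x `^ e) by apply: measurable_fun_powR.
have mq0 e x : 0 <= m x `^ e by exact: powR_ge0.
have fin (e : R) : p <= e -> (\int[mu]_x (m x `^ e)%:E < +oo)%E.
  move=> pe; apply: (@le_lt_trans _ (\bar R) (\int[mu]_x (c `^ (e - p) * u x `^ p)%:E)%E).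
    by apply: ge0_int_le => x; [exact: powR_ge0|exact: powR_truncation_ub].
  have mup : measurable_fun setT (fun x => u x `^ p) by apply: measurable_fun_powR.
  have up0 x : 0 <= u x `^ p by exact: powR_ge0.
  rewrite ge0_intZ ?powR_ge0//.
  by apply: lte_mul_pinfty => //; rewrite ?lee_fin ?powR_ge0.
have I0 : (0 <= \int[mu]_x (m x `^ q)%:E)%E by apply: integral_ge0 => x _; rewrite lee_fin powR_ge0.
have If : (\int[mu]_x (m x `^ q)%:E)%E \is a fin_num by rewrite ge0_fin_numE// fin// ltW.
pose a := fine (\int[mu]_x (m x `^ q)%:E)%E.
have aE : (\int[mu]_x (m x `^ q)%:E)%E = a%:E by rewrite fineK.
have : 0 <= a by exact: fine_ge0.
rewrite -/(m _) aE lee_fin le_eqVlt => /predU1P[<-|a0]; first exact: powR_ge0.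
(* The extremal function m^(q-1), normalised in L^r; it lies in L^p' because (q - 1) p' >= p. *)
pose h x := a `^ (- r^-1) * m x `^ (q - 1).
have r0 : 0 < r by rewrite divr_gt0.
have p'0 : 0 < p' by rewrite divr_gt0.
have h0 x : 0 <= h x by rewrite mulr_ge0 ?powR_ge0.
have mh : measurable_fun setT h by apply: measurable_funM => //; exact: mmq.
have hr : (\int[mu]_x (h x `^ r)%:E <= 1)%E.
  have hE x : h x `^ r = a^-1 * m x `^ q.
    rewrite powRM ?powR_ge0// -!powRrM; congr (_ * _ `^ _).
      by rewrite mulNr mulVf ?gt_eqF// powR_inv1// ltW.
    by field; rewrite gt_eqF.
  under eq_integral do rewrite hE.
  by rewrite ge0_intZ ?invr_ge0 ?(ltW a0)// aE -EFinM mulVf ?gt_eqF// lexx.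
have hp : (pint p' h < +oo)%E.
  have hE x : `|h x| `^ p' = a `^ (- r^-1 * p') * m x `^ ((q - 1) * p').
    by rewrite ger0_norm// powRM ?powR_ge0// -!powRrM.
  rewrite /pint; under eq_integral do rewrite hE.
  rewrite ge0_intZ ?powR_ge0//.
  apply: lte_mul_pinfty; rewrite ?lee_fin ?powR_ge0// fin//.
  by rewrite mulrA ler_pdivlMr// mulrC ler_pM2r// lerD2r ltW.
have := pairing mh h0 hr hp.
have uh : ((a `^ (- r^-1) * a)%:E <= \int[mu]_x (u x * h x)%:E)%E.
  rewrite EFinM -aE -ge0_intZ ?powR_ge0//.
  apply: ge0_int_le => x; first by rewrite mulr_ge0 ?powR_ge0.
  rewrite /h [leRHS]mulrCA ler_wpM2l ?powR_ge0//.
  apply: (@le_trans _ _ (m x * m x `^ (q - 1))); last by rewrite ler_wpM2r ?powR_ge0.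
  have := m0 x; rewrite le_eqVlt => /predU1P[<-|mx0]; first by rewrite powR0 ?mul0r// gt_eqF.
  by rewrite -{2}(powRr1 (m0 x)) -powRDp// addrC subrK.
move=> /(le_trans uh); rewrite lee_fin => aB.
have aq : a `^ (- r^-1) * a = a `^ q^-1.
  rewrite -{2}(powRr1 (ltW a0)) -powRDp//; congr (_ `^ _).
  by field; rewrite !gt_eqF.
rewrite aq in aB.
have := ler_powRl (ltW q0) (powR_ge0 _ _) aB.
by rewrite -powRrM mulVf ?gt_eqF// powRr1// ltW.
Qed.

Lemma integral_powR_ub : (\int[mu]_x (u x `^ q)%:E <= (B `^ q)%:E)%E.
Proof.
pose g (N : nat) (x : E) : \bar R := (Num.min (u x) N%:R `^ q)%:E.
have mg N : measurable_fun setT (g N).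
  apply/measurable_EFinP; apply: measurable_fun_powR; exact: measurable_minr.
have g0 N x : setT x -> (0 <= g N x)%E by rewrite lee_fin powR_ge0.
have ndg x : setT x -> nondecreasing_seq (g^~ x).
  move=> _ N1 N2 N12; rewrite lee_fin; apply: ler_powRl; first exact: ltW.
    by rewrite le_min u0/=.
  by rewrite le_min !ge_min lexx/= ler_nat N12 orbT.
have limg x : limn (g^~ x) = (u x `^ q)%:E.
  apply: lim_near_cst; first exact: ereal_hausdorff.
  (* The truncations become stationary once the level exceeds the value of [u]. *)
  exists (Num.bound (u x)) => // N /= bN; rewrite /g min_l//.
  apply: (le_trans (ltW (archi_boundP (u0 x)))).
  by rewrite ler_nat.
under eq_integral do rewrite -limg.
rewrite (monotone_convergence mu measurableT mg g0 ndg).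
apply: lime_le.
  apply: ereal_nondecreasing_is_cvgn => N1 N2 N12.
  by apply: ge0_le_lower_integral => x _; [exact: g0|exact: ndg].
by apply: nearW => N; exact: integral_truncation_ub.
Qed.

End duality.

(** * Norms of complex functions and the embedding *)

Section complex_norm.
Context {R : realType} {n : nat}.
Local Notation mu := (lebrV R n).
Local Notation E := 'rV[R]_n.

Lemma cLnormE (e : R) (f : E -> R[i]) : 0 < e ->
  cLnorm (lebesgue_rV R n) e f = ((\int[mu]_x (Normc.normc (f x) `^ e)%:E) `^ e^-1)%E.
Proof.
move=> e0; rewrite /cLnorm (LnormE _ e0).
have -> // : pint e (fun x => Normc.normc (f x)) = (\int[mu]_x (Normc.normc (f x) `^ e)%:E)%E.
apply: eq_integral => x _; congr (_ `^ _)%:E; apply: ger0_norm; exact: normc_ge0'.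
Qed.

Lemma cLnorm_le (e c : R) (f : E -> R[i]) : 0 < e -> 0 <= c ->
  (cLnorm (lebesgue_rV R n) e f <= c%:E)%E <->
  (\int[mu]_x (Normc.normc (f x) `^ e)%:E <= (c `^ e)%:E)%E.
Proof.
move=> e0 c0; rewrite cLnormE//.
have : (0 <= \int[mu]_x (Normc.normc (f x) `^ e)%:E)%E.
  by apply: integral_ge0 => x _; rewrite lee_fin powR_ge0.
case: (integral _ _ _) => [x||] // x0.
  rewrite poweR_EFin !lee_fin; rewrite lee_fin in x0; split => H.
    have := ler_powRl (ltW e0) (powR_ge0 _ _) H.
    by rewrite -powRrM mulVf ?gt_eqF// powRr1.
  have ei : 0 <= e^-1 by rewrite invr_ge0 ltW.
  by have := ler_powRl ei x0 H; rewrite -powRrM mulfV ?gt_eqF// powRr1.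
by rewrite poweRyr ?gt_eqF ?invr_gt0.
Qed.

End complex_norm.

Theorem lemma5p1 (R : realType) (d : nat) (alpha omega p q s : R)
    (d23 : d = 2%N \/ d = 3%N)
    (omega_gt : omega_min d alpha < omega)
    (p_gt1 : 1 < p) (pq : p < q)
    (p_d3 : d = 3%N -> 3 / 2 < p /\ p < 3)
    (s_gt0 : 0 < s)
    (s_lt : s < d%:R / p - d%:R + 2)
    (s_eq : s / d%:R = 1 / p - 1 / q) :
  exists2 C : R, 0 < C &
    forall phi : 'rV[R]_d -> R[i], Hsp_alpha alpha p s omega phi ->
      cLfun (lebesgue_rV R d) q phi /\
      (cLnorm (lebesgue_rV R d) q phi <= C%:E * Hsp_norm alpha p s omega phi)%E.
Proof.
have p0 : 0 < p := lt_trans ltr01 p_gt1.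
have q0 : 0 < q := lt_trans p0 pq.
have q1 : 0 < q - 1 by rewrite subr_gt0 (lt_trans p_gt1).
have d0 : 0 < d%:R :> R by case: d23 => ->.
pose r := q / (q - 1); pose sg := s / d%:R; pose k : R := d%:R / 2.
have r1 : 1 < r by rewrite ltr_pdivlMr// mul1r gtrBl.
have sg0 : 0 < sg by rewrite divr_gt0.
have rE : r^-1 = 1 - q^-1 by rewrite /r; field; rewrite !gt_eqF.
have prs : p^-1 + r^-1 = 1 + sg by rewrite /sg s_eq rE !div1r; ring.
have ssg : s / 2 = k * sg by rewrite /k /sg; field; rewrite gt_eqF.
have k0 : 0 < k by rewrite divr_gt0.
have sE : s = d%:R * p^-1 - d%:R * q^-1.
  rewrite -mulrBr (_ : p^-1 - q^-1 = s / d%:R); last by rewrite s_eq !div1r.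
  by rewrite mulrC divfK ?gt_eqF.
have kp : 0 < k / p by rewrite divr_gt0.
have kr : 0 < k / r by rewrite divr_gt0// (lt_trans ltr01).
have al0 : 0 < 1 - k / p.
  rewrite subr_gt0 ltr_pdivrMr// mul1r /k.
  case: d23 => dE; first by rewrite dE divff.
  by rewrite dE; exact: (p_d3 dE).1.
(* As s = d/p - d/q, the hypothesis on [s] says d(1 - 1/q) < 2, that is k/r < 1. *)
have be0 : 0 < 1 - k / r.
  rewrite rE /k; move: s_lt; rewrite sE; lra.
(* This is s < 2, which follows from d/p < d. *)
have s2 : 0 < 1 - k * sg.
  have : d%:R / p < d%:R by rewrite ltr_pdivrMr// ltr_pMr.
  rewrite -ssg; move: s_lt; lra.
(* All three exponents lie strictly between 0 and 1, so half their minimum and 1 are admissible for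
   [b1] and [b2]. *)
pose m := Num.min (1 - k / p) (Num.min (1 - k / r) (1 - k * sg)).
have m0 : 0 < m by rewrite !lt_min al0 be0 s2.
pose b1 := m / 2.
have b10 : 0 < b1 by rewrite divr_gt0.
have b1m : b1 < m by rewrite ltr_pdivrMr// ltr_pMr// ltr1n.
have m1 : m <= 1 by rewrite ge_min gerBl ltW.
have b11 : b1 <= 1 by apply: le_trans m1; exact: ltW.
have bal : b1 < 1 - k / p < 1.
  by rewrite (lt_le_trans b1m) ?ge_min ?lexx//= gtrBl.
have bbe : b1 < 1 - k / r < 1.
  by rewrite (lt_le_trans b1m) ?ge_min ?lexx ?orbT//= gtrBl.
have bs : b1 < 1 - k * sg < 1.
  by rewrite (lt_le_trans b1m) ?ge_min ?lexx ?orbT//= gtrBl mulr_gt0.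
have [K K0 HK] := fractional_pairing d23 omega_gt p_gt1 r1 sg0 prs ssg b10 b11 bal bbe bs.
exists K => // phi Hphi.
pose f := frac_op alpha p s omega phi.
(* [xget] returns some preimage once one exists, and the estimate holds for every preimage. *)
have Hf : is_frac_resolvent alpha p s omega f phi by exact: (xgetPex _ Hphi).
have [[mf Lf] [mphi Lphi] _] := Hf.
have normphi : (cLnorm (lebesgue_rV R d) q phi <= K%:E * cLnorm (lebesgue_rV R d) p f)%E.
  have L0 : (0 <= cLnorm (lebesgue_rV R d) p f)%E by rewrite cLnormE// poweR_ge0.
  have fL : cLnorm (lebesgue_rV R d) p f \is a fin_num by rewrite ge0_fin_numE.
  move: L0; rewrite -(fineK fL); set L := fine _; rewrite lee_fin => L0.
  apply/lee_addgt0Pr => e e0; rewrite -EFinM -EFinD.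
  (* The slack e/K makes the normalisation possible even when the norm of [f] is 0, and costs only
     [e] in the final bound. *)
  pose lam := L + e / K.
  have lam0 : 0 < lam by rewrite ltr_wpDl// divr_gt0.
  have -> : K * L + e = K * lam by rewrite mulrDr mulrCA divff ?gt_eqF// mulr1.
  have Kl : 0 <= K * lam by rewrite mulr_ge0// ltW.
  apply/(cLnorm_le _ q0 Kl).
  pose v x := lam^-1 * Normc.normc (f x).
  have li : 0 <= lam^-1 by rewrite invr_ge0 ltW.
  have v0 x : 0 <= v x by rewrite mulr_ge0 ?normc_ge0'.
  have mnf := measurable_normc mf.
  have mv : measurable_fun setT v by exact: measurable_funM.
  have fv x : Normc.normc (f x) = lam * v x by rewrite mulVKf ?gt_eqF.
  have fl : (cLnorm (lebesgue_rV R d) p f <= lam%:E)%E.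
    by rewrite -(fineK fL) lee_fin lerDl divr_ge0// ltW.
  have v1 : (\int[lebrV R d]_x (v x `^ p)%:E <= 1)%E.
    under eq_integral do rewrite powRM ?normc_ge0'//.
    rewrite ge0_intZ ?powR_ge0//; [|by apply: measurable_fun_powR|by move=> x; exact: powR_ge0].
    apply: le_trans (lee_wpmul2l _ ((cLnorm_le f p0 (ltW lam0)).1 fl)) _.
      by rewrite lee_fin powR_ge0.
    by rewrite -EFinM -powRM ?(ltW lam0)// mulVf ?gt_eqF// powR1 lexx.
  have mnphi := measurable_normc mphi.
  apply: (@integral_powR_ub R d p q (K * lam) (fun x => Normc.normc (phi x))) => //.
  - by move=> x; exact: normc_ge0'.
  - have := Lphi; rewrite cLnormE// => H; rewrite ltey; apply/eqP => EE.
    by move: H; rewrite EE poweRyr// gt_eqF// invr_gt0.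
  move=> h mh h0 h1 hp.
  exact: (HK lam f phi v h (ltW lam0) Hf mv v0 fv v1 mh h0 h1 hp).
split => //; split => //.
by apply: (le_lt_trans normphi); rewrite lte_mul_pinfty// lee_fin ltW.
Qed.
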